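(* For each of the following profiles $\mathrm b$, one has for every $C\ge 0$ $$\limsup_{r\to\infty}\ \limsup_{n\to\infty}\ \mathbb P\left(\left|Z^{\mathrm b}[Cn^{2/3}]_n\right|\ge r n^{2/3}\right)=0:$$ (i) the narrow wedge $\mathrm w(0)=0$, $\mathrm w(k)=-\infty$ for $k\neq 0$; (ii) the flat profile $\mathrm f(k)=0$ for all $k\in\mathbb Z$; (iii) wedge to flat: $\mathrm{wf}(k)=-\infty$ for $k<0$ and $\mathrm{wf}(k)=0$ for $k\ge 0$; (iv) wedge to stationary: $\mathrm{ws}(k)=-\infty$ for $k<0$, $\mathrm{ws}(0)=0$, $\mathrm{ws}(k)=\sum_{i=1}^k\zeta_i$ for $k>0$; (v) flat to stationary: $\mathrm{fs}(k)=0$ for $k\le 0$, $\mathrm{fs}(k)=\sum_{i=1}^k\zeta_i$ for $k>0$; where in (iv) and (v) the $\zeta_i$ are i.i.d. copies of $X(1/2)$, independent of $\omega$.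
   Context: Let $\omega=\{\omega_{i,j}:(i,j)\in\mathbb Z^2,\ i+j>0\}$ be i.i.d. exponential random variables with parameter $1$. Write $(i,j)\le(k,l)$ if $i\le k$ and $j\le l$. An up-right path from $\mathbf x$ to $\mathbf y$ is a sequence $\mathbf x=\mathbf x_0,\dots,\mathbf x_m=\mathbf y$ with increments in $\{(1,0),(0,1)\}$; its passage time is $\sum_{i=1}^m\omega_{\mathbf x_i}$ (starting point excluded). For $\mathbf x=(i,j)\le\mathbf y$ with $i+j\ge0$, $L(\mathbf x,\mathbf y)$ is the maximal passage time over up-right paths from $\mathbf x$ to $\mathbf y$. Set $L_k(\mathbf x)=L((k,-k),\mathbf x)$ and $C^{\mathbf x}=\{k\in\mathbb Z:(k,-k)\le\mathbf x\}$. For integer $k$, $[k]_n:=(n+k,n-k)$; for real $x$, $[x]_n:=[\lfloor x\rfloor]_n$. For a profile $\mathrm b:\mathbb Z\to\mathbb R\cup\{-\infty\}$ with $\mathrm b(0)=0$ (possibly random and independent of $\omega$), $L^{\mathrm b}(\mathbf x):=\max_{k\in C^{\mathbf x}}\{\mathrm b(k)+L_k(\mathbf x)\}$, and the exit point $Z^{\mathrm b}(\mathbf x)$ is the largest $k\in C^{\mathbf x}$ attaining this maximum. For $\rho\in(0,1)$, $X(\rho):=E_1-E_2$ where $E_1,E_2$ are independent exponential variables with rates $1-\rho$ and $\rho$ respectively (means $1/(1-\rho)$ and $1/\rho$). *)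

(* Defs.v *)
From HB Require Import structures.
From mathcomp Require Import all_boot all_order all_algebra.
From mathcomp Require Import all_classical all_reals all_analysis.
Set Implicit Arguments. Unset Strict Implicit. Unset Printing Implicit Defensive.
Import Order.TTheory GRing.Theory Num.Theory.
Import numFieldTopology.Exports.

Local Open Scope classical_set_scope.
Local Open Scope ring_scope.

Definition pt := (int * int)%type.

(** Boolean words of length m; [true] = step (1,0), [false] = step (0,1). *)
Fixpoint words (m : nat) : seq (seq bool) :=
  if m is m'.+1 then [seq b :: w | b <- [:: true; false], w <- words m']
  else [:: [::]].

(** Points x_1, ..., x_m visited by the up-right path from x coded by w
    (starting point excluded). *)
Fixpoint path_pts (x : pt) (w : seq bool) : seq pt :=
  if w is b :: w' then
    let x' := if b then (x.1 + 1, x.2) else (x.1, x.2 + 1) in x' :: path_pts x' w'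
  else [::].

Section LPP.
Context {R : realType}.
Implicit Types (om : pt -> R) (b : int -> \bar R).

Definition passage om (x : pt) (w : seq bool) : R :=
  \sum_(p <- path_pts x w) om p.

(** L(x,y): maximal passage time over up-right paths from x to y
    (every up-right path from x to y has (y1-x1)+(y2-x2) steps). *)
Definition LPP om (x y : pt) : \bar R :=
  \big[maxe/-oo%E]_(w <- words (absz ((y.1 - x.1) + (y.2 - x.2)))
                    | last x (path_pts x w) == y) (passage om x w)%:E.

Definition Lk om (k : int) (x : pt) : \bar R := LPP om (k, - k) x.

(** C^x = {k : (k,-k) <= x} = {-x2, ..., x1}, listed increasingly *)
Definition Cset (x : pt) : seq int :=
  if (0 <= x.1 + x.2) then [seq - x.2 + (i%:Z) | i <- iota 0 (absz (x.1 + x.2)).+1]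
  else [::].


Definition Lb b om (x : pt) : \bar R :=
  \big[maxe/-oo%E]_(k <- Cset x) (b k + Lk om k x)%E.

Definition Zb b om (x : pt) : int :=
  \big[Num.max/(- x.2)]_(k <- Cset x | (b k + Lk om k x)%E == Lb b om x) k.

Definition brk (k : int) (n : nat) : pt := (n%:Z + k, n%:Z - k).
Definition brkR (x : R) (n : nat) : pt := brk (Num.floor x) n.

Definition prof_w : int -> \bar R := fun k => if k == 0 then 0%E else -oo%E.
Definition prof_f : int -> \bar R := fun _ => 0%E.
Definition prof_wf : int -> \bar R := fun k => if k < 0 then -oo%E else 0%E.
(** random profiles built from zeta_1, zeta_2, ... (zeta 0 unused) *)
Definition prof_ws (zeta : nat -> R) : int -> \bar R :=
  fun k => if k < 0 then -oo%E else (\sum_(0 <= i < absz k) zeta i.+1)%:E.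
Definition prof_fs (zeta : nat -> R) : int -> \bar R :=
  fun k => if k <= 0 then 0%E else (\sum_(0 <= i < absz k) zeta i.+1)%:E.

Definition law_X (rho : R) : set R -> \bar R :=
  pushforward (product_measure1 (exponential_prob (1 - rho)) (exponential_prob rho))
    (fun xy : R * R => xy.1 - xy.2).

Definition mutually_independent {d} {T : measurableType d} (P : probability T R)
    {I : eqType} (D : I -> Prop) (Y : I -> T -> R) : Prop :=
  forall (s : seq I) (B : I -> set R),
    uniq s -> (forall i, i \in s -> D i) -> (forall i, measurable (B i)) ->
    P (\big[setI/setT]_(i <- s) (Y i @^-1` B i)) = (\prod_(i <- s) P (Y i @^-1` B i))%E.

Definition exit_tail {d} {T : measurableType d} (P : probability T R)
    (b : T -> int -> \bar R) (om : T -> pt -> R) (C : R) : \bar R :=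
  limf_esup (fun r : R =>
     limn_esup (fun n : nat =>
       P [set t | r * (n%:R `^ (2%:R / 3%:R)) <=
                  ((`|Zb (b t) (om t) (brkR (C * (n%:R `^ (2%:R / 3%:R))) n)|%R : int)%:~R)]))
   +oo%R.

End LPP.

(* Main.v *)
(* In coordinates read backwards from the end point, the passage times L_k are
   differences along an antidiagonal of an exponential last passage model. Putting
   independent exponential weights of rates 1 - rho and rho on the axes makes the
   model stationary (Burke): its antidiagonal increments are independent, with an
   explicit law. If the geodesic of the stationary model leaves through the
   vertical axis, the stationary increments dominate the original ones. The
   probability of the opposite exit follows from the exact exponential moments of
   the stationary passage time (tilt the vertical axis, then apply Burke). With
   rho = 1/2 + c r n^(-1/3) this shows that k -> L_k drops by at least a constant
   times r n^(-1/3) k for all k >= r n^(2/3), up to probability O(exp(- c r^3)).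
   Both sides follow by reflection. A profile that is nonpositive, or a centred
   random walk, cannot make up for this drop, so k is not a maximizer. *)
Require Import Defs.
From HB Require Import structures.
From mathcomp Require Import all_boot all_order all_algebra.
From mathcomp Require Import all_classical all_reals all_analysis.
From mathcomp Require Import measurable_realfun ring lra zify.
Set Implicit Arguments. Unset Strict Implicit. Unset Printing Implicit Defensive.
Import Order.TTheory GRing.Theory Num.Theory.
Import numFieldTopology.Exports.
Local Open Scope classical_set_scope.
Local Open Scope ring_scope.

Import HBNNSimple.

(** * Densities and exponential integrals *)

(** No single density works. Near the diagonal a density above [1 / 2] gives the stationary
    increments a downward drift, but the geodesic then tends to leave through the horizontal axis
    and nothing can be compared; a density below [1 / 2] gives the right exit, but an upward drift.
    Hence two comparisons. A density slightly below [1 / 2], used at [(a, b)], keeps the first [k]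
    steps from rising much, with [k] about [r n^(2/3) / 4]. The point [(a - k, b + k)] lies far
    enough above the diagonal for the vertical exit to prevail at a density [1 / 2 + eps], and from
    there on the passage times drop. The cube in the exponent is [eps^2] times the length
    [r n^(2/3)], with [eps] of order [r n^(-1/3)]; exit probabilities and walk deviations both have
    this order. The drop is needed for all [k] simultaneously, and a union bound over the times of a
    walk would cost a factor of order [n^(2/3)]; a maximal inequality for exponentials of the walk
    avoids this loss. *)

Section density.
Context {R : realType} {d : measure_display} {T : measurableType d}.
Local Open Scope ereal_scope.

(** Bootstrapping from indicators to simple functions, then monotone convergence on both sides. It
    serves the exponential densities as well as the later changes of measure. *)
Lemma ge0_integral_density (mu nu : {measure set T -> \bar R}) (g : T -> R)
    (f : T -> \bar R) :
  measurable_fun setT g -> (forall x, (0 <= g x)%R) ->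
  (forall A, measurable A -> nu A = \int[mu]_(x in A) (g x)%:E) ->
  measurable_fun setT f -> (forall x, 0 <= f x) ->
  \int[nu]_x f x = \int[mu]_x (f x * (g x)%:E).
Proof.
move=> mg g0 nuE mf f0.
have mgE : measurable_fun setT (fun x => (g x)%:E) by exact/measurable_EFinP.
have indE A : measurable A -> \int[nu]_x (\1_A x)%:E = \int[mu]_x ((\1_A x)%:E * (g x)%:E).
  move=> mA; rewrite integral_indic// setIT nuE// integral_mkcond.
  apply: eq_integral => x _; rewrite patchE indicE.
  by case: (x \in A); rewrite ?mul1e ?mul0e.
pose h := nnsfun_approx measurableT mf.
have hE n : \int[nu]_x (h n x)%:E = \int[mu]_x ((h n x)%:E * (g x)%:E).
  under eq_integral do rewrite fimfunE -fsumEFin//.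
  rewrite ge0_integral_fsum//; last 2 first.
  - by move=> r; exact/measurable_EFinP/measurableT_comp.
  - by move=> m x _; rewrite nnfun_muleindic_ge0.
  under [RHS]eq_integral => x _.
    rewrite fimfunE -fsumEFin// muleC ge0_mule_fsumr; last first.
      by move=> r; rewrite EFinM nnfun_muleindic_ge0.
    over.
  rewrite [RHS]ge0_integral_fsum//; last 2 first.
  - move=> r; apply: emeasurable_funM => //.
    by apply/measurable_EFinP; exact: measurable_funM.
  - by move=> m x _; rewrite mule_ge0 ?nnfun_muleindic_ge0 ?lee_fin.
  apply: eq_fsbigr => r _.
  rewrite integralZl_indic_nnsfun// indE//.
  have [r0|r0] := leP 0%R r; last first.
    rewrite preimage_nnfun0//; rewrite [in LHS]integral0_eq ?mule0; last first.
      by move=> x _; rewrite indicE in_set0 mul0e.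
    by rewrite integral0_eq// => x _; rewrite indicE in_set0 mulr0 mule0.
  rewrite -ge0_integralZl//; last 2 first.
  - by apply: emeasurable_funM => //; exact/measurable_EFinP.
  - by move=> x _; rewrite mule_ge0 ?lee_fin.
  by apply: eq_integral => x _; rewrite EFinM muleA [RHS]muleC.
transitivity (limn (fun n => \int[nu]_x (h n x)%:E)).
  rewrite -monotone_convergence//=.
  - apply: eq_integral => x _; apply/esym/cvg_lim => //=.
    exact: cvg_nnsfun_approx.
  - by move=> n; exact/measurable_EFinP.
  - by move=> n x _; rewrite lee_fin.
  - by move=> x _ m n mn; rewrite lee_fin; exact/lefP/nd_nnsfun_approx.
rewrite [X in limn X](_ : _ = fun n => \int[mu]_x ((h n x)%:E * (g x)%:E)); last first.
  exact/funext.
rewrite -monotone_convergence//=.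
- apply: eq_integral => x _; apply/cvg_lim => //=.
  by apply: cvgeZr => //; exact: cvg_nnsfun_approx.
- by move=> n; apply: emeasurable_funM => //; exact/measurable_EFinP.
- by move=> n x _; rewrite mule_ge0 ?lee_fin.
- move=> x _ m n mn; rewrite lee_wpmul2r ?lee_fin//.
  by apply/lefP/nd_nnsfun_approx.
Qed.

End density.

Section density_measure.
Context {R : realType} {d : measure_display} {T : measurableType d}.
Variables (mu : {measure set T -> \bar R}) (g : T -> R).
Hypotheses (mg : measurable_fun setT g) (g0 : forall x, 0 <= g x).

(** The two proofs are arguments so that the measure structure declared below can be attached to
    this set function. *)
Definition dens of measurable_fun setT g & (forall x, 0 <= g x) :=
  fun A : set T => (\int[mu]_(x in A) (g x)%:E)%E.

Let nu := dens mg g0.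

Let nu0 : nu set0 = 0%E.
Proof. by rewrite /nu /dens integral_set0. Qed.

Let nu_ge0 A : (0 <= nu A)%E.
Proof. by rewrite /nu /dens integral_ge0//= => x _; rewrite lee_fin. Qed.

Let nu_sigma_additive : semi_sigma_additive nu.
Proof.
move=> /= F mF tF mUF; rewrite /nu /dens; apply: cvg_toP.
  by apply: is_cvg_ereal_nneg_natsum => n _; exact: nu_ge0.
rewrite ge0_integral_bigcup//=; first exact/measurable_funTS/measurableT_comp.
by move=> x _; rewrite lee_fin.
Qed.

HB.instance Definition _ := isMeasure.Build _ _ _ nu nu0 nu_ge0 nu_sigma_additive.

Lemma density_probability : (\int[mu]_x (g x)%:E = 1)%E ->
  exists Q : probability T R,
    (forall A, measurable A -> Q A = \int[mu]_(x in A) (g x)%:E)%E.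
Proof.
move=> g1; have nuT : nu setT = 1%E by [].
pose m := Measure_isProbability.Build _ _ R nu nuT.
pose Q : probability T R := HB.pack nu m.
by exists Q.
Qed.

End density_measure.

Definition image_measure {R : realType} {d d'} {T : measurableType d}
    {T' : measurableType d'} (mu : {measure set T -> \bar R}) (f : T -> T')
    (mf : measurable_fun setT f) : {measure set T' -> \bar R} :=
  measure_function_pushforward__canonical__measure_function_Measure mu mf.

Definition exponential_law {R : realType} (l : R) (l0 : 0 < l) :
    probability (measurableTypeR R) R :=
  exponential_distribution_exponential_prob__canonical__probability_measure_Probability l0.

Section product_law.
Context {R : realType} {d1 d2} {T1 : measurableType d1} {T2 : measurableType d2}.
Variables (P1 : probability T1 R) (P2 : probability T2 R).
Local Open Scope ereal_scope.

Definition product_law : probability (T1 * T2)%type R :=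
  [the probability _ _ of P1 \x P2].

Variable f : T1 * T2 -> \bar R.
Hypotheses (mf : measurable_fun setT f) (f0 : forall x, 0 <= f x).

Lemma integral_product_law1 :
  \int[product_law]_z f z = \int[P1]_x \int[P2]_y f (x, y).
Proof. exact: fubini_tonelli1. Qed.

Lemma integral_product_law2 :
  \int[product_law]_z f z = \int[P2]_y \int[P1]_x f (x, y).
Proof. exact: fubini_tonelli2. Qed.

End product_law.

Section exponential_integrals.
Context {R : realType}.
Local Notation mu := (@lebesgue_measure R).
Local Open Scope ereal_scope.
Implicit Types (f : R -> \bar R) (l a s : R).

Lemma measurable_affine l a :
  measurable_fun setT ((fun y => l * y + a)%R : measurableTypeR R -> measurableTypeR R).
Proof. by apply: measurable_funD => //; exact: measurable_funM. Qed.

(** The rescaled image measure agrees with Lebesgue measure on half-open intervals; uniqueness of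
    the latter does the rest. *)
Lemma lebesgue_measure_affine l a (A : set R) : (0 < l)%R -> measurable A ->
  l%:E * mu ((fun y => l * y + a)%R @^-1` A) = mu A.
Proof.
move=> l0 mA.
pose l' : {nonneg R} := NngNum (ltW l0).
pose phi : measurableTypeR R -> measurableTypeR R := (fun y => l * y + a)%R.
have mphi : measurable_fun setT phi by exact: measurable_affine.
pose m : {measure set (measurableTypeR R) -> \bar R} := mscale l' (image_measure mu mphi).
suff: forall X, measurable X -> mu X = m X by move=> /(_ A mA) ->.
apply: lebesgue_measure_unique => _ [[u v]] _ <-.
rewrite /m /= /mscale /= /pushforward.
rewrite (_ : phi @^-1` _ = `](((u - a) / l)%R), (((v - a) / l)%R)]%classic); last first.
  apply/seteqP; split => x /=; rewrite !in_itv/= /phi ltr_pdivrMr// ler_pdivlMr//.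
    by rewrite ltrBlDr lerBrDr (mulrC x).
  by rewrite ltrBlDr lerBrDr (mulrC x).
rewrite !lebesgue_measure_itv/= !lte_fin ltr_pM2r ?invr_gt0// ltrD2r.
case: ifPn => uv; last by rewrite mule0.
rewrite -!EFinD -EFinM; congr EFin; field; exact: lt0r_neq0.
Qed.

Lemma integral_affine l a f : (0 < l)%R -> measurable_fun setT f ->
  (forall x, 0 <= f x) ->
  \int[mu]_x f x = l%:E * \int[mu]_x f (l * x + a)%R.
Proof.
move=> l0 mf f0.
pose l' : {nonneg R} := NngNum (ltW l0).
pose phi : measurableTypeR R -> measurableTypeR R := (fun y => l * y + a)%R.
have mphi : measurable_fun setT phi by exact: measurable_affine.
pose m : {measure set (measurableTypeR R) -> \bar R} := mscale l' (image_measure mu mphi).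
rewrite -[in RHS](@preimage_setT _ _ phi).
rewrite -[X in _ = _ * X](@ge0_integral_pushforward _ _ _ _ R phi mphi mu setT f)//.
rewrite -[RHS](@ge0_integral_mscale _ _ _ (image_measure mu mphi) setT measurableT l' f)//.
apply: (@eq_measure_integral _ _ _ _ m) => A mA _; first [exact: (lebesgue_measure_affine a l0 mA)|exact: (esym (lebesgue_measure_affine a l0 mA))].
Qed.

Lemma integral_exponential l f : (0 < l)%R -> measurable_fun setT f ->
  (forall x, 0 <= f x) ->
  \int[exponential_prob l]_x f x = \int[mu]_x (f x * (exponential_pdf l x)%:E).
Proof.
move=> l0 mf f0.
apply: (@ge0_integral_density _ _ _ mu (exponential_law l0) (exponential_pdf l)) => //.
- exact: measurable_exponential_pdf.
- by move=> x; exact/exponential_pdf_ge0/ltW.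
Qed.

Lemma eq_exponential_integral l f g : (0 < l)%R ->
  measurable_fun setT f -> (forall x, 0 <= f x) ->
  measurable_fun setT g -> (forall x, 0 <= g x) ->
  (forall x, (0 <= x)%R -> f x = g x) ->
  \int[exponential_prob l]_x f x = \int[exponential_prob l]_x g x.
Proof.
move=> l0 mf f0 mg g0 fg; rewrite !integral_exponential//.
apply: eq_integral => x _; have [x0|x0] := leP 0%R x; first by rewrite fg.
by rewrite lt0_exponential_pdf// !mule0.
Qed.

Lemma exponential_integral_ge0 l f : (0 < l)%R -> (forall x, 0 <= f x) ->
  0 <= \int[exponential_prob l]_x f x.
Proof. by move=> l0 f0; exact: (@integral_ge0 _ _ _ (exponential_law l0)). Qed.

Lemma exponential_integralD l f g : (0 < l)%R ->
  measurable_fun setT f -> (forall x, 0 <= f x) ->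
  measurable_fun setT g -> (forall x, 0 <= g x) ->
  \int[exponential_prob l]_x (f x + g x) =
  \int[exponential_prob l]_x f x + \int[exponential_prob l]_x g x.
Proof.
by move=> l0 mf f0 mg g0; exact: (@ge0_integralD _ _ _ (exponential_law l0)).
Qed.

Lemma exponential_integralZl l (k : \bar R) f : (0 < l)%R -> 0 <= k ->
  measurable_fun setT f -> (forall x, 0 <= f x) ->
  \int[exponential_prob l]_x (k * f x) = k * \int[exponential_prob l]_x f x.
Proof.
by move=> l0 k0 mf f0; exact: (@ge0_integralZl _ _ _ (exponential_law l0)).
Qed.

Lemma exponential_integral_cst l (c : \bar R) : (0 < l)%R ->
  \int[exponential_prob l]_x c = c.
Proof.
move=> l0.
have lT := @probability_setT _ _ _ (exponential_law l0).
by rewrite (@integral_cst _ _ _ (exponential_law l0))// -[RHS]mule1; congr (_ * _).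
Qed.

(** Multiplying the density of rate [l] by [expR (s * x)] gives, up to the constant [l / (l - s)],
    the density of rate [l - s]; [s] may be negative. Moment generating functions and tilted laws
    below all come from this identity. *)
Lemma exponential_tilt l s f : (0 < l)%R -> (s < l)%R ->
  measurable_fun setT f -> (forall x, 0 <= f x) ->
  \int[exponential_prob l]_x ((expR (s * x))%:E * f x) =
  (l / (l - s))%:E * \int[exponential_prob (l - s)]_x f x.
Proof.
move=> l0 sl mf f0; have ls0 : (0 < l - s)%R by rewrite subr_gt0.
have me : measurable_fun setT (fun x => (expR (s * x))%:E : \bar R).
  apply/measurable_EFinP; apply: measurableT_comp => //.
rewrite !integral_exponential//; last 2 first.
- exact: emeasurable_funM.
- by move=> x; rewrite mule_ge0// lee_fin expR_ge0.
rewrite -ge0_integralZl//; last 3 first.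
- apply: emeasurable_funM => //; apply/measurable_EFinP.
  exact: measurable_exponential_pdf.
- by move=> x _; rewrite mule_ge0// lee_fin exponential_pdf_ge0// ltW.
- by rewrite lee_fin divr_ge0// ltW.
apply: eq_integral => x _.
have [x0|x0] := leP 0%R x; last first.
  by rewrite !lt0_exponential_pdf// !mule0.
rewrite !exponential_pdfE// [RHS]muleCA (muleC _ (f x)) -!muleA -!EFinM.
congr (_ * _%:E); rewrite [in RHS]mulrA divfK ?gt_eqF//.
by rewrite mulrCA -expRD; congr (_ * expR _)%R; ring.
Qed.

(** The memoryless property in integrated form. *)
Lemma exponential_shift l a f : (0 < l)%R -> (0 <= a)%R ->
  measurable_fun setT f -> (forall x, 0 <= f x) ->
  \int[exponential_prob l]_x (f x * (a <= x)%R%:R%:E) =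
  (expR (- (l * a)))%:E * \int[exponential_prob l]_x f (x + a)%R.
Proof.
move=> l0 a0 mf f0.
have mi : measurable_fun setT (fun x : R => ((a <= x)%R%:R)%:E : \bar R).
  apply/measurable_EFinP; rewrite (_ : (fun _ => _) = \1_`[a, +oo[%classic)//.
  by apply/funext => x; rewrite indicE mem_setE in_itv/= andbT.
have mp : measurable_fun setT (fun x : R => (exponential_pdf l x)%:E).
  by apply/measurable_EFinP; exact: measurable_exponential_pdf.
have mshift : measurable_fun setT (fun x : R => x + a : R)%R by exact: measurable_funD.
rewrite !integral_exponential//; last 3 first.
- exact: measurableT_comp.
- exact: emeasurable_funM.
- by move=> x; rewrite mule_ge0// lee_fin.
rewrite (@integral_affine 1 a) ?mul1e//; last 2 first.
- exact: emeasurable_funM (emeasurable_funM mf mi) mp.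
- by move=> x; rewrite !mule_ge0// lee_fin// exponential_pdf_ge0// ltW.
rewrite -ge0_integralZl//; last 2 first.
- exact: emeasurable_funM (measurableT_comp mf mshift) mp.
- by move=> x _; rewrite mule_ge0// lee_fin exponential_pdf_ge0// ltW.
apply: eq_integral => x _; rewrite mul1r lerDr.
have [x0|x0] := leP 0%R x; last first.
  by rewrite [exponential_pdf l x]lt0_exponential_pdf// !mule0 mul0e.
rewrite mule1 !exponential_pdfE ?addr_ge0// [RHS]muleCA -EFinM; congr (_ * _%:E).
by rewrite mulrCA -expRD; congr (_ * expR _)%R; ring.
Qed.

(** The events [a <= x] and [a < x] differ by a Lebesgue-null point. *)
Lemma exponential_shift_lt l a f : (0 < l)%R -> (0 <= a)%R ->
  measurable_fun setT f -> (forall x, 0 <= f x) ->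
  \int[exponential_prob l]_x (f x * (a < x)%R%:R%:E) =
  (expR (- (l * a)))%:E * \int[exponential_prob l]_x f (x + a)%R.
Proof.
move=> l0 a0 mf f0; rewrite -exponential_shift//.
have mi : measurable_fun setT (fun x : R => ((a <= x)%R%:R)%:E : \bar R).
  apply/measurable_EFinP; rewrite (_ : (fun _ => _) = \1_`[a, +oo[%classic)//.
  by apply/funext => x; rewrite indicE mem_setE in_itv/= andbT.
have mi' : measurable_fun setT (fun x : R => ((a < x)%R%:R)%:E : \bar R).
  apply/measurable_EFinP; rewrite (_ : (fun _ => _) = \1_`]a, +oo[%classic)//.
  by apply/funext => x; rewrite indicE mem_setE in_itv/= andbT.
have mp : measurable_fun setT (fun x : R => (exponential_pdf l x)%:E).
  by apply/measurable_EFinP; exact: measurable_exponential_pdf.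
rewrite !integral_exponential//; last 4 first.
- exact: emeasurable_funM.
- by move=> x; rewrite mule_ge0// lee_fin.
- exact: emeasurable_funM.
- by move=> x; rewrite mule_ge0// lee_fin.
have mD : measurable ([set: R] `\ a) by exact: measurableD.
rewrite -[LHS](@integral_setD1 _ _ a setT)//; last first.
  by apply: measurable_funTS; exact: emeasurable_funM (emeasurable_funM mf _) mp.
rewrite -[RHS](@integral_setD1 _ _ a setT)//; last first.
  by apply: measurable_funTS; exact: emeasurable_funM (emeasurable_funM mf _) mp.
apply: eq_integral => x; rewrite inE/= => -[_ xa].
by rewrite [in LHS]lt_neqAle eq_sym; move/eqP: xa => ->.
Qed.

Lemma exponential_scale l f : (0 < l)%R ->
  measurable_fun setT f -> (forall x, 0 <= f x) ->
  \int[exponential_prob 1]_x f (x / l)%R = \int[exponential_prob l]_x f x.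
Proof.
move=> l0 mf f0.
have mp r : measurable_fun setT (fun x : R => (exponential_pdf r x)%:E).
  by apply/measurable_EFinP; exact: measurable_exponential_pdf.
have mdiv : measurable_fun setT (fun x : R => x / l : R)%R by exact: measurable_funM.
have mfd : measurable_fun setT (fun x : R => f (x / l)%R) := measurableT_comp mf mdiv.
apply: (etrans (integral_exponential ltr01 mfd (fun x => f0 (x / l)%R))).
apply: (etrans _ (esym (integral_exponential l0 mf f0))).
rewrite (@integral_affine l 0)//; last 2 first.
- exact: emeasurable_funM (measurableT_comp mf mdiv) (mp _).
- by move=> x; rewrite mule_ge0// lee_fin exponential_pdf_ge0.
rewrite -ge0_integralZl//; last 3 first.
- have ml : measurable_fun setT (fun x : R => l * x + 0 : R)%R.
    by apply: measurable_funD => //; exact: measurable_funM.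
  apply: emeasurable_funM.
    apply: (measurableT_comp mf); exact: (measurableT_comp mdiv).
  exact: (measurableT_comp (mp 1%R)).
- by move=> x _; rewrite mule_ge0// lee_fin exponential_pdf_ge0.
- by rewrite lee_fin ltW.
apply: eq_integral => x _; rewrite addr0 mulrAC mulfV ?gt_eqF// mul1r.
rewrite muleCA; congr (_ * _); have [x0|x0] := leP 0%R x; last first.
  by rewrite !lt0_exponential_pdf ?mule0// pmulr_rlt0.
by rewrite !exponential_pdfE ?mulr_ge0 ?(ltW l0)// -EFinM mul1r mulN1r mulNr.
Qed.

End exponential_integrals.

(** * The Burke property of one cell *)

Section burke.
Context {R : realType}.
Local Notation mR := (measurableTypeR R).
Local Open Scope ereal_scope.
Implicit Types (f g h : R -> \bar R).

Lemma measurable_bool_EFin d (T : measurableType d) (b : T -> bool) :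
  measurable_fun setT b -> measurable_fun setT (fun x => ((b x)%:R : R)%:E).
Proof.
move=> mb; apply/measurable_EFinP.
rewrite (_ : (fun _ => _) = (fun x => if b x then 1%R else 0%R)).
  exact: measurable_fun_ifT.
by apply/funext => x; case: (b x).
Qed.

(** By the memoryless property the excess of [p.1] over [p.2] has rate [l] whatever the value of
    [p.2]; the constant is the probability that [p.2 <= p.1]. *)
Lemma exponential_wedge (l m : R) (l0 : (0 < l)%R) (m0 : (0 < m)%R) h :
  measurable_fun setT h -> (forall x, 0 <= h x) ->
  \int[product_law (exponential_law l0) (exponential_law m0)]_p
    (h (p.1 - p.2)%R * ((p.2 <= p.1)%R%:R)%:E) =
  (m / (l + m))%:E * \int[exponential_prob l]_x h x.
Proof.
move=> mh h0.
have m1 : measurable_fun setT (fun p : mR * mR => h (p.1 - p.2)%R).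
  by apply: measurableT_comp => //; exact: measurable_funB.
have m2 : measurable_fun setT (fun p : mR * mR => (((p.2 <= p.1)%R)%:R : R)%:E).
  apply: measurable_bool_EFin; exact: measurable_fun_ler.
rewrite integral_product_law2//=; last 2 first.
- exact: emeasurable_funM.
- by move=> x; rewrite mule_ge0// lee_fin.
transitivity (\int[exponential_prob m]_y ((expR (- l * y))%:E * \int[exponential_prob l]_x h x)).
  apply: eq_exponential_integral.
  - by [].
  - apply: (@measurable_fun_fubini_tonelli_G _ _ _ _ _ (exponential_law l0) (fun p : mR * mR => h (p.1 - p.2)%R * (((p.2 <= p.1)%R)%:R)%:E)).
    - exact: emeasurable_funM.
    - by move=> x; rewrite mule_ge0// lee_fin.
  - move=> x; apply: exponential_integral_ge0 => // y; by rewrite mule_ge0// lee_fin.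
  - apply: emeasurable_funM => //; apply/measurable_EFinP.
    apply: measurableT_comp => //.
  - move=> x; rewrite mule_ge0// ?lee_fin ?expR_ge0//.
    exact: exponential_integral_ge0.
  move=> y y0.
  rewrite (@exponential_shift _ l y (fun x => h (x - y)%R))//; last first.
    by apply: measurableT_comp => //; exact: measurable_funB.
  rewrite mulNr; congr (_ * _); congr integral; apply/funext => x.
  by rewrite addrK.
have lm : (- l < m)%R by rewrite (lt_trans _ m0)// oppr_lt0.
have c0 : 0 <= \int[exponential_prob l]_x h x by exact: exponential_integral_ge0.
apply: (etrans (exponential_tilt m0 lm (measurable_cst _) (fun=> c0))).
by rewrite opprK addrC exponential_integral_cst ?addr_gt0.
Qed.

Lemma exponential_wedge_lt (l m : R) (l0 : (0 < l)%R) (m0 : (0 < m)%R) h :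
  measurable_fun setT h -> (forall x, 0 <= h x) ->
  \int[product_law (exponential_law l0) (exponential_law m0)]_p
    (h (p.2 - p.1)%R * ((p.1 < p.2)%R%:R)%:E) =
  (l / (l + m))%:E * \int[exponential_prob m]_x h x.
Proof.
move=> mh h0.
have m1 : measurable_fun setT (fun p : mR * mR => h (p.2 - p.1)%R).
  by apply: measurableT_comp => //; exact: measurable_funB.
have m2 : measurable_fun setT (fun p : mR * mR => (((p.1 < p.2)%R)%:R : R)%:E).
  apply: measurable_bool_EFin; exact: measurable_fun_ltr.
rewrite integral_product_law1//=; last 2 first.
- exact: emeasurable_funM.
- by move=> x; rewrite mule_ge0// lee_fin.
transitivity (\int[exponential_prob l]_y ((expR (- m * y))%:E * \int[exponential_prob m]_x h x)).
  apply: eq_exponential_integral.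
  - by [].
  - apply: (@measurable_fun_fubini_tonelli_F _ _ _ _ _ (exponential_law m0) (fun p : mR * mR => h (p.2 - p.1)%R * (((p.1 < p.2)%R)%:R)%:E)).
    - exact: emeasurable_funM.
    - by move=> x; rewrite mule_ge0// lee_fin.
  - move=> x; apply: exponential_integral_ge0 => // y; by rewrite mule_ge0// lee_fin.
  - apply: emeasurable_funM => //; apply/measurable_EFinP.
    apply: measurableT_comp => //.
  - move=> x; rewrite mule_ge0// ?lee_fin ?expR_ge0//.
    exact: exponential_integral_ge0.
  move=> y y0.
  rewrite (@exponential_shift_lt _ m y (fun x => h (x - y)%R))//; last first.
    by apply: measurableT_comp => //; exact: measurable_funB.
  rewrite mulNr; congr (_ * _); congr integral; apply/funext => x.
  by rewrite addrK.
have lm : (- m < l)%R by rewrite (lt_trans _ l0)// oppr_lt0.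
have c0 : 0 <= \int[exponential_prob m]_x h x by exact: exponential_integral_ge0.
apply: (etrans (exponential_tilt l0 lm (measurable_cst _) (fun=> c0))).
by rewrite opprK exponential_integral_cst ?addr_gt0.
Qed.

(** For independent [X], [Y] of rates [a], [b], the minimum has rate [a + b = 1] and is independent
    of [X - Y]. Replacing it by an independent weight of rate 1 therefore does not change the joint
    law of the pair [min + (X - Y)^+], [min + (Y - X)^+], which is [(X, Y)]. *)
Lemma burke_integral (a b : R) (a0 : (0 < a)%R) (b0 : (0 < b)%R) f g :
  (a + b = 1)%R ->
  measurable_fun setT f -> (forall x, 0 <= f x) ->
  measurable_fun setT g -> (forall x, 0 <= g x) ->
  \int[product_law (exponential_law ltr01) (product_law (exponential_law a0) (exponential_law b0))]_p
    (f (p.1 + Num.max 0 (p.2.1 - p.2.2))%R * g (p.1 + Num.max 0 (p.2.2 - p.2.1))%R) =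
  \int[exponential_prob a]_x f x * \int[exponential_prob b]_x g x.
Proof.
move=> ab mf f0 mg g0.
have m1 : measurable_fun setT (fun p : mR * (mR * mR) => (p.1 + Num.max 0 (p.2.1 - p.2.2))%R : mR).
  apply: measurable_funD => //; apply: measurable_maxr => //.
  by apply: measurable_funB; apply: measurableT_comp.
have m2 : measurable_fun setT (fun p : mR * (mR * mR) => (p.1 + Num.max 0 (p.2.2 - p.2.1))%R : mR).
  apply: measurable_funD => //; apply: measurable_maxr => //.
  by apply: measurable_funB; apply: measurableT_comp.
have mF : measurable_fun setT (fun p : mR * (mR * mR) =>
   (f (p.1 + Num.max 0 (p.2.1 - p.2.2))%R * g (p.1 + Num.max 0 (p.2.2 - p.2.1))%R)).
  by apply: emeasurable_funM; exact: measurableT_comp.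
rewrite integral_product_law1//=; last by move=> x; rewrite mule_ge0.
have mfg (h k : R -> \bar R) (r : rel R) : measurable_fun setT h -> measurable_fun setT k ->
    measurable_fun setT (fun p : mR * mR => r p.1 p.2) ->
    measurable_fun setT (fun p : mR * mR => h p.1 * k p.2 * ((r p.1 p.2)%:R : R)%:E).
  move=> mh mk mr; apply: emeasurable_funM; last exact: measurable_bool_EFin.
  by apply: emeasurable_funM; exact: measurableT_comp.
(* The weight [w] is the smaller of the two outputs: [Phi] collects the case where the argument of
   [g] equals [w], [Psi] the case where the argument of [f] does. *)
pose Phi w := \int[exponential_prob a]_x (g w * f x * ((w <= x)%R%:R)%:E).
pose Psi w := \int[exponential_prob b]_x (f w * g x * ((w < x)%R%:R)%:E).
have Phi0 w : 0 <= Phi w.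
  by apply: exponential_integral_ge0 => // x; rewrite !mule_ge0// lee_fin.
have Psi0 w : 0 <= Psi w.
  by apply: exponential_integral_ge0 => // x; rewrite !mule_ge0// lee_fin.
have mle : measurable_fun setT (fun p : mR * mR => p.1 <= p.2)%R by exact: measurable_fun_ler.
have mlt : measurable_fun setT (fun p : mR * mR => p.1 < p.2)%R by exact: measurable_fun_ltr.
have mPhi : measurable_fun setT Phi.
  apply: (@measurable_fun_fubini_tonelli_F _ _ _ _ _ (exponential_law a0)
    (fun p : mR * mR => g p.1 * f p.2 * ((p.1 <= p.2)%R%:R)%:E)).
    exact: (mfg _ _ (fun x y => x <= y)%R).
  by move=> x; rewrite !mule_ge0// lee_fin.
have mPsi : measurable_fun setT Psi.
  apply: (@measurable_fun_fubini_tonelli_F _ _ _ _ _ (exponential_law b0)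
    (fun p : mR * mR => f p.1 * g p.2 * ((p.1 < p.2)%R%:R)%:E)).
    exact: (mfg _ _ (fun x y => x < y)%R).
  by move=> x; rewrite !mule_ge0// lee_fin.
have mexp (c : R) : measurable_fun setT (fun w : R => (expR (c * w))%:E : \bar R).
  by apply/measurable_EFinP; apply: measurableT_comp.
have mP1 : measurable_fun setT (fun w => (expR (a * w))%:E * Phi w).
  exact: emeasurable_funM (mexp a) mPhi.
have mP2 : measurable_fun setT (fun w => (expR (b * w))%:E * Psi w).
  exact: emeasurable_funM (mexp b) mPsi.
have mQ1 : measurable_fun setT (fun w => b%:E * ((expR (a * w))%:E * Phi w)).
  exact: emeasurable_funM (measurable_cst _) mP1.
have mQ2 : measurable_fun setT (fun w => a%:E * ((expR (b * w))%:E * Psi w)).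
  exact: emeasurable_funM (measurable_cst _) mP2.
have a0E : 0 <= a%:E by rewrite lee_fin ltW.
have b0E : 0 <= b%:E by rewrite lee_fin ltW.
have e0E (c : R) : 0 <= (expR c)%:E by rewrite lee_fin expR_ge0.
have P10 w : 0 <= (expR (a * w))%:E * Phi w := mule_ge0 (e0E _) (Phi0 w).
have P20 w : 0 <= (expR (b * w))%:E * Psi w := mule_ge0 (e0E _) (Psi0 w).
have Q10 w : 0 <= b%:E * ((expR (a * w))%:E * Phi w) := mule_ge0 b0E (P10 w).
have Q20 w : 0 <= a%:E * ((expR (b * w))%:E * Psi w) := mule_ge0 a0E (P20 w).
(* The two signs of the difference have probabilities [b] and [a]; undoing the shift by [w] with the
   memoryless property produces the factors [expR (a * w)] and [expR (b * w)]. *)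
transitivity (\int[exponential_prob 1]_w
   (b%:E * ((expR (a * w))%:E * Phi w) + a%:E * ((expR (b * w))%:E * Psi w))).
  apply: eq_exponential_integral => //.
  - apply: (@measurable_fun_fubini_tonelli_F _ _ _ _ _ (product_law (exponential_law a0) (exponential_law b0)) _ mF).
    by move=> x; rewrite mule_ge0.
  - by move=> w; apply: (@integral_ge0 _ _ _ (product_law (exponential_law a0) (exponential_law b0))) => x _; rewrite mule_ge0.
  - exact: emeasurable_funD mQ1 mQ2.
  - move=> w; exact: adde_ge0 (Q10 w) (Q20 w).
  move=> w w0.
  have mshift c : measurable_fun setT (fun x : mR => (c + x)%R : mR) by exact: measurable_funD.
  transitivity (\int[product_law (exponential_law a0) (exponential_law b0)]_p
     (f (w + (p.1 - p.2))%R * g w * ((p.2 <= p.1)%R%:R)%:E +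
      f w * g (w + (p.2 - p.1))%R * ((p.1 < p.2)%R%:R)%:E)).
    apply: (@eq_integral _ _ _ (product_law (exponential_law a0) (exponential_law b0))) => -[x y] _ /=.
    have [yx|xy] := leP y x.
      rewrite mule0 adde0 mule1 max_r ?subr_ge0// max_l ?addr0//.
      by rewrite subr_le0.
    rewrite mule0 add0e mule1 max_l ?subr_le0 1?ltW// addr0 max_r//.
    by rewrite subr_ge0 ltW.
  have mm1 : measurable_fun setT (fun x : mR => f (w + x)%R * g w).
    exact: emeasurable_funM (measurableT_comp mf (mshift w)) (measurable_cst _).
  have mm2 : measurable_fun setT (fun x : mR => f w * g (w + x)%R).
    exact: emeasurable_funM (measurable_cst _) (measurableT_comp mg (mshift w)).
  rewrite (@ge0_integralD _ _ _ (product_law (exponential_law a0) (exponential_law b0)))//=; last 4 first.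
  - by move=> x _; rewrite !mule_ge0// lee_fin.
  - apply: emeasurable_funM.
      apply: (@measurableT_comp _ _ _ _ _ _ (fun x => f (w + x)%R * g w)) => //.
      exact: measurable_funB.
    by apply: measurable_bool_EFin; exact: measurable_fun_ler.
  - by move=> x _; rewrite !mule_ge0// lee_fin.
  - apply: emeasurable_funM.
      apply: (@measurableT_comp _ _ _ _ _ _ (fun x => f w * g (w + x)%R)) => //.
      exact: measurable_funB.
    by apply: measurable_bool_EFin; exact: measurable_fun_ltr.
  rewrite (@exponential_wedge a b a0 b0 (fun x => f (w + x)%R * g w))//; last first.
    by move=> x; rewrite mule_ge0.
  rewrite (@exponential_wedge_lt a b a0 b0 (fun x => f w * g (w + x)%R))//; last first.
    by move=> x; rewrite mule_ge0.
  rewrite ab !divr1; congr (_ * _ + _ * _).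
    rewrite /Phi (@exponential_shift _ a w (fun x => g w * f x))//; last 2 first.
    - exact: emeasurable_funM.
    - by move=> x; rewrite mule_ge0.
    rewrite muleA -EFinM -expRD subrr expR0 mul1e.
    by congr integral; apply/funext => x; rewrite muleC addrC.
  rewrite /Psi (@exponential_shift_lt _ b w (fun x => f w * g x))//; last 2 first.
  - exact: emeasurable_funM.
  - by move=> x; rewrite mule_ge0.
  rewrite muleA -EFinM -expRD subrr expR0 mul1e.
  by congr integral; apply/funext => x; rewrite addrC.
have a1 : (a < 1)%R by rewrite -ab ltrDl.
have b1 : (b < 1)%R by rewrite -ab ltrDr.
have abE : (1 - a = b)%R by rewrite -ab addrAC subrr add0r.
have baE : (1 - b = a)%R by rewrite -ab addrK.
apply: (etrans (exponential_integralD ltr01 mQ1 Q10 mQ2 Q20)).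
apply: (etrans (congr2 _ (exponential_integralZl ltr01 b0E mP1 P10)
  (exponential_integralZl ltr01 a0E mP2 P20))).
(* These factors tilt the rate 1 of [w] to [1 - a = b] and to [1 - b = a], with constants [1 / b]
   and [1 / a] that cancel the probabilities. *)
apply: (etrans (congr2 _ (congr1 _ (exponential_tilt ltr01 a1 mPhi Phi0))
  (congr1 _ (exponential_tilt ltr01 b1 mPsi Psi0)))).
rewrite abE baE.
have cancel (c : R) (x : \bar R) : (0 < c)%R -> c%:E * ((1 / c)%:E * x) = x.
  by move=> c0; rewrite muleA -EFinM div1r mulfV ?gt_eqF// mul1e.
apply: (etrans (congr2 _ (cancel _ _ b0) (cancel _ _ a0))).
have mlt' y : measurable_fun setT (fun x : mR => (x < y)%R) by exact: measurable_fun_ltr.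
have mle' y : measurable_fun setT (fun x : mR => (y <= x)%R) by exact: measurable_fun_ler.
pose Psi' y := \int[exponential_prob a]_x (g y * f x * ((x < y)%R%:R)%:E).
have mfg' : measurable_fun setT (fun p : mR * mR => f p.1 * g p.2 * ((p.1 < p.2)%R%:R)%:E).
  exact: (mfg _ _ (fun x y => x < y)%R).
have fg0 (p : mR * mR) : 0 <= f p.1 * g p.2 * ((p.1 < p.2)%R%:R)%:E.
  by rewrite !mule_ge0// lee_fin.
have Psi'E : Psi' = fun y => \int[exponential_prob a]_x (f x * g y * ((x < y)%R%:R)%:E).
  by apply/funext => y; congr integral; apply/funext => x; rewrite (muleC (f x)).
have swap : \int[exponential_prob a]_x Psi x = \int[exponential_prob b]_y Psi' y.
  rewrite Psi'E.
  have P1 := @integral_product_law1 _ _ _ _ _ (exponential_law a0) (exponential_law b0) _ mfg' fg0.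
  have P2 := @integral_product_law2 _ _ _ _ _ (exponential_law a0) (exponential_law b0) _ mfg' fg0.
  exact: (etrans (esym P1) P2).
have mPsi' : measurable_fun setT Psi'.
  rewrite Psi'E.
  exact: (@measurable_fun_fubini_tonelli_G _ _ _ _ _ (exponential_law a0) _ mfg' fg0).
have bool0 (c : bool) : 0 <= (c%:R : R)%:E by rewrite lee_fin.
have Psi'0 y : 0 <= Psi' y.
  apply: (exponential_integral_ge0 a0) => x.
  exact: mule_ge0 (mule_ge0 (g0 y) (f0 x)) (bool0 _).
(* With the order of integration exchanged in the second term, both integrals are over the same
   product law, and the indicators of [y <= x] and [x < y] add up to one. *)
rewrite swap.
apply: (etrans (esym (exponential_integralD b0 mPhi Phi0 mPsi' Psi'0))).
have If0 : 0 <= \int[exponential_prob a]_x f x by exact: exponential_integral_ge0.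
apply: (etrans _ (exponential_integralZl b0 If0 mg g0)).
congr integral; apply/funext => y.
have h1 : measurable_fun setT (fun x => g y * f x * ((y <= x)%R%:R)%:E).
  apply: emeasurable_funM (measurable_bool_EFin (mle' y)).
  exact: emeasurable_funM (measurable_cst _) mf.
have h10 x : 0 <= g y * f x * ((y <= x)%R%:R)%:E.
  exact: mule_ge0 (mule_ge0 (g0 y) (f0 x)) (bool0 _).
have h2 : measurable_fun setT (fun x => g y * f x * ((x < y)%R%:R)%:E).
  apply: emeasurable_funM (measurable_bool_EFin (mlt' y)).
  exact: emeasurable_funM (measurable_cst _) mf.
have h20 x : 0 <= g y * f x * ((x < y)%R%:R)%:E.
  exact: mule_ge0 (mule_ge0 (g0 y) (f0 x)) (bool0 _).
apply: (etrans (esym (exponential_integralD a0 h1 h10 h2 h20))).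
rewrite [RHS]muleC.
apply: (etrans _ (exponential_integralZl a0 (g0 y) mf f0)).
congr integral; apply/funext => x.
by case: leP => _; rewrite !mule1 mule0 ?adde0 ?add0e.
Qed.

End burke.

(** * Independent families *)

Section image_probability.
Context {R : realType} {d d'} {T : measurableType d} {T' : measurableType d'}.
Variables (P : probability T R) (X : T -> T') (mX : measurable_fun setT X).

Let image_measureT : image_measure P mX setT = 1%E.
Proof. by rewrite /image_measure /= /pushforward preimage_setT probability_setT. Qed.

Definition law : probability T' R :=
  HB.pack (Measure.sort (image_measure P mX))
    (Measure_isProbability.Build _ _ R (image_measure P mX) image_measureT).

Lemma integral_law (f : T' -> \bar R) :
  measurable_fun setT f -> (forall x, 0 <= f x)%E ->
  (\int[law]_x f x = \int[P]_t f (X t))%E.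
Proof. by move=> mf f0; rewrite ge0_integral_pushforward. Qed.

End image_probability.

Section pair_law.
Context {R : realType} {d d1 d2} {T : measurableType d}
  {T1 : measurableType d1} {T2 : measurableType d2}.
Local Open Scope ereal_scope.

(** Uniqueness of product measures applied to the law of the pair conditioned on [E]; a null [E] is
    treated apart. In the applications [E] is a cylinder over the other variables, so that
    independence from them is kept while a pair is transformed. *)
Lemma pair_law (P : probability T R) (m1 : probability T1 R) (m2 : probability T2 R)
    (X1 : T -> T1) (X2 : T -> T2) (E : set T) :
  measurable_fun setT X1 -> measurable_fun setT X2 -> measurable E ->
  (forall A B, measurable A -> measurable B ->
     P (X1 @^-1` A `&` (X2 @^-1` B `&` E)) = m1 A * m2 B * P E) ->
  forall C, measurable C ->
    P ((fun t => (X1 t, X2 t)) @^-1` C `&` E) = product_law m1 m2 C * P E.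
Proof.
move=> mX1 mX2 mE XE C mC.
have mX : measurable_fun setT (fun t => (X1 t, X2 t)) by exact: measurable_fun_pair.
have mXC A : measurable A -> measurable ((fun t => (X1 t, X2 t)) @^-1` A).
  by move=> mA; rewrite -[X in measurable X]setTI; exact: mX.
have PEfin : P E \is a fin_num by exact: fin_num_measure.
have [PE0|PE0] := eqVneq (fine (P E)) 0%R.
  have PE : P E = 0 by rewrite -(fineK PEfin) PE0.
  rewrite PE mule0; apply/eqP; rewrite eq_le measure_ge0 andbT -PE.
  by apply: le_measure; rewrite ?inE//; exact: measurableI (mXC _ mC) mE.
have PEp : (0 < fine (P E))%R by rewrite lt_neqAle eq_sym PE0 fine_ge0.
pose c : {nonneg R} := NngNum (ltW (eq_ind_r is_true PEp (invr_gt0 (fine (P E))))).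
pose m' := mscale c (image_measure (mrestr P mE) mX).
have m'E A : m' A = ((fine (P E))^-1)%:E * P ((fun t => (X1 t, X2 t)) @^-1` A `&` E) by [].
have -> : product_law m1 m2 C = m' C.
  apply: product_measure_unique => // A B mA mB.
  apply: (etrans (m'E _)); rewrite (_ : _ `&` E = X1 @^-1` A `&` (X2 @^-1` B `&` E)); last first.
    by apply/seteqP; split => t /=; tauto.
  by rewrite XE// muleC -muleA -[X in X * _%:E](fineK PEfin) -EFinM mulfV// mule1.
by rewrite m'E muleAC -[X in _ * X * _](fineK PEfin) -EFinM mulVf// mul1e.
Qed.

End pair_law.

Definition real_law {R : realType} {d} {T : measurableType d} (P : probability T R)
    (X : T -> R) (mX : measurable_fun setT X) : probability (measurableTypeR R) R :=
  @law _ _ _ T (measurableTypeR R) P X mX.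

Section indep.
Context {R : realType} {d} {T : measurableType d} {I : eqType}.
Implicit Types (P : probability T R) (s : seq I) (Y : I -> T -> R) (B : I -> set R).
Local Open Scope ereal_scope.

Definition cylinder s Y B : set T := \big[setI/setT]_(i <- s) (Y i @^-1` B i).

(** The product formula is asked of the whole list only; on duplicate-free lists it passes to
    sublists by choosing full sets ([indep_catl]). *)
Definition indep P s Y := forall B, (forall i, measurable (B i)) ->
  P (cylinder s Y B) = \prod_(i <- s) P (Y i @^-1` B i).

Lemma cylinder_cons i s Y B : cylinder (i :: s) Y B = Y i @^-1` B i `&` cylinder s Y B.
Proof. by rewrite /cylinder big_cons. Qed.

Lemma measurable_cylinder s Y B :
  (forall i, measurable_fun setT (Y i)) -> (forall i, measurable (B i)) ->
  measurable (cylinder s Y B).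
Proof.
move=> mY mB; rewrite /cylinder; elim/big_ind: _ => //.
- by move=> A A'; exact: measurableI.
- by move=> i _; rewrite -[X in measurable X]setTI; exact: mY.
Qed.

Lemma eq_cylinder s Y B B' : {in s, forall i, B i = B' i} ->
  cylinder s Y B = cylinder s Y B'.
Proof. by move=> BB'; apply: eq_big_seq => i /BB' ->. Qed.

Lemma indep_perm P s s' Y : perm_eq s s' -> indep P s Y -> indep P s' Y.
Proof.
move=> ss' iY B mB.
by rewrite /cylinder -(perm_big _ ss')/= iY// (perm_big _ ss').
Qed.

Lemma indep_catl P s s' Y : uniq (s ++ s') -> indep P (s ++ s') Y -> indep P s Y.
Proof.
rewrite cat_uniq => /and3P[_ ss' _] iY B mB.
pose B' i := if i \in s then B i else setT.
have mB' i : measurable (B' i) by rewrite /B'; case: ifP.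
have := iY _ mB'; rewrite /cylinder !big_cat/=.
have B's' i : i \in s' -> B' i = setT.
  move=> is'; rewrite /B' ifF//; apply/negbTE; apply: contra ss' => si.
  by apply/hasP; exists i.
rewrite [X in _ `&` X](_ : _ = setT); last first.
  by rewrite big_seq big1// => i /B's' ->; rewrite preimage_setT.
rewrite [X in _ * X](_ : _ = 1); last first.
  by rewrite big_seq big1// => i /B's' ->; rewrite preimage_setT probability_setT.
rewrite setIT mule1 => BE.
rewrite (eq_big_seq (fun i => Y i @^-1` B' i)); last by move=> i si; rewrite /B' si.
rewrite BE; apply: eq_big_seq => i si; by rewrite /B' si.
Qed.

Lemma indep_cons P i s Y : uniq (i :: s) -> indep P (i :: s) Y -> indep P s Y.
Proof.
move=> us iY; apply: (@indep_catl P s [:: i]).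
  by rewrite uniq_catC.
by apply: indep_perm iY; rewrite -cat1s perm_catC.
Qed.

Lemma indep_consE P i s Y A B : uniq (i :: s) -> indep P (i :: s) Y ->
  measurable A -> (forall j, measurable (B j)) ->
  P (Y i @^-1` A `&` cylinder s Y B) = P (Y i @^-1` A) * P (cylinder s Y B).
Proof.
move=> us iY mA mB; pose B' j := if j == i then A else B j.
have mB' j : measurable (B' j) by rewrite /B'; case: ifP.
have sB' : {in s, forall j, B' j = B j}.
  move=> j sj; rewrite /B'; case: eqP => // ji.
  by move: us; rewrite /= -ji sj.
have := iY B' mB'; rewrite cylinder_cons (eq_cylinder _ sB') {1}/B' eqxx => ->.
rewrite big_cons {1}/B' eqxx (indep_cons us iY)//; congr (_ * _).
by apply: eq_big_seq => j /sB' ->.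
Qed.

Lemma indep_consI P i s Y : indep P s Y ->
  (forall A B, measurable A -> (forall j, measurable (B j)) ->
    P (Y i @^-1` A `&` cylinder s Y B) = P (Y i @^-1` A) * P (cylinder s Y B)) ->
  indep P (i :: s) Y.
Proof. by move=> iY H B mB; rewrite cylinder_cons H// iY// big_cons. Qed.

(** Bridge from the independence of the statement to lists of relabelled ([f]) and transformed ([g])
    variables; the transformation is what scales the weights on the axes. *)
Lemma mutually_independent_indep {J : eqType} P (D : J -> Prop) (Z : J -> T -> R)
    (f : I -> J) (g : I -> R -> R) s Y :
  mutually_independent P D Z -> uniq [seq f i | i <- s] ->
  {in s, forall i, D (f i)} -> (forall i, measurable_fun setT (g i)) ->
  {in s, forall i, Y i = g i \o Z (f i)} ->
  indep P s Y.
Proof.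
move=> iZ ufs Ds mg Yg B mB.
case: s ufs Ds Yg => [|i0 s]; first by move=> *; rewrite /cylinder !big_nil probability_setT.
set s' := i0 :: s => ufs Ds Yg.
(* [f] is only injective on the list, so its inverse is read off positions in it. *)
pose inv j := nth i0 s' (index j (map f s')).
have invK : {in s', forall i, inv (f i) = i}.
  move=> i si; have ip : (index i s' < size s')%N by rewrite index_mem.
  have fi : f i = nth (f i0) (map f s') (index i s') by rewrite (nth_map i0)// nth_index.
  by rewrite /inv {1}fi index_uniq ?size_map// nth_index.
pose B' j := g (inv j) @^-1` B (inv j).
have mB' j : measurable (B' j) by rewrite -[X in measurable X]setTI; exact: mg.
have YB : {in s', forall i, Y i @^-1` B i = Z (f i) @^-1` B' (f i)}.
  by move=> i si; rewrite Yg// /B' invK.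
have Ds' j : j \in map f s' -> D j by move=> /mapP[i si ->]; exact: Ds.
have := iZ (map f s') B' ufs Ds' mB'; rewrite !big_map => ZE.
rewrite /cylinder (eq_big_seq _ YB) ZE.
by apply: eq_big_seq => i /YB ->.
Qed.

Definition upd B i (A : set R) : I -> set R := fun j => if j == i then A else B j.

Lemma measurable_upd B i A : measurable A -> (forall j, measurable (B j)) ->
  forall j, measurable (upd B i A j).
Proof. by move=> mA mB j; rewrite /upd; case: ifP. Qed.

Lemma cylinder_upd i s Y B A : i \notin s ->
  cylinder (i :: s) Y (upd B i A) = Y i @^-1` A `&` cylinder s Y B.
Proof.
move=> si; rewrite cylinder_cons {1}/upd eqxx; congr (_ `&` _).
by apply: eq_cylinder => j js; rewrite /upd; case: eqP => // ji; rewrite -ji js in si.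
Qed.

Lemma indep_pairE P i j s Y (mi mj : probability (measurableTypeR R) R) :
  (forall k, measurable_fun setT (Y k)) -> uniq (i :: j :: s) ->
  indep P (i :: j :: s) Y ->
  (forall A, measurable A -> P (Y i @^-1` A) = mi A) ->
  (forall A, measurable A -> P (Y j @^-1` A) = mj A) ->
  forall B C, (forall k, measurable (B k)) -> measurable C ->
  P ((fun t => (Y i t, Y j t)) @^-1` C `&` cylinder s Y B) =
  product_law mi mj C * P (cylinder s Y B).
Proof.
move=> mY us iY miE mjE B C mB mC.
have us' := us; rewrite cons_uniq in us'; case/andP: us' => _ us'.
have js : j \notin s by case/andP: us'.
apply: (@pair_law _ _ _ _ _ (measurableTypeR R) (measurableTypeR R) P mi mj _ _ _ (mY i) (mY j)
  (measurable_cylinder s mY mB) _ C mC) => A A' mA mA'.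
rewrite -cylinder_upd// (indep_consE us iY)//; last exact: measurable_upd.
rewrite cylinder_upd// (indep_consE us')//; last exact: indep_cons iY.
by rewrite miE// mjE// muleA.
Qed.

Lemma indep_tripleE P i j k s Y (mi mj mk : probability (measurableTypeR R) R) :
  (forall k, measurable_fun setT (Y k)) -> uniq (i :: j :: k :: s) ->
  indep P (i :: j :: k :: s) Y ->
  (forall A, measurable A -> P (Y i @^-1` A) = mi A) ->
  (forall A, measurable A -> P (Y j @^-1` A) = mj A) ->
  (forall A, measurable A -> P (Y k @^-1` A) = mk A) ->
  forall B C, (forall k, measurable (B k)) -> measurable C ->
  P ((fun t => (Y i t, (Y j t, Y k t))) @^-1` C `&` cylinder s Y B) =
  product_law mi (product_law mj mk) C * P (cylinder s Y B).
Proof.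
move=> mY us iY miE mjE mkE B C mB mC.
have pjk : perm_eq (i :: j :: k :: s) (j :: k :: i :: s).
  by rewrite -[i :: j :: k :: s]/([:: i] ++ [:: j; k] ++ s) perm_catCA.
have us' : uniq (j :: k :: i :: s) by rewrite -(perm_uniq pjk).
have iY' := indep_perm pjk iY.
have us1 : uniq (i :: s) by move: us'; rewrite cons_uniq => /andP[_]; rewrite cons_uniq => /andP[].
have iY1 : indep P (i :: s) Y.
  apply: (@indep_cons P k); first by move: us'; rewrite cons_uniq => /andP[].
  exact: indep_cons iY'.
have si : i \notin s by case/andP: us1.
apply: (@pair_law _ _ _ _ _ (measurableTypeR R) (measurableTypeR R * measurableTypeR R)%type
  P mi (product_law mj mk) _ _ _ (mY i) (measurable_fun_pair (mY j) (mY k))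
  (measurable_cylinder s mY mB) _ C mC) => A A' mA mA'.
rewrite setICA -cylinder_upd//.
rewrite (indep_pairE mY us' iY' mjE mkE)//; last exact: measurable_upd.
by rewrite cylinder_upd// (indep_consE us1 iY1)// miE// muleA (muleC (mi A)).
Qed.

Definition has_exponential_law P (X : T -> R) (l : R) :=
  forall A, measurable A -> P (X @^-1` A) = exponential_prob l A.

(** One Burke move: the three independent inputs of a cell are exchanged for its two outputs, and
    independence from the bystanders [s] survives. The individual laws are the case of full sets in
    [key]. *)
Lemma indep_burke P Y (w i j h v : I) s (a b : R) :
  (forall k, measurable_fun setT (Y k)) ->
  (0 < a)%R -> (0 < b)%R -> (a + b = 1)%R ->
  uniq (w :: i :: j :: s) -> uniq (h :: v :: s) ->
  indep P (w :: i :: j :: s) Y ->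
  has_exponential_law P (Y w) 1 -> has_exponential_law P (Y i) a ->
  has_exponential_law P (Y j) b ->
  (forall t, Y h t = Y w t + Num.max 0 (Y i t - Y j t))%R ->
  (forall t, Y v t = Y w t + Num.max 0 (Y j t - Y i t))%R ->
  [/\ indep P (h :: v :: s) Y, has_exponential_law P (Y h) a &
      has_exponential_law P (Y v) b].
Proof.
move=> mY a0 b0 ab us us' iY lw li lj hE vE.
have key A A' B : measurable A -> measurable A' -> (forall k, measurable (B k)) ->
    P (Y h @^-1` A `&` (Y v @^-1` A' `&` cylinder s Y B)) =
    exponential_prob a A * exponential_prob b A' * P (cylinder s Y B).
  move=> mA mA' mB.
  pose mR := measurableTypeR R.
  pose phi1 (p : mR * (mR * mR)) : mR := (p.1 + Num.max 0 (p.2.1 - p.2.2))%R.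
  pose phi2 (p : mR * (mR * mR)) : mR := (p.1 + Num.max 0 (p.2.2 - p.2.1))%R.
  have m1 : measurable_fun setT phi1.
    apply: measurable_funD => //; apply: measurable_maxr => //.
    by apply: measurable_funB; apply: measurableT_comp.
  have m2 : measurable_fun setT phi2.
    apply: measurable_funD => //; apply: measurable_maxr => //.
    by apply: measurable_funB; apply: measurableT_comp.
  pose C := phi1 @^-1` A `&` phi2 @^-1` A'.
  have mC : measurable C.
    by apply: measurableI; rewrite -[X in measurable X]setTI; [exact: m1|exact: m2].
  rewrite setIA (_ : Y h @^-1` A `&` Y v @^-1` A' = (fun t => (Y w t, (Y i t, Y j t))) @^-1` C); last first.
    by apply/seteqP; split => t; rewrite /C /phi1 /phi2 /= hE vE.
  rewrite (indep_tripleE (mi := exponential_law ltr01) (mj := exponential_law a0)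
    (mk := exponential_law b0) mY us iY lw li lj mB mC); congr (_ * _).
  have mi A0 : measurable A0 -> measurable_fun setT (fun x : mR => (\1_A0 x : R)%:E).
    by move=> mA0; apply/measurable_EFinP; exact: measurable_indic.
  have i0 (A0 : set R) x : 0 <= (\1_A0 x : R)%:E by rewrite lee_fin.
  have intE (l : R) (l0 : (0 < l)%R) A0 : measurable A0 ->
      \int[exponential_prob l]_x (\1_A0 x)%:E = exponential_prob l A0.
    by move=> mA0; rewrite (@integral_indic _ _ _ (exponential_law l0))// setIT.
  rewrite -(intE _ a0 _ mA) -(intE _ b0 _ mA').
  apply: (etrans _ (burke_integral a0 b0 ab (mi _ mA) (i0 A) (mi _ mA') (i0 A'))).
  rewrite -[C]setIT -[LHS]integral_indic//; apply: eq_integral => p _.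
  by rewrite /C indicI/= EFinM !indicE.
have setTB (k : I) : measurable ([set: R]) by [].
have cT : cylinder s Y (fun=> setT) = setT.
  by rewrite /cylinder big1// => k _; rewrite preimage_setT.
have eT (l : R) : (0 < l)%R -> exponential_prob l setT = 1.
  by move=> l0; exact: (@probability_setT _ _ _ (exponential_law l0)).
have lh : has_exponential_law P (Y h) a.
  move=> A mA; have := key A setT _ mA measurableT setTB.
  by rewrite cT preimage_setT !setIT probability_setT eT// !mule1.
have lv : has_exponential_law P (Y v) b.
  move=> A mA; have := key setT A _ measurableT mA setTB.
  by rewrite cT preimage_setT setTI setIT probability_setT eT// mule1 mul1e.
split => // B mB.
rewrite !cylinder_cons key// !big_cons lh// lv//.
rewrite -muleA; congr (_ * (_ * _)).
have iY1 : indep P s Y.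
  have u1 := us; rewrite cons_uniq in u1; case/andP: u1 => _ u1.
  have u2 := u1; rewrite cons_uniq in u2; case/andP: u2 => _ u2.
  exact: indep_cons u2 (indep_cons u1 (indep_cons us iY)).
exact: iY1.
Qed.

Lemma indep_pair_integral P i j Y (mY : forall k, measurable_fun setT (Y k))
    (F : R * R -> \bar R) :
  i != j -> indep P [:: i; j] Y -> measurable_fun setT F -> (forall p, 0 <= F p) ->
  \int[P]_t F (Y i t, Y j t) =
  \int[real_law P (mY i)]_x \int[real_law P (mY j)]_y F (x, y).
Proof.
move=> ij iY mF F0; rewrite -integral_product_law1//.
have mp : @measurable_fun _ _ T (measurableTypeR R * measurableTypeR R)%type setT (fun t => (Y i t, Y j t)) := measurable_fun_pair (mY i) (mY j).
rewrite -[LHS](@integral_law _ _ _ _ (measurableTypeR R * measurableTypeR R)%type P _ mp)//.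
apply: eq_measure_integral => C mC _; apply/esym.
have us : uniq [:: i; j] by rewrite /= inE ij.
have := indep_pairE (mi := real_law P (mY i)) (mj := real_law P (mY j)) mY us iY
  (fun _ _ => erefl) (fun _ _ => erefl) (fun _ => measurableT) mC.
rewrite /cylinder big_nil setIT probability_setT mule1 => e; first [exact: e|exact: (esym e)].
Qed.

Lemma indep_merge P i j k s Y (f : R * R -> R) :
  (forall k, measurable_fun setT (Y k)) ->
  uniq (i :: j :: s) -> k \notin s -> measurable_fun setT f ->
  (forall t, Y k t = f (Y i t, Y j t)) ->
  indep P (i :: j :: s) Y -> indep P (k :: s) Y.
Proof.
move=> mY us ks mf kE iY.
have u1 := us; rewrite cons_uniq in u1; case/andP: u1 => _ u1.
apply: indep_consI => [|A B mA mB]; first exact: indep_cons u1 (indep_cons us iY).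
have mC : measurable (f @^-1` A) by rewrite -[X in measurable X]setTI; exact: mf.
have E0 : Y k @^-1` A = (fun t => (Y i t, Y j t)) @^-1` (f @^-1` A).
  by apply/seteqP; split => t /=; rewrite kE.
have H B' (mB' : forall k, measurable (B' k)) := indep_pairE (mi := real_law P (mY i)) (mj := real_law P (mY j)) mY us iY
  (fun _ _ => erefl) (fun _ _ => erefl) (B := B') mB' mC.
rewrite E0 H//; congr (_ * _).
have := H (fun=> setT) (fun=> measurableT).
rewrite (_ : cylinder _ _ _ = setT) ?setIT ?probability_setT ?mule1//.
by rewrite /cylinder big1// => l _; rewrite preimage_setT.
Qed.

Lemma integral_indep_cylinder P i s Y B (h : R -> \bar R) :
  (forall k, measurable_fun setT (Y k)) -> uniq (i :: s) ->
  indep P (i :: s) Y -> (forall k, measurable (B k)) ->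
  measurable_fun setT h -> (forall x, 0 <= h x) ->
  \int[P]_(t in cylinder s Y B) h (Y i t) =
  (\int[P]_t h (Y i t)) * P (cylinder s Y B).
Proof.
move=> mY us iY mB mh h0.
have mE : measurable (cylinder s Y B) by exact: measurable_cylinder.
set E := cylinder s Y B in mE *.
have PEfin : P E \is a fin_num by exact: fin_num_measure.
pose c : {nonneg R} := NngNum (fine_ge0 (measure_ge0 P E)).
have mhY : measurable_fun setT (fun t => h (Y i t)) by exact: measurableT_comp.
transitivity (\int[mrestr P mE]_t h (Y i t)).
  have m1 : measurable_fun setT (\1_E : T -> R) by exact: measurable_indic.
  have i0 t : (0 <= (\1_E : T -> R) t)%R by [].
  have ie A : measurable A -> mrestr P mE A = \int[P]_(t in A) (\1_E t)%:E.
    by move=> mA; rewrite integral_indic// setIC.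
  rewrite (ge0_integral_density m1 i0 ie mhY (fun t => h0 _)) [LHS]integral_mkcond.
  apply: eq_integral => t _.
  by rewrite patchE indicE; case: (t \in E); rewrite ?mule1 ?mule0.
transitivity (\int[@image_measure _ _ _ T (measurableTypeR R) (mrestr P mE) _ (mY i)]_x h x).
  by rewrite (@ge0_integral_pushforward _ _ _ (measurableTypeR R) _ _ (mY i)).
transitivity (\int[mscale c (real_law P (mY i))]_x h x).
  apply: eq_measure_integral => A mA _.
  rewrite [LHS](indep_consE us iY)//.
  transitivity ((fine (P E))%:E * P (Y i @^-1` A)); last by [].
  by rewrite fineK// muleC.
rewrite ge0_integral_mscale//.
transitivity ((fine (P E))%:E * \int[real_law P (mY i)]_x h x); first by [].
rewrite fineK// muleC; congr (_ * _).
by rewrite [LHS](@integral_law _ _ _ _ (measurableTypeR R) P _ (mY i) _ mh h0).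
Qed.

(** The density depends on [Y i] alone, so it integrates out against any event about the other
    variables: independence survives and only the law of [Y i] changes. *)
Lemma indep_tilt P i s Y (g : R -> R) :
  (forall k, measurable_fun setT (Y k)) -> uniq (i :: s) ->
  indep P (i :: s) Y -> measurable_fun setT g -> (forall x, 0 <= g x)%R ->
  \int[P]_t (g (Y i t))%:E = 1 ->
  exists Q : probability T R,
    [/\ forall F, measurable_fun setT F -> (forall t, 0 <= F t) ->
          \int[Q]_t F t = \int[P]_t (F t * (g (Y i t))%:E),
        indep Q (i :: s) Y &
        forall k A, k \in s -> measurable A -> Q (Y k @^-1` A) = P (Y k @^-1` A)].
Proof.
move=> mY us iY mg g0 g1.
have mgY : measurable_fun setT (fun t => g (Y i t)) by exact: measurableT_comp.
have [Q QE] := density_probability mgY (fun t => g0 (Y i t)) g1.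
exists Q.
have mgE : measurable_fun setT (fun x => (g x)%:E) by exact/measurable_EFinP.
have mc A B : measurable A -> (forall k, measurable (B k)) -> measurable (Y i @^-1` A `&` cylinder s Y B).
  move=> mA mB; apply: measurableI; last exact: measurable_cylinder.
  by rewrite -[X in measurable X]setTI; exact: mY.
have key A B : measurable A -> (forall k, measurable (B k)) ->
    Q (Y i @^-1` A `&` cylinder s Y B) = Q (Y i @^-1` A) * P (cylinder s Y B).
  move=> mA mB.
  have mA' : measurable (Y i @^-1` A) by rewrite -[X in measurable X]setTI; exact: mY.
  pose h x := (\1_A x * g x)%:E.
  have mh : measurable_fun setT h.
    by apply/measurable_EFinP; apply: measurable_funM => //; exact: measurable_indic.
  have h0 x : 0 <= h x by rewrite lee_fin mulr_ge0.
  have hE t : h (Y i t) = (\1_(Y i @^-1` A) t * g (Y i t))%:E.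
    by rewrite /h !indicE.
  rewrite !QE//; last exact: mc.
  rewrite -setIC integral_mkcondr.
  transitivity (\int[P]_(t in cylinder s Y B) h (Y i t)).
    apply: eq_integral => t _; rewrite hE patchE indicE.
    by case: (t \in _); rewrite ?mul1r ?mul0r.
  rewrite (integral_indep_cylinder mY us iY mB mh h0); congr (_ * _).
  rewrite [RHS]integral_mkcond; apply: eq_integral => t _; rewrite hE patchE indicE.
  by case: (t \in _); rewrite ?mul1r ?mul0r.
have keyT B : (forall k, measurable (B k)) -> Q (cylinder s Y B) = P (cylinder s Y B).
  move=> mB; have := key setT B measurableT mB.
  by rewrite preimage_setT setTI probability_setT mul1e.
have law_s k A : k \in s -> measurable A -> Q (Y k @^-1` A) = P (Y k @^-1` A).
  move=> ks mA; have := keyT (upd (fun=> setT) k A).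
  have -> : cylinder s Y (upd (fun=> setT) k A) = Y k @^-1` A.
    have sk : perm_eq s (k :: rem k s) by exact: perm_to_rem.
    have usk : uniq (k :: rem k s).
      by rewrite -(perm_uniq sk); move: us; rewrite cons_uniq => /andP[].
    rewrite /cylinder (perm_big _ sk)/= -/(cylinder (k :: rem k s) Y _) cylinder_upd; last first.
      by move: usk; rewrite cons_uniq => /andP[].
    by rewrite /cylinder big1 ?setIT// => l _; rewrite preimage_setT.
  by apply; exact: measurable_upd.
split => //.
- by move=> F mF F0; exact: (ge0_integral_density mgY (fun t => g0 (Y i t)) QE mF F0).
- apply: indep_consI.
    move=> B mB; rewrite keyT// (indep_cons us iY)//.
    by apply: eq_big_seq => k ks; rewrite law_s.
  by move=> A B mA mB; rewrite key// keyT.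
Qed.

(** The first factor is absorbed as a density by [indep_tilt]; the others keep their independence
    and their means under the new measure, and induction applies. *)
Lemma indep_expectation_prod1 P s Y (g : I -> R -> R) :
  (forall k, measurable_fun setT (Y k)) -> uniq s -> indep P s Y ->
  (forall i, measurable_fun setT (g i)) -> (forall i x, 0 <= g i x)%R ->
  {in s, forall i, \int[P]_t (g i (Y i t))%:E = 1} ->
  \int[P]_t (\prod_(i <- s) g i (Y i t))%:E = 1.
Proof.
move=> mY + + mg g0; elim: s P => [|i s IH] P us iY g1.
  under eq_integral do rewrite big_nil.
  by rewrite integral_cst//= probability_setT mule1.
have gi : \int[P]_t (g i (Y i t))%:E = 1 by apply: g1; rewrite inE eqxx.
have [Q [QE iQ Qs]] := indep_tilt mY us iY (mg i) (g0 i) gi.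
have us' : uniq s by move: us; rewrite cons_uniq => /andP[].
rewrite -(IH Q us' (indep_cons us iQ)); last first.
  move=> k ks; have := g1 k; rewrite inE ks orbT => <-//.
  have mgE : measurable_fun setT (fun x => (g k x)%:E) by exact/measurable_EFinP.
  have g0E x : 0 <= (g k x)%:E by rewrite lee_fin.
  rewrite -(@integral_law _ _ _ _ (measurableTypeR R) Q _ (mY k) _ mgE g0E) -(@integral_law _ _ _ _ (measurableTypeR R) P _ (mY k) _ mgE g0E).
  by apply: eq_measure_integral => A mA _; exact: Qs.
rewrite QE.
- by apply: eq_integral => t _; rewrite big_cons mulrC EFinM.
- apply/measurable_EFinP; apply: measurable_prod => k _.
  exact: measurableT_comp.
- by move=> t; rewrite lee_fin prodr_ge0.
Qed.

End indep.

Lemma probability_integral_cst {R : realType} {d} {T : measurableType d}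
    (P : probability T R) (c : \bar R) : (\int[P]_x c = c)%E.
Proof. by rewrite integral_cst// -[RHS]mule1; congr (_ * _)%E; exact: probability_setT. Qed.

Lemma measurable_le_set {R : realType} {d} {T : measurableType d} (f g : T -> R) :
  measurable_fun setT f -> measurable_fun setT g -> measurable [set t | f t <= g t].
Proof.
move=> mf mg; rewrite -[X in measurable X]setTI.
have /(_ measurableT [set true]) := measurable_fun_ler mf mg.
by apply.
Qed.

Lemma measurable_lt_set {R : realType} {d} {T : measurableType d} (f g : T -> R) :
  measurable_fun setT f -> measurable_fun setT g -> measurable [set t | f t < g t].
Proof.
move=> mf mg; rewrite (_ : [set t | _] = ~` [set t | g t <= f t]).
  by apply: measurableC; exact: measurable_le_set.
by apply/seteqP; split => t /=; rewrite ltNge => /negP.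
Qed.

Lemma markov_le {R : realType} {d} {T : measurableType d} (P : probability T R)
    (W : T -> R) (lam c : R) : (0 < lam)%R -> measurable_fun setT W ->
  (forall t, 0 <= W t)%R -> (\int[P]_t (W t)%:E <= c%:E)%E ->
  (P [set t | lam <= W t]%R <= (c / lam)%:E)%E.
Proof.
move=> lam0 mW W0 Wc.
have mA : measurable [set t | lam <= W t]%R.
  exact: measurable_le_set (measurable_cst lam) mW.
rewrite mulrC EFinM lee_pdivlMl//; apply: le_trans Wc.
rewrite -[X in P X]setIT -integral_indic// -ge0_integralZl//; last 2 first.
- by apply/measurable_EFinP; exact: measurable_indic.
- by rewrite lee_fin ltW.
apply: ge0_le_integral => //.
- by move=> t _; rewrite -EFinM lee_fin mulr_ge0// ltW.
- by apply/measurable_EFinP; apply: measurable_funM => //; exact: measurable_indic.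
- exact/measurable_EFinP.
move=> t _; rewrite -EFinM lee_fin indicE.
have [|_] := boolP (t \in [set t | lam <= W t]); last by rewrite mulr0.
by rewrite inE mulr1.
Qed.

(** * Tails of random walks *)

Section maximal_inequality.
Context {R : realType} {d} {T : measurableType d} (P : probability T R).
Local Open Scope ereal_scope.

Fixpoint stopped_prod (lam : R) (X : nat -> T -> R) (k : nat) (t : T) : R :=
  if k is k'.+1 then
    let z := stopped_prod lam X k' t in if (lam <= z)%R then z else (z * X k' t)%R
  else 1%R.

Variables (lam : R) (X : nat -> T -> R) (N : nat).
Hypotheses (lam0 : (0 < lam)%R) (mX : forall i, measurable_fun setT (X i))
  (X0 : forall i t, (0 <= X i t)%R)
  (EX : forall i, (i < N)%N -> \int[P]_t (X i t)%:E <= 1)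
  (iX : indep P (iota 0 N) X).

Let Z := stopped_prod lam X.

Let mZ k : measurable_fun setT (Z k).
Proof.
elim: k => [|k IH]; first exact: measurable_cst.
rewrite /Z /= -/(Z k); apply: measurable_fun_ifT => //.
- exact: measurable_fun_ler.
- exact: measurable_funM.
Qed.

Let Z0 k t : (0 <= Z k t)%R.
Proof. by elim: k => [|k IH] //=; rewrite /Z/= -/(Z k); case: ifP => // _; rewrite mulr_ge0. Qed.

(** One family holds the stopped products, labelled [(true, k)], and the factors, labelled
    [(false, i)], so that [indep_merge] can absorb factor [k] into the product while the later
    factors stay independent of it. *)
Let Y (l : bool * nat) : T -> R := if l.1 then Z l.2 else X l.2.

Let mY l : measurable_fun setT (Y l).
Proof. by rewrite /Y; case: ifP. Qed.

Let tail k := [seq (false, i) | i <- iota k (N - k)].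

Let uniq_tail b k j : (j < k)%N || b -> uniq ((b, j) :: tail k).
Proof.
move=> jk /=; rewrite map_inj_uniq ?iota_uniq ?andbT; last by move=> x y [].
apply/mapP => -[i]; rewrite mem_iota => /andP[ki _] [bE ji].
by move: jk; rewrite bE orbF ji ltnNge ki.
Qed.

Let indep_stopped k : (k <= N)%N -> indep P ((true, k) :: tail k) Y.
Proof.
elim: k => [_|k IH kN].
  have i0 : indep P (tail 0) Y.
    rewrite /tail subn0 => B mB.
    rewrite /cylinder !big_map /=.
    have := iX (fun i => mB (false, i)); rewrite /cylinder /Y /= => <-.
    by [].
  apply: indep_consI => // A B mA mB.
  have [A1|A1] := pselect (A 1%R).
    have -> : Y (true, 0%N) @^-1` A = setT by apply/seteqP; split.
    by rewrite setTI probability_setT mul1e.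
  have -> : Y (true, 0%N) @^-1` A = set0 by apply/seteqP; split.
  by rewrite set0I measure0 mul0e.
have tE : tail k = (false, k) :: tail k.+1.
  by rewrite /tail subnS; case: (N - k)%N (subn_gt0 k N) => [|m]; rewrite ?kN.
pose f (p : R * R) : R := if (lam <= p.1)%R then p.1 else (p.1 * p.2)%R.
have mf : measurable_fun setT f.
  apply: measurable_fun_ifT => //; first exact: measurable_fun_ler.
  exact: measurable_funM.
apply: (@indep_merge _ _ _ _ P (true, k) (false, k) _ _ Y f mY) => //.
- rewrite -tE cons_uniq; apply/andP; split.
    by have := @uniq_tail true k k (orbT _) => /andP[].
  by have := @uniq_tail true k k (orbT _) => /andP[].
- by have := @uniq_tail true k.+1 k.+1 (orbT _) => /andP[].
- by rewrite -tE; exact/IH/ltnW.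
Qed.

Let EZ k : (k <= N)%N -> \int[P]_t (Z k t)%:E <= 1.
Proof.
elim: k => [_|k IH kN].
  by rewrite /Z/= integral_cst//= probability_setT mule1.
apply: le_trans (IH (ltnW kN)).
(* The absolute values only make the integrand nonnegative on the whole plane; products and factors
   are nonnegative already. *)
pose F (p : R * R) := ((if (lam <= p.1)%R then `|p.1| else (`|p.1| * `|p.2|)%R)%:E : \bar R).
have mF : measurable_fun setT F.
  apply/measurable_EFinP; apply: measurable_fun_ifT.
  - exact: measurable_fun_ler.
  - exact: measurableT_comp.
  - by apply: measurable_funM; exact: measurableT_comp.
have mabs : measurable_fun setT (fun x : R => (`|x|)%:E).
  by apply/measurable_EFinP; exact: normr_measurable.
have F0 p : 0 <= F p by rewrite lee_fin; case: ifP => _; rewrite ?mulr_ge0.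
have i2 : indep P [:: (true, k); (false, k)] Y.
  have tE : tail k = (false, k) :: tail k.+1.
    by rewrite /tail subnS; case: (N - k)%N (subn_gt0 k N) => [|m]; rewrite ?kN.
  have := indep_stopped (ltnW kN); rewrite tE.
  apply: (@indep_catl _ _ _ _ _ [:: (true, k); (false, k)] (tail k.+1)).
  have -> : [:: (true, k); (false, k)] ++ tail k.+1 = (true, k) :: tail k by rewrite tE.
  exact: (@uniq_tail true k k (orbT _)).
have -> : \int[P]_t (Z k.+1 t)%:E = \int[P]_t F (Y (true, k) t, Y (false, k) t).
  apply: eq_integral => t _; rewrite /F /Y /Z /= -/(Z k).
  by rewrite !ger0_norm// ?Z0//.
rewrite (indep_pair_integral mY)//.
have -> : \int[P]_t (Z k t)%:E = \int[real_law P (mY (true, k))]_x (`|x|%R)%:E.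
  rewrite (@integral_law _ _ _ _ (measurableTypeR R) P _ (mY (true, k)))//.
  by apply: eq_integral => t _; rewrite /Y /= ger0_norm.
apply: ge0_le_integral => //.
- by move=> x _; exact: integral_ge0.
- by apply: (@measurable_fun_fubini_tonelli_F _ _ _ (measurableTypeR R) _ (real_law P (mY (false, k))) F).
move=> x _; rewrite [F]lock; under eq_integral do rewrite -lock /F [fst _]/= [snd _]/=.
case: (lam <= x)%R.
  by rewrite probability_integral_cst.
under eq_integral do rewrite EFinM.
rewrite ge0_integralZl//.
rewrite -[leRHS]mule1; apply: lee_wpmul2l; first by rewrite lee_fin.
rewrite (@integral_law _ _ _ _ (measurableTypeR R) P _ (mY (false, k)) (fun y => (`|y|%R)%:E))//.
apply: le_trans (EX kN); rewrite /Y /= le_eqVlt; apply/orP; left; apply/eqP.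
by apply: eq_integral => t _; rewrite ger0_norm.
Qed.

(** A frozen product stays above [lam], so the event lies in [lam <= Z N], and Markov's inequality
    applies to a variable of mean at most one. *)
Lemma maximal_ineq :
  P [set t | exists2 k, (k <= N)%N & (lam <= \prod_(0 <= i < k) X i t)%R] <= (lam^-1)%:E.
Proof.
have sub : [set t | exists2 k, (k <= N)%N & (lam <= \prod_(0 <= i < k) X i t)%R] `<=`
    [set t | lam <= Z N t]%R.
  move=> t /= [k kN lk].
  have ZE j : (lam <= Z j t)%R \/ Z j t = (\prod_(0 <= i < j) X i t)%R.
    elim: j => [|j [lj|Zj]]; first by right; rewrite big_geq.
      by left; rewrite /Z/= -/(Z j) lj.
    rewrite /Z/= -/(Z j); case: ifP => [->|_]; first by left.
    by right; rewrite big_nat_recr//= Zj.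
  have Zk : (lam <= Z k t)%R by case: (ZE k) => [//|->].
  rewrite -(subnKC kN); elim: (N - k)%N => [|m IH]; first by rewrite addn0.
  by rewrite addnS /Z/= -/(Z (k + m)) IH.
have mset : measurable [set t | lam <= Z N t]%R.
  exact: measurable_le_set (measurable_cst lam) (mZ N).
have mset' : measurable [set t | exists2 k, (k <= N)%N & (lam <= \prod_(0 <= i < k) X i t)%R].
  rewrite (_ : [set t | _] = \bigcup_(k in [set k | (k <= N)%N]) [set t | lam <= \prod_(0 <= i < k) X i t]%R); last first.
    by apply/seteqP; split => t /= [k]; exists k.
  apply: fin_bigcup_measurable => [|k _].
    by apply: (sub_finite_set _ (finite_II N.+1)) => k.
  by apply: measurable_le_set => //; exact: measurable_prod.
apply: (@le_trans _ _ (P [set t | lam <= Z N t]%R)).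
  by apply: le_measure; rewrite ?inE.
by rewrite -[in leRHS](mul1r lam^-1%R); apply: markov_le => //; exact: EZ.
Qed.

End maximal_inequality.

Section walk.
Context {R : realType} {d} {T : measurableType d} (P : probability T R).
Local Open Scope ereal_scope.

Lemma indep_comp {I : eqType} (s : seq I) (Y Z : I -> T -> R) (g : I -> R -> R) :
  (forall i, measurable_fun setT (g i)) -> (forall i t, Z i t = g i (Y i t)) ->
  indep P s Y -> indep P s Z.
Proof.
move=> mg Zg iY B mB.
have ZB i : Z i @^-1` B i = Y i @^-1` (g i @^-1` B i).
  by apply/seteqP; split => t /=; rewrite Zg.
rewrite /cylinder (eq_bigr _ (fun i _ => ZB i)) -/(cylinder s Y _) iY.
  by apply: eq_bigr => i _; rewrite ZB.
by move=> i; rewrite -[X in measurable X]setTI; exact: mg.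
Qed.

Lemma measurable_bounded_ex (N : nat) (A : nat -> set T) (D : pred nat) :
  (forall k, measurable (A k)) ->
  measurable [set t | exists2 k, (k <= N)%N && D k & A k t].
Proof.
move=> mA; rewrite (_ : [set t | _] = \bigcup_(k in [set k | (k <= N)%N && D k]) A k); last first.
  by apply/seteqP; split => t /= [k]; exists k.
apply: fin_bigcup_measurable => // .
by apply: (sub_finite_set _ (finite_II N.+1)) => k /= /andP[].
Qed.

(** The maximal inequality for the products of [expR (th * (X i t - gam))]: at any time [k >= M] the
    event forces such a product above [expR (th * tau * M%:R)], so all times are treated
    together. *)
Lemma walk_tail (X : nat -> T -> R) (N M : nat) (th gam tau : R) :
  (0 < th)%R -> (0 <= tau)%R -> (forall i, measurable_fun setT (X i)) ->
  indep P (iota 0 N) X ->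
  (forall i, (i < N)%N -> \int[P]_t (expR (th * X i t))%:E <= (expR (th * gam))%:E) ->
  P [set t | exists2 k, (k <= N)%N && (M <= k)%N &
       ((gam + tau) * k%:R <= \sum_(0 <= i < k) X i t)%R] <=
  (expR (- (th * tau * M%:R)))%:E.
Proof.
move=> th0 tau0 mX iX EX.
pose g (i : nat) (x : R) := expR (th * (x - gam)).
have mg i : measurable_fun setT (g i).
  apply: measurableT_comp => //; apply: measurable_funM => //.
  exact: measurable_funB.
pose X' i t := g i (X i t).
have mX' i : measurable_fun setT (X' i) by exact: measurableT_comp (mg i) (mX i).
have iX' : indep P (iota 0 N) X' by apply: (indep_comp mg) iX.
have EX' i : (i < N)%N -> \int[P]_t (X' i t)%:E <= 1.
  move=> iN; rewrite /X' /g.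
  have mexp : measurable_fun setT (fun t => (expR (th * X i t))%:E).
    apply/measurable_EFinP; apply: measurableT_comp => //.
    exact: measurable_funM.
  rewrite (eq_integral (fun t => (expR (- (th * gam)))%:E * (expR (th * X i t))%:E)); last first.
    by move=> t _; rewrite -EFinM -expRD; congr (expR _)%:E; ring.
  rewrite ge0_integralZl//.
  apply: (@le_trans _ _ ((expR (- (th * gam)))%:E * (expR (th * gam))%:E)).
    by apply: lee_wpmul2l; [rewrite lee_fin expR_ge0|exact: EX].
  by rewrite -EFinM -expRD addNr expR0.
have := @maximal_ineq _ _ _ P (expR (th * tau * M%:R)) X' N (expR_gt0 _) mX' (fun i t => expR_ge0 _) EX' iX'.
rewrite -expRN; apply: le_trans; apply: le_measure; rewrite ?inE.
- apply: measurable_bounded_ex => k; apply: measurable_le_set => //.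
  by apply: measurable_sum.
- rewrite (_ : [set t | _] = [set t | exists2 k, (k <= N)%N && predT k & (expR (th * tau * M%:R) <= \prod_(0 <= i < k) X' i t)%R]).
    apply: measurable_bounded_ex => k; apply: measurable_le_set => //.
    by apply: measurable_prod => i _; exact: mX'.
  by apply/seteqP; split => t /= [k kN]; exists k; rewrite ?andbT// in kN *.
move=> t /= [k /andP[kN Mk] Sk]; exists k => //.
rewrite /X' /g -expR_sum ler_expR -mulr_sumr -mulrA ler_pM2l//.
rewrite big_split/= sumr_const_nat subn0 mulNrn -[(gam *+ k)%R]mulr_natr lerBrDr.
apply: le_trans Sk; rewrite mulrDl [leLHS]addrC.
by rewrite lerD2l ler_wpM2l// ler_nat.
Qed.

Lemma exponential_mgf (l s : R) : (0 < l)%R -> (s < l)%R ->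
  \int[exponential_prob l]_x (expR (s * x))%:E = (l / (l - s))%:E.
Proof.
move=> l0 sl; have ls : (0 < l - s)%R by rewrite subr_gt0.
transitivity ((l / (l - s))%:E * 1 : \bar R); last by rewrite mule1.
rewrite -[X in _ = _ * X](exponential_integral_cst 1 ls).
apply: (etrans _ (exponential_tilt l0 sl (measurable_cst 1) (fun=> lee01))).
by congr integral; apply/funext => x; rewrite mule1.
Qed.

Lemma exponential_diff_mgf (a b s : R) : (0 < a)%R -> (0 < b)%R ->
  (s < a)%R -> (- s < b)%R ->
  \int[exponential_prob a]_x \int[exponential_prob b]_y (expR (s * (x - y)))%:E =
  (a / (a - s) * (b / (b + s)))%:E.
Proof.
move=> a0 b0 sa sb.
have mexp (c : R) : measurable_fun setT (fun w : R => (expR (c * w))%:E : \bar R).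
  by apply/measurable_EFinP; apply: measurableT_comp.
have e0 (c w : R) : 0 <= (expR (c * w))%:E by rewrite lee_fin expR_ge0.
have q0 : 0 <= (b / (b + s))%:E.
  by rewrite lee_fin divr_ge0 ?ltW// -ltrBlDr sub0r.
transitivity (\int[exponential_prob a]_x ((b / (b + s))%:E * (expR (s * x))%:E)).
  congr integral; apply/funext => x.
  rewrite -[X in (b + X)%R]opprK -(exponential_mgf b0 sb) muleC.
  apply: (etrans _ (exponential_integralZl b0 (e0 s x) (mexp (- s)%R) (e0 (- s)%R))).
  congr integral; apply/funext => y; rewrite -EFinM -expRD; congr (expR _)%:E; ring.
apply: (etrans (exponential_integralZl a0 q0 (mexp s) (e0 s))).
by rewrite exponential_mgf// -EFinM mulrC.
Qed.

Lemma exponential_diff_law_mgf (X : T -> R) (a b s : R) :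
  (0 < a)%R -> (0 < b)%R -> (s < a)%R -> (- s < b)%R ->
  measurable_fun setT X ->
  (forall A, measurable A -> P (X @^-1` A) = pushforward (product_measure1
     (exponential_prob a) (exponential_prob b)) (fun xy : R * R => xy.1 - xy.2)%R A) ->
  \int[P]_t (expR (s * X t))%:E = (a / (a - s) * (b / (b + s)))%:E.
Proof.
move=> a0 b0 sa sb mX XE; rewrite -exponential_diff_mgf//.
have mexp : measurable_fun setT (fun w : R => (expR (s * w))%:E : \bar R).
  by apply/measurable_EFinP; apply: measurableT_comp.
have e0 (w : R) : 0 <= (expR (s * w))%:E by rewrite lee_fin expR_ge0.
pose mR := measurableTypeR R.
have mB : @measurable_fun _ _ (mR * mR)%type mR setT (fun xy : mR * mR => xy.1 - xy.2)%R.
  exact: measurable_funB.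
pose m := product_law (exponential_law a0) (exponential_law b0).
rewrite -(@integral_law _ _ _ _ mR P _ mX _ mexp e0).
transitivity (\int[law m mB]_x (expR (s * x))%:E).
  by apply: eq_measure_integral => A mA _; exact: XE.
rewrite (@integral_law _ _ _ _ mR m _ mB _ mexp e0) /m integral_product_law1//.
exact: measurableT_comp mexp mB.
Qed.

Lemma indep_exponential_diff_mgf {I : eqType} (Y : I -> T -> R) (i j : I) (a b s : R) :
  (forall k, measurable_fun setT (Y k)) ->
  (0 < a)%R -> (0 < b)%R -> (s < a)%R -> (- s < b)%R -> i != j ->
  indep P [:: i; j] Y -> has_exponential_law P (Y i) a -> has_exponential_law P (Y j) b ->
  \int[P]_t (expR (s * (Y i t - Y j t)))%:E = (a / (a - s) * (b / (b + s)))%:E.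
Proof.
move=> mY a0 b0 sa sb ij iY li lj; rewrite -exponential_diff_mgf//.
have mF : measurable_fun setT (fun p : R * R => (expR (s * (p.1 - p.2)))%:E : \bar R).
  apply/measurable_EFinP; apply: measurableT_comp => //.
  by apply: measurable_funM => //; exact: measurable_funB.
have F0 (p : R * R) : 0 <= (expR (s * (p.1 - p.2)))%:E by rewrite lee_fin expR_ge0.
rewrite (indep_pair_integral mY ij iY mF F0).
transitivity (\int[exponential_law a0]_x \int[real_law P (mY j)]_y (expR (s * (x - y)))%:E).
  by apply: eq_measure_integral => A mA _; exact: li.
congr integral; apply/funext => x.
by apply: (@eq_measure_integral _ _ _ _ (exponential_law b0)) => A mA _; exact: lj.
Qed.

End walk.

(** * Last passage recursion with boundary weights *)

Section last_passage_recursion.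
Context {R : realType}.
Implicit Types (al be : R) (W : nat -> nat -> R) (a b k : nat).

Fixpoint lpp_row (w : nat -> R) (c : R) (prev : nat -> R) a : R :=
  if a is a'.+1 then w a + Num.max (lpp_row w c prev a') (prev a) else prev 0%N + c.

Fixpoint lpp_rows al be W b : nat -> R :=
  if b is b'.+1 then lpp_row (W ^~ b) (be * W 0%N b) (lpp_rows al be W b')
  else fun a => \sum_(0 <= i < a) al * W i.+1 0%N.

(* Last passage time from the origin of the quadrant, whose boundary weights are
   the bulk ones scaled by [al] (horizontal axis) and [be] (vertical axis). The
   stationary model of density [rho] is [al = 1 / (1 - rho)], [be = 1 / rho];
   [al = be = 0] leaves only the weights off the axes. *)
Definition lpp al be W a b := lpp_rows al be W b a.

Lemma lpp00 al be W : lpp al be W 0 0 = 0.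
Proof. by rewrite /lpp /= big_geq. Qed.

Lemma lppS0 al be W a : lpp al be W a.+1 0 = lpp al be W a 0 + al * W a.+1 0%N.
Proof. by rewrite /lpp /= big_nat_recr. Qed.

Lemma lpp0S al be W b : lpp al be W 0 b.+1 = lpp al be W 0 b + be * W 0%N b.+1.
Proof. by []. Qed.

Lemma lppSS al be W a b : lpp al be W a.+1 b.+1 =
  W a.+1 b.+1 + Num.max (lpp al be W a b.+1) (lpp al be W a.+1 b).
Proof. by []. Qed.

Lemma lpp_ind (Q : nat -> nat -> Prop) : Q 0%N 0%N ->
  (forall a, Q a 0%N -> Q a.+1 0%N) -> (forall b, Q 0%N b -> Q 0%N b.+1) ->
  (forall a b, Q a b.+1 -> Q a.+1 b -> Q a.+1 b.+1) -> forall a b, Q a b.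
Proof.
move=> Q00 QS0 Q0S QSS a b; elim: b a => [|b IHb]; first by elim.
by elim=> [|a IHa]; [exact: Q0S|exact: QSS].
Qed.

Lemma lpp_ge0 al be W a b : 0 <= al -> 0 <= be -> (forall a b, 0 <= W a b) ->
  0 <= lpp al be W a b.
Proof.
move=> al0 be0 W0; move: a b; apply: lpp_ind => [|a IH|b IH|a b IH1 IH2].
- by rewrite lpp00.
- by rewrite lppS0 addr_ge0// mulr_ge0.
- by rewrite lpp0S addr_ge0// mulr_ge0.
- by rewrite lppSS addr_ge0// le_max IH1.
Qed.

Lemma le_lpp al al' be be' W a b : al <= al' -> be <= be' -> (forall a b, 0 <= W a b) ->
  lpp al be W a b <= lpp al' be' W a b.
Proof.
move=> al0 be0 W0; move: a b; apply: lpp_ind => [|a IH|b IH|a b IH1 IH2].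
- by rewrite !lpp00.
- by rewrite !lppS0 lerD// ler_wpM2r.
- by rewrite !lpp0S lerD// ler_wpM2r.
- by rewrite !lppSS lerD2l ge_max !le_max IH1 IH2 orbT.
Qed.

(** A path collects the boundary weights of one axis only, and erasing those of the other axis
    cannot raise any passage time. Comparing the two terms therefore tells through which axis the
    maximizing path leaves. *)
Lemma lpp_max al be W a b : 0 <= al -> 0 <= be -> (forall a b, 0 <= W a b) ->
  lpp al be W a b = Num.max (lpp al 0 W a b) (lpp 0 be W a b).
Proof.
move=> al0 be0 W0; have h al' be' x y : 0 <= al' -> 0 <= be' -> 0 <= lpp al' be' W x y.
  by move=> ? ?; exact: lpp_ge0.
move: a b; apply: lpp_ind => [|a IH|b IH|a b IH1 IH2].
- by rewrite !lpp00 maxxx.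
- have E k : lpp 0 be W k 0 = 0.
    by elim: k => [|k IHk]; rewrite ?lpp00// lppS0 IHk mul0r addr0.
  move: IH; rewrite !lppS0 !E mul0r addr0 => ->.
  by rewrite !max_l// ?addr_ge0 ?mulr_ge0 ?h ?lexx.
- have E k : lpp al 0 W 0 k = 0.
    by elim: k => [|k IHk]; rewrite ?lpp00// lpp0S IHk mul0r addr0.
  move: IH; rewrite !lpp0S !E mul0r addr0 => ->.
  by rewrite !max_r// ?addr_ge0 ?mulr_ge0 ?h ?lexx.
- by rewrite !lppSS IH1 IH2 -addr_maxr maxACA.
Qed.

Definition hinc al be W a b := lpp al be W a.+1 b - lpp al be W a b.
Definition vinc al be W a b := lpp al be W a b.+1 - lpp al be W a b.

(** Together with [vincS], this is the cell map of [burke_integral]: the weight and the lower and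
    left increments give the upper and right ones. *)
Lemma hincS al be W a b : hinc al be W a b.+1 =
  W a.+1 b.+1 + Num.max 0 (hinc al be W a b - vinc al be W a b).
Proof.
by rewrite /hinc /vinc lppSS; case: leP => ?; case: leP => ?; lra.
Qed.

Lemma vincS al be W a b : vinc al be W a.+1 b =
  W a.+1 b.+1 + Num.max 0 (vinc al be W a b - hinc al be W a b).
Proof.
by rewrite /hinc /vinc lppSS; case: leP => ?; case: leP => ?; lra.
Qed.

Lemma inc_antidiag al be W a b :
  lpp al be W a b.+1 - lpp al be W a.+1 b = vinc al be W a b - hinc al be W a b.
Proof. by rewrite /hinc /vinc; lra. Qed.

(* Raising the boundary weights on the vertical axis raises the vertical
   increments and lowers the horizontal ones. *)
Lemma inc_comparison be W : 0 <= be -> (forall a b, 0 <= W a b) -> forall a b,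
  hinc 0 be W a b <= hinc 0 0 W a b /\ vinc 0 0 W a b <= vinc 0 be W a b.
Proof.
move=> be0 W0 a b; elim: b a => [|b IH] a.
- have H0 k be' : hinc 0 be' W k 0 = 0 by rewrite /hinc lppS0; lra.
  rewrite !H0; split => //; elim: a => [|a IHa].
    by rewrite /vinc !lpp0S; have := mulr_ge0 be0 (W0 0%N 1%N); lra.
  by rewrite !vincS !H0 !subr0 lerD2l ge_max !le_max lexx IHa orbT.
- have H k : hinc 0 be W k b.+1 <= hinc 0 0 W k b.+1.
    rewrite !hincS lerD2l ge_max !le_max lexx/=.
    by have [h v] := IH k; rewrite lerB ?orbT.
  split => //; elim: a => [|a IHa].
    by rewrite /vinc !lpp0S; have := mulr_ge0 be0 (W0 0%N b.+2); lra.
  by rewrite !vincS lerD2l ge_max !le_max lexx/= lerB ?orbT.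
Qed.

(** An antidiagonal step is a vertical minus a horizontal increment; [inc_comparison] bounds each
    one, and the steps are summed. *)
Lemma bulk_comparison be W a b k : 0 <= be -> (forall a b, 0 <= W a b) -> (k <= a)%N ->
  lpp 0 0 W (a - k) (b + k) - lpp 0 0 W a b <=
  lpp 0 be W (a - k) (b + k) - lpp 0 be W a b.
Proof.
move=> be0 W0; elim: k => [|k IH] ka; first by rewrite subn0 addn0 !subrr.
have [ka' akE] : (k <= a)%N /\ (a - k = (a - k.+1).+1)%N by lia.
have := IH ka'; rewrite akE addnS => IHk.
have [h v] := inc_comparison be0 W0 (a - k.+1) (b + k).
have := @inc_antidiag 0 0 W (a - k.+1) (b + k).
have := @inc_antidiag 0 be W (a - k.+1) (b + k).
lra.
Qed.

(* If the maximizing path to [(a, b)] leaves through the vertical axis, the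
   increments of the model with both boundaries dominate the bulk ones. *)
Lemma exit_comparison al be W a b k : 0 <= al -> 0 <= be -> (forall a b, 0 <= W a b) ->
  (k <= a)%N -> lpp al 0 W a b <= lpp 0 be W a b ->
  lpp 0 0 W (a - k) (b + k) - lpp 0 0 W a b <=
  lpp al be W (a - k) (b + k) - lpp al be W a b.
Proof.
move=> al0 be0 W0 ka exitV; apply: le_trans (bulk_comparison b be0 W0 ka) _.
(* The exit hypothesis makes the full model coincide with the vertical one at [(a, b)]; at the other
   end monotonicity is enough. *)
rewrite [lpp al be W a b]lpp_max// max_r// lerD2r.
exact: le_lpp.
Qed.

Lemma lpp_antidiag_sum al be W a b k : (k <= a)%N ->
  lpp al be W (a - k) (b + k) - lpp al be W a b =
  \sum_(0 <= i < k) (vinc al be W (a - i.+1) (b + i) - hinc al be W (a - i.+1) (b + i)).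
Proof.
elim: k => [|k IH] ka; first by rewrite subn0 addn0 subrr big_geq.
rewrite big_nat_recr//= -IH; last by lia.
rewrite -inc_antidiag addnS.
have -> : (a - k = (a - k.+1).+1)%N by lia.
lra.
Qed.

Lemma lpp_transpose al be W a b : lpp al be W a b = lpp be al (fun x y => W y x) b a.
Proof.
move: a b; apply: lpp_ind => [|a IH|b IH|a b IH1 IH2]; rewrite ?lpp00 ?lppS0 ?lpp0S ?lppSS//.
- by rewrite IH.
- by rewrite IH.
- by rewrite IH1 IH2 maxC.
Qed.

End last_passage_recursion.

Lemma measurable_lpp {R : realType} {d} {T : measurableType d}
    (W : nat -> nat -> T -> R) (al be : R) a b :
  (forall a b, measurable_fun setT (W a b)) ->
  measurable_fun setT (fun t => lpp al be (fun x y => W x y t) a b).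
Proof.
move=> mW; move: a b; apply: lpp_ind => [|a IH|b IH|a b IH1 IH2].
- rewrite (_ : (fun _ => _) = cst 0)//; by apply/funext => t; rewrite lpp00.
- rewrite (_ : (fun _ => _) = fun t => lpp al be (fun x y => W x y t) a 0 + al * W a.+1 0%N t).
    by apply: measurable_funD => //; apply: measurable_funM.
  by apply/funext => t; rewrite lppS0.
- by apply: measurable_funD => //; apply: measurable_funM.
- by apply: measurable_funD => //; exact: measurable_maxr.
Qed.

(** * Stationary increments along down-right paths *)

Section grid.
Context {R : realType} {d} {T : measurableType d}.
Implicit Types (P : probability T R) (W : nat -> nat -> T -> R).

Lemma indep_subset {I : eqType} P (s s' : seq I) (Y : I -> T -> R) :
  uniq s -> uniq s' -> {subset s' <= s} -> indep P s Y -> indep P s' Y.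
Proof.
move=> us us' ss' iY.
have ps : perm_eq s (s' ++ [seq i <- s | i \notin s']).
  apply: uniq_perm => //.
    rewrite cat_uniq us' filter_uniq// andbT; apply/hasPn => i.
    by rewrite mem_filter => /andP[].
  move=> i; rewrite mem_cat mem_filter.
  by case: (boolP (i \in s')) => [/ss' ->|_].
apply: (@indep_catl _ _ _ _ _ s' [seq i <- s | i \notin s']).
  by rewrite -(perm_uniq ps).
exact: indep_perm ps iY.
Qed.

(** The first component is the kind: 0 for a cell, 1 for a horizontal and 2 for a vertical edge.
    [(a, b)] is the lower left corner of a cell, whose weight sits at [(a + 1, b + 1)], and the
    lower or left end of an edge. *)
Definition label := (nat * (nat * nat))%type.
Definition cell a b : label := (0%N, (a, b)).
Definition hedge a b : label := (1%N, (a, b)).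
Definition vedge a b : label := (2%N, (a, b)).

Definition grid_var al be W (l : label) (t : T) : R :=
  let: (c, (a, b)) := l in
  match c with
  | 0%N => W a.+1 b.+1 t
  | 1%N => hinc al be (fun x y => W x y t) a b
  | _ => vinc al be (fun x y => W x y t) a b
  end.

Definition grid_rate (rho : R) (l : label) : R :=
  match l.1 with 0%N => 1 | 1%N => 1 - rho | _ => rho end.

Definition exponential_family {I : eqType} P (D : pred I) (Y : I -> T -> R) (r : I -> R) :=
  (forall s, uniq s -> {subset s <= D} -> indep P s Y) /\
  (forall i, D i -> has_exponential_law P (Y i) (r i)).

Lemma sub_exponential_family {I : eqType} P (D D' : pred I) (Y : I -> T -> R) r :
  subpred D' D -> exponential_family P D Y r -> exponential_family P D' Y r.
Proof.
move=> DD' [iY lY]; split => [s us sD|i Di]; last exact/lY/DD'.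
by apply: iY => // i /sD; exact: DD'.
Qed.

(* Labels met by the down-right path bounding the Young diagram with row
   lengths [mu], together with the cells outside of the diagram. *)
Definition on_shape (mu : nat -> nat) (l : label) : bool :=
  let: (c, (a, b)) := l in
  match c with
  | 0%N => (mu b <= a)%N
  | 1%N => (mu b <= a)%N && ((b == 0%N) || (a < mu b.-1)%N)
  | 2%N => a == mu b
  | _ => false
  end.

Section burke_shape.
Variables (P : probability T R) (W : nat -> nat -> T -> R) (al be rho : R).
Hypotheses (mW : forall a b, measurable_fun setT (W a b)) (rho0 : 0 < rho) (rho1 : rho < 1).
(** The law of the weights is known in a finite region only: a triangle or a rectangle in the
    applications. *)
Variable inside : pred label.
Hypothesis inside_cell : forall a b, inside (cell a b) ->
  inside (hedge a b) && inside (vedge a b).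

Local Notation Y := (grid_var al be W).
Local Notation family mu :=
  (exponential_family P [pred l | on_shape mu l && inside l] Y (grid_rate rho)).

Lemma measurable_grid_var l : measurable_fun setT (Y l).
Proof.
case: l => -[|[|c]] [a b] /=; first exact: mW.
- by apply: measurable_funB; exact: measurable_lpp.
- by apply: measurable_funB; exact: measurable_lpp.
Qed.

(** Adding the corner cell [(a, b)] to the diagram trades the cell and its lower and left edges for
    its upper and right edges, which is one application of [indep_burke]. *)
Lemma burke_flip mu mu' a b :
  a = mu b -> (b == 0%N) || (a < mu b.-1)%N -> inside (cell a b) ->
  (forall b', mu' b' = if b' == b then a.+1 else mu b') ->
  family mu -> family mu'.
Proof.
move=> ab bmu ic mu'E [iY lY].
have /andP[ih iv] := inside_cell ic.
have Dw : on_shape mu (cell a b) && inside (cell a b) by rewrite /= ic ab leqnn.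
have Dh : on_shape mu (hedge a b) && inside (hedge a b) by rewrite /= ih {1}ab leqnn bmu.
have Dv : on_shape mu (vedge a b) && inside (vedge a b) by rewrite /= iv {1}ab eqxx.
pose h := hedge a b.+1; pose v := vedge a.+1 b.
have Dh' : on_shape mu h = false by rewrite /= ab ltnn andbF.
have Dv' : on_shape mu v = false by rewrite /= -ab gtn_eqF.
(* Every label of the new shape is one of the two new edges or an old label distinct from the three
   consumed ones. *)
have sub l : on_shape mu' l -> [\/ l = h, l = v |
    [&& on_shape mu l, l != cell a b, l != hedge a b & l != vedge a b]].
  rewrite /h /v /cell /hedge /vedge.
  case: l => -[|[|[|c]]] [x y] //=; rewrite !mu'E !xpair_eqE/=.
  - case: (eqVneq y b) => [->|yb]; last by move=> ->; apply: Or33; rewrite ?andbF.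
    by move=> ax; apply: Or33; rewrite -ab ltnW//= gtn_eqF.
  - case: (eqVneq y b) => [->|yb].
      case: b bmu ab {ic ih iv mu'E Dw Dh Dv h v Dh' Dv'} => [|b] /= bmu ab.
        by rewrite ?andbT => ax; apply: Or33; rewrite -ab ltnW//= gtn_eqF.
      rewrite (ltn_eqF (ltnSn b)) => /andP[ax xm].
      by apply: Or33; rewrite -ab ltnW//= xm gtn_eqF.
    case: y yb => [|y] yb/=; first by move=> ->; apply: Or33; rewrite ?(negbTE yb) ?andbF.
    case: (eqVneq y b) => [yE|_].
      rewrite ltnS => /andP[mx]; rewrite leq_eqVlt => /orP[/eqP ->|xa].
        by apply: Or31; rewrite yE.
      by apply: Or33; rewrite mx yE -ab xa ?andbF.
    by move=> ->; apply: Or33; rewrite ?(negbTE yb) ?andbF.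
  - case: (eqVneq y b) => [->|yb]; first by move=> /eqP ->; apply: Or32.
    by move=> ->; apply: Or33; rewrite ?(negbTE yb) ?andbF.
have us3 s : uniq s -> all (fun l => [&& on_shape mu l, l != cell a b, l != hedge a b & l != vedge a b]) s ->
    uniq (cell a b :: hedge a b :: vedge a b :: s).
  move=> us /allP as'; rewrite /= us !inE/= andbT.
  by apply/and3P; split; apply/negP => /as'; rewrite eqxx ?andbF.
have key s : uniq s -> {subset s <= [pred l | on_shape mu l && inside l]} ->
    all (fun l => [&& on_shape mu l, l != cell a b, l != hedge a b & l != vedge a b]) s ->
    [/\ indep P (h :: v :: s) Y, has_exponential_law P (Y h) (1 - rho) &
      has_exponential_law P (Y v) rho].
  move=> us sD as'; have u3 := us3 s us as'.
  apply: (@indep_burke _ _ _ _ P Y (cell a b) (hedge a b) (vedge a b)).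
  - exact: measurable_grid_var.
  - by rewrite subr_gt0.
  - exact: rho0.
  - by rewrite subrK.
  - exact: u3.
  - have hs : h \notin s.
      by apply/negP => /(allP as') /and4P[]; rewrite Dh'.
    have vs : v \notin s.
      by apply/negP => /(allP as') /and4P[]; rewrite Dv'.
    by rewrite /= us inE negb_or hs vs.
  - apply: iY => // l; rewrite !inE => /or4P[/eqP ->|/eqP ->|/eqP ->|ls] //.
    exact: sD.
  - exact: (lY _ Dw).
  - exact: (lY _ Dh).
  - exact: (lY _ Dv).
  - by move=> t; rewrite /= hincS.
  - by move=> t; rewrite /= vincS.
split.
- move=> s us sD.
  (* The new edges are removed from the list, put back by the Burke move, and the original list is
     recovered as a sublist. *)
  pose s0 := [seq l <- s | (l != h) && (l != v)].
  have us0 : uniq s0 by rewrite filter_uniq.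
  have as0 : all (fun l => [&& on_shape mu l, l != cell a b, l != hedge a b & l != vedge a b]) s0.
    apply/allP => l; rewrite mem_filter => /andP[/andP[lh lv] /sD].
    by rewrite inE => /andP[/sub[lE|lE|//] _]; move: lh lv; rewrite lE eqxx ?andbF.
  have sD0 : {subset s0 <= [pred l | on_shape mu l && inside l]}.
    move=> l ls0; have /and4P[ol _ _ _] := allP as0 _ ls0.
    move: ls0; rewrite mem_filter => /andP[_ /sD]; rewrite !inE => /andP[_ ->].
    by rewrite ol.
  have [iY' _ _] := key s0 us0 sD0 as0.
  apply: indep_subset iY' => //.
    have hs : h \notin s0 by apply/negP => /(allP as0) /and4P[]; rewrite Dh'.
    have vs : v \notin s0 by apply/negP => /(allP as0) /and4P[]; rewrite Dv'.
    by rewrite /= us0 inE negb_or hs vs.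
  move=> l ls; rewrite !inE mem_filter ls andbT.
  by case: (eqVneq l h) => //= _; case: (eqVneq l v).
- have nilD : {subset [::] <= [pred l | on_shape mu l && inside l]} by [].
  have [_ lh lv] := key [::] isT nilD isT.
  move=> l /andP[ol' il]; case: (sub _ ol') => [->|->|/and4P[ol _ _ _]] //.
  by apply: lY; rewrite /= ol.
Qed.

(** The diagram is filled row by row, each row from left to right; monotonicity of [mu] guarantees
    that every added cell is a corner. *)
Lemma burke_shape mu n :
  (forall b, (mu b.+1 <= mu b)%N) ->
  (forall a b, (b < n)%N -> (a < mu b)%N -> inside (cell a b)) ->
  family (fun=> 0%N) -> family (fun b => if (b < n)%N then mu b else 0%N).
Proof.
move=> mudec mui f0; elim: n mui => [//|n IH] mui.
have fn : family (fun b => if (b < n)%N then mu b else 0%N).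
  by apply: IH => a b bn; apply: mui; rewrite ltnW.
suff: forall k, (k <= mu n)%N ->
    family (fun b => if (b < n)%N then mu b else if b == n then k else 0%N).
  move=> /(_ _ (leqnn _)); apply: sub_exponential_family => l /=.
  congr (_ && _); congr on_shape; apply/funext => b.
  by rewrite ltnS leq_eqVlt; case: (eqVneq b n) => [->|_]//=; rewrite ltnn.
elim=> [_|k IHk kn].
  apply: sub_exponential_family fn => l /=.
  congr (_ && _); congr on_shape; apply/funext => b.
  by case: ifP => //; case: ifP.
apply: (@burke_flip _ _ k n) (IHk (ltnW kn)).
- by rewrite ltnn eqxx.
- by case: (n) kn => //= m km; rewrite leqnn (leq_trans km).
- exact: mui.
- move=> b; case: (eqVneq b n) => [->|//]; by rewrite ltnn.
Qed.

End burke_shape.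

End grid.

Section stationary_grid.
Context {R : realType} {d} {T : measurableType d}.
Variables (P : probability T R) (W : nat -> nat -> T -> R) (N : nat).
Hypothesis mW : forall a b, measurable_fun setT (W a b).

Definition used_site (p : nat * nat) : Prop := (p != (0, 0)%N) && (p.1 + p.2 <= N)%N.

Hypothesis iW : mutually_independent P used_site (fun p => W p.1 p.2).
Hypothesis lW : forall p, used_site p -> has_exponential_law P (W p.1 p.2) 1.

Definition site (l : label) : nat * nat :=
  let: (c, (a, b)) := l in
  match c with 0%N => (a.+1, b.+1) | 1%N => (a.+1, 0%N) | _ => (0%N, b.+1) end.

Definition initial_rate (rh rv : R) (l : label) : R :=
  match l.1 with 0%N => 1 | 1%N => rh | _ => rv end.

Lemma has_exponential_law_scale (X : T -> R) l : 0 < l -> measurable_fun setT X ->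
  has_exponential_law P X 1 -> has_exponential_law P (fun t => l^-1 * X t) l.
Proof.
move=> l0 mX lX A mA.
have mi (B : set R) : measurable B -> measurable_fun setT (fun x : R => (\1_B x : R)%:E).
  by move=> mB; apply/measurable_EFinP; exact: measurable_indic.
have intE (k : R) (k0 : 0 < k) B : measurable B ->
    (\int[exponential_prob k]_x (\1_B x)%:E = exponential_prob k B)%E.
  by move=> mB; rewrite (@integral_indic _ _ _ (exponential_law k0))// setIT.
pose B := (fun x : R => x / l) @^-1` A.
have mB : measurable B.
  have md : measurable_fun setT (fun x : R => x / l : R) by exact: measurable_funM.
  by rewrite -[X in measurable X]setTI; exact: md.
have -> : (fun t => l^-1 * X t) @^-1` A = X @^-1` B.
  by apply/seteqP; split => t /=; rewrite /B/= mulrC.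
rewrite lX// -(intE _ ltr01 _ mB) -(intE _ l0 _ mA).
apply: (etrans _ (exponential_scale l0 (mi _ mA) _)); last by move=> x; rewrite lee_fin.
by congr integral; apply/funext => x; rewrite !indicE.
Qed.

(** For the empty diagram the increments along the axes are the scaled boundary weights themselves.
    The two rates are kept unrelated because [lpp_mgf] starts from a model that is not
    stationary. *)
Lemma initial_family (rh rv : R) (inside : pred label) : 0 < rh -> 0 < rv ->
  (forall l, on_shape (fun=> 0%N) l -> inside l -> used_site (site l)) ->
  exponential_family P [pred l | on_shape (fun=> 0%N) l && inside l]
    (grid_var rh^-1 rv^-1 W) (initial_rate rh rv).
Proof.
move=> rh0 rv0 ins.
pose g (l : label) (x : R) := match l.1 with 0%N => x | 1%N => rh^-1 * x | _ => rv^-1 * x end.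
have mg l : measurable_fun setT (g l).
  by case: l => -[|[|c]] [a b]; rewrite /g/=; first exact: measurable_id; exact: measurable_funM.
have Yg l : on_shape (fun=> 0%N) l ->
    grid_var rh^-1 rv^-1 W l = g l \o (fun t => W (site l).1 (site l).2 t).
  case: l => -[|[|[|c]]] [a b]//=; rewrite /g/=.
    rewrite ltn0 orbF => /eqP ->; apply/funext => t /=.
    by rewrite /hinc lppS0 addrAC subrr add0r.
  move=> /eqP ->; apply/funext => t /=.
  by rewrite /vinc lpp0S addrAC subrr add0r.
split.
- move=> s us sD.
  apply: (mutually_independent_indep (f := site) (g := g) iW) => //.
  + rewrite map_inj_in_uniq// => -[[|[|[|c]]] [a b]] [[|[|[|c']]] [a' b']] /sD + /sD;
      rewrite !inE/= ?ltn0 ?orbF ?andbF// => H1 H2 [].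
    * by move=> -> ->.
    * by move: H1 H2 => /andP[/eqP -> _] /andP[/eqP -> _] ->.
    * by move: H1 H2 => /andP[/eqP -> _] /andP[/eqP -> _] ->.
  + by move=> l /sD /andP[ol il]; exact: ins.
  + by move=> l /sD /andP[ol _]; exact: Yg.
- move=> l /andP[ol il]; rewrite Yg//.
  have := lW (ins _ ol il); have mWl := mW (site l).1 (site l).2.
  move: (W (site l).1 (site l).2) mWl => X mX lX; rewrite /g /initial_rate.
  case: l.1 => [//|[|c]]; exact: has_exponential_law_scale.
Qed.

Definition inside_triangle (l : label) : bool :=
  let: (c, (a, b)) := l in
  match c with 0%N => (a + b + 2 <= N)%N | _ => (a + b + 1 <= N)%N end.

(** Row lengths [N.-1 - b] give the staircase whose boundary consists of the edges joining the
    antidiagonals [N - 1] and [N]. *)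
Lemma staircase_family rho : 0 < rho -> rho < 1 ->
  exponential_family P
    [pred l : label | let: (c, (a, b)) := l in
       ((c == 1%N) || (c == 2%N)) && (a + b + 1 == N)%N]
    (grid_var (1 - rho)^-1 rho^-1 W) (grid_rate rho).
Proof.
move=> rho0 rho1; have rho1' : 0 < 1 - rho by rewrite subr_gt0.
have f0 : exponential_family P [pred l | on_shape (fun=> 0%N) l && inside_triangle l]
    (grid_var (1 - rho)^-1 rho^-1 W) (grid_rate rho).
  apply: initial_family => //.
  move=> [[|[|[|c]]] [a b]]//=; rewrite /used_site/=.
  - by move=> _ ?; lia.
  - by rewrite ltn0 orbF => /eqP -> ?; lia.
  - by move=> /eqP -> ?; lia.
have ic a b : inside_triangle (cell a b) ->
    inside_triangle (hedge a b) && inside_triangle (vedge a b).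
  by rewrite /= => ?; lia.
have := @burke_shape _ _ _ P W _ _ rho mW rho0 rho1 inside_triangle ic
  (fun b => (N.-1 - b)%N) N _ _ f0.
have c1 b : (N.-1 - b.+1 <= N.-1 - b)%N by lia.
have c2 a b : (b < N)%N -> (a < N.-1 - b)%N -> inside_triangle (cell a b).
  by rewrite /= => ? ?; lia.
move=> /(_ c1 c2); apply: sub_exponential_family => -[c [a b]] /=.
case: c => [|[|[|c]]]//= /eqP abN.
- have -> : (b < N)%N by lia.
  case: b abN => [|b] abN /=; first by apply/andP; split; lia.
  have -> : (b < N)%N by lia.
  by apply/andP; split; lia.
- have -> : (b < N)%N by lia.
  by apply/andP; split; lia.
Qed.

Definition antidiag_step rho a b (i : nat) (t : T) : R :=
  grid_var (1 - rho)^-1 rho^-1 W (vedge (a - i.+1) (b + i)) t -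
  grid_var (1 - rho)^-1 rho^-1 W (hedge (a - i.+1) (b + i)) t.

Lemma measurable_antidiag_step rho a b i :
  measurable_fun setT (antidiag_step rho a b i).
Proof. by apply: measurable_funB; exact: measurable_grid_var. Qed.

Lemma antidiag_step_mgf rho s a b i : 0 < rho -> rho < 1 -> s < rho -> - s < 1 - rho ->
  (a + b = N)%N -> (i < a)%N ->
  (\int[P]_t (expR (s * antidiag_step rho a b i t))%:E =
   (rho / (rho - s) * ((1 - rho) / (1 - rho + s)))%:E)%E.
Proof.
move=> rho0 rho1 s1 s2 abN ia.
have [iY lY] := staircase_family rho0 rho1.
have Dv : [pred l : label | let: (c, (a, b)) := l in
       ((c == 1%N) || (c == 2%N)) && (a + b + 1 == N)%N] (vedge (a - i.+1) (b + i)).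
  by rewrite /=; lia.
have Dh : [pred l : label | let: (c, (a, b)) := l in
       ((c == 1%N) || (c == 2%N)) && (a + b + 1 == N)%N] (hedge (a - i.+1) (b + i)).
  by rewrite /=; lia.
apply: indep_exponential_diff_mgf => //.
- exact: measurable_grid_var.
- by rewrite subr_gt0.
- apply: iY => // l; rewrite !inE => /orP[/eqP ->|/eqP ->]; [exact: Dv|exact: Dh].
- exact: (lY _ Dv).
- exact: (lY _ Dh).
Qed.

(** Distinct steps use disjoint pairs of staircase edges, so merging the edges two by two with
    [indep_merge] keeps independence. *)
Lemma indep_antidiag_step rho a b : 0 < rho -> rho < 1 -> (a + b = N)%N ->
  indep P (iota 0 a) (antidiag_step rho a b).
Proof.
move=> rho0 rho1 abN.
have [iY _] := staircase_family rho0 rho1.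
pose Z (l : nat * nat) : T -> R := match l.1 with
  | 0%N => antidiag_step rho a b l.2
  | 1%N => grid_var (1 - rho)^-1 rho^-1 W (vedge (a - l.2.+1) (b + l.2))
  | _ => grid_var (1 - rho)^-1 rho^-1 W (hedge (a - l.2.+1) (b + l.2)) end.
have mZ l : measurable_fun setT (Z l).
  case: l => -[|[|c]] i; rewrite /Z/=; first exact: measurable_antidiag_step.
    exact: measurable_grid_var.
  exact: measurable_grid_var.
(* The edges not merged yet: kind 1 is vertical, kind 2 horizontal, while kind 0 denotes a finished
   step. *)
pose todo j k := flatten [seq [:: (1%N, i); (2%N, i)] | i <- iota j k].
have mem_todo j k c i : ((c, i) \in todo j k) = ((c == 1%N) || (c == 2%N)) && (j <= i < j + k)%N.
  elim: k j => [|k IH] j; first by rewrite /todo/= in_nil; lia.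
  rewrite /todo/= !inE -/(todo j.+1 k) IH !xpair_eqE; lia.
have uniq_todo j k : uniq (todo j k).
  elim: k j => [|k IH] j //=; rewrite -/(todo j.+1 k) IH !inE !xpair_eqE !mem_todo/=.
  by rewrite andbT; apply/andP; split; lia.
suff: forall j, (j <= a)%N -> indep P ([seq (0%N, i) | i <- iota 0 j] ++ todo j (a - j)%N) Z.
  move=> /(_ a (leqnn _)); rewrite subnn cats0 => iZ B mB.
  have := iZ (fun l => B l.2) (fun l => mB l.2).
  by rewrite /cylinder !big_map.
have us j k : uniq ([seq (0%N, i) | i <- iota 0 j] ++ todo j k).
  rewrite cat_uniq uniq_todo map_inj_uniq ?iota_uniq ?andbT/=; last by move=> x y [].
  apply/hasPn => -[c i]; rewrite mem_todo => /andP[c12 _].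
  by apply/mapP => -[i' _ [cE _]]; rewrite cE in c12.
elim=> [_|j IH ja].
  rewrite /= subn0.
  pose f (l : nat * nat) : label := (if l.1 == 1%N then 2%N else 1%N, (a - l.2.+1, b + l.2)%N).
  have fE l : l \in todo 0 a -> Z l = grid_var (1 - rho)^-1 rho^-1 W (f l).
    by case: l => c i; rewrite mem_todo => /andP[/orP[/eqP ->|/eqP ->] _].
  have finj : {in todo 0 a &, injective f}.
    move=> [c i] [c' i']; rewrite !mem_todo /f/= => /andP[c1 i1] /andP[c2 i2] [].
    by move: c1 c2 => /orP[]/eqP -> /orP[]/eqP -> //= *; congr pair; lia.
  have mu : mutually_independent P (fun l : label => [pred l : label | let: (c, (a, b)) := l in
       ((c == 1%N) || (c == 2%N)) && (a + b + 1 == N)%N] l) (grid_var (1 - rho)^-1 rho^-1 W).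
    by move=> s B us' sD mB; apply: iY.
  apply: (mutually_independent_indep (f := f) (g := fun=> id) mu) => //.
  - by rewrite map_inj_in_uniq.
  - by move=> [c i]; rewrite mem_todo /f/= => /andP[/orP[]/eqP ->]/=; lia.
have todoE : todo j (a - j)%N = (1%N, j) :: (2%N, j) :: todo j.+1 (a - j.+1)%N.
  by rewrite /todo (_ : (a - j)%N = (a - j.+1).+1)//; lia.
have {}IH := IH (ltnW ja); rewrite todoE in IH.
have p1 : perm_eq ([seq (0%N, i) | i <- iota 0 j] ++ (1%N, j) :: (2%N, j) :: todo j.+1 (a - j.+1)%N)
   ((1%N, j) :: (2%N, j) :: ([seq (0%N, i) | i <- iota 0 j] ++ todo j.+1 (a - j.+1)%N)).
  by rewrite (perm_catCA _ [:: (1%N, j); (2%N, j)]).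
have p2 : perm_eq ((0%N, j) :: ([seq (0%N, i) | i <- iota 0 j] ++ todo j.+1 (a - j.+1)%N))
   ([seq (0%N, i) | i <- iota 0 j.+1] ++ todo j.+1 (a - j.+1)%N).
  rewrite -cat1s catA perm_cat2r perm_catC cats1 -map_rcons.
  by rewrite -addn1 iotaD add0n cats1 perm_refl.
apply: (indep_perm p2).
apply: (@indep_merge _ _ _ _ P (1%N, j) (2%N, j) (0%N, j) _ Z (fun p => p.1 - p.2) mZ) => //.
- by rewrite -(perm_uniq p1) -todoE; exact: us.
- have := us j.+1 (a - j.+1)%N; rewrite -(perm_uniq p2) cons_uniq; by case/andP.
- exact: measurable_funB.
- exact: indep_perm IH.
Qed.

End stationary_grid.

(** * Moment generating functions and exit probabilities *)

Section tilted_grid.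
Context {R : realType} {d} {T : measurableType d}.
Local Open Scope ereal_scope.

Lemma integral_has_exponential_law (P : probability T R) (X : T -> R) l (f : R -> \bar R) :
  (0 < l)%R -> measurable_fun setT X -> has_exponential_law P X l ->
  measurable_fun setT f -> (forall x, 0 <= f x) ->
  \int[P]_t f (X t) = \int[exponential_prob l]_x f x.
Proof.
move=> l0 mX lX mf f0.
rewrite -(@integral_law _ _ _ _ (measurableTypeR R) P _ mX _ mf f0).
by apply: (@eq_measure_integral _ _ _ _ (exponential_law l0)) => A mA _; exact: lX.
Qed.

Lemma indep_tilt_seq {I : eqType} (P : probability T R) (js rest : seq I)
    (Y : I -> T -> R) (g : R -> R) :
  (forall k, measurable_fun setT (Y k)) -> uniq (js ++ rest) ->
  indep P (js ++ rest) Y -> measurable_fun setT g -> (forall x, 0 <= g x)%R ->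
  {in js, forall j, \int[P]_t (g (Y j t))%:E = 1} ->
  exists Q : probability T R,
    [/\ forall F, measurable_fun setT F -> (forall t, 0 <= F t) ->
          \int[Q]_t F t = \int[P]_t (F t * (\prod_(j <- js) g (Y j t))%:E),
        indep Q (js ++ rest) Y,
        forall k A, k \in rest -> measurable A -> Q (Y k @^-1` A) = P (Y k @^-1` A) &
        forall k A, k \in js -> measurable A ->
          Q (Y k @^-1` A) = \int[P]_t ((\1_A (Y k t))%:E * (g (Y k t))%:E)].
Proof.
move=> mY + + mg g0.
have mgE : measurable_fun setT (fun x => (g x)%:E) by exact/measurable_EFinP.
have miE A : measurable A -> measurable_fun setT (fun x : R => (\1_A x : R)%:E).
  by move=> mA; apply/measurable_EFinP; exact: measurable_indic.
have transfer (P1 P2 : probability T R) k (f : R -> \bar R) :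
    measurable_fun setT f -> (forall x, 0 <= f x) ->
    (forall A, measurable A -> P1 (Y k @^-1` A) = P2 (Y k @^-1` A)) ->
    \int[P1]_t f (Y k t) = \int[P2]_t f (Y k t).
  move=> mf f0 PE.
  rewrite -(@integral_law _ _ _ _ (measurableTypeR R) P1 _ (mY k) _ mf f0).
  rewrite -(@integral_law _ _ _ _ (measurableTypeR R) P2 _ (mY k) _ mf f0).
  by apply: eq_measure_integral => A mA _; exact: PE.
elim: js P rest => [|j js IH] P rest us iY g1.
  exists P; split=> // F mF F0.
  by apply: eq_integral => t _; rewrite big_nil mule1.
have gj : \int[P]_t (g (Y j t))%:E = 1 by apply: g1; rewrite inE eqxx.
have [Q1 [Q1E iQ1 Q1s]] := indep_tilt mY us iY mg g0 gj.
have pj : perm_eq (j :: (js ++ rest)) (js ++ j :: rest).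
  by rewrite -cat1s perm_catCA.
have us1 : uniq (js ++ j :: rest) by rewrite -(perm_uniq pj).
have g1' : {in js, forall k, \int[Q1]_t (g (Y k t))%:E = 1}.
  move=> k kj; rewrite -(g1 k); last by rewrite inE kj orbT.
  apply: (transfer Q1 P k (fun x => (g x)%:E) mgE) => [x|A mA]; first by rewrite lee_fin.
  by apply: Q1s => //; rewrite mem_cat kj.
have [Q [QE iQ Qr Qj]] := IH Q1 (j :: rest) us1 (indep_perm pj iQ1) g1'.
exists Q; split.
- move=> F mF F0; rewrite QE// Q1E.
  + by apply: eq_integral => t _; rewrite big_cons -muleA -EFinM mulrC.
  + apply: emeasurable_funM => //; apply/measurable_EFinP.
    by apply: measurable_prod => k _; exact: measurableT_comp.
  + by move=> t; rewrite mule_ge0// lee_fin prodr_ge0.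
- by apply: indep_perm iQ; rewrite perm_sym.
- move=> k A kr mA; rewrite Qr//; last by rewrite inE kr orbT.
  by apply: Q1s => //; rewrite mem_cat kr orbT.
- move=> k A; rewrite inE => /orP[/eqP -> mA|kj mA].
    rewrite Qr ?inE ?eqxx//.
    rewrite -Q1E.
    + rewrite (eq_integral (fun t => (\1_(Y j @^-1` A) t)%:E)).
        by rewrite integral_indic ?setIT// -[X in measurable X]setTI; exact: mY.
      by move=> t _; rewrite !indicE.
    + by apply: (measurableT_comp (miE _ mA)).
    + by move=> t; rewrite lee_fin.
  rewrite Qj//.
  apply: (transfer _ _ k (fun x => (\1_A x)%:E * (g x)%:E)).
  + exact: emeasurable_funM (miE _ mA) mgE.
  + by move=> x; rewrite mule_ge0 ?lee_fin.
  + by move=> B mB; apply: Q1s => //; rewrite mem_cat kj.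
Qed.

Variables (P : probability T R) (W : nat -> nat -> T -> R) (N : nat).
Hypothesis mW : forall a b, measurable_fun setT (W a b).
Hypothesis iW : mutually_independent P (used_site N) (fun p => W p.1 p.2).
Hypothesis lW : forall p, used_site N p -> has_exponential_law P (W p.1 p.2) 1.

Definition inside_rectangle m n (l : label) : bool :=
  let: (c, (a, b)) := l in
  match c with
  | 0%N => (a < m)%N && (b < n)%N
  | 1%N => (a < m)%N && (b <= n)%N
  | _ => (a <= m)%N && (b < n)%N
  end.

Lemma exponential_reweight (a b : R) (A : set R) : (0 < a)%R -> (0 < b)%R -> measurable A ->
  \int[exponential_prob a]_x ((\1_A x)%:E * (b / a * expR ((a - b) * x))%:E) =
  exponential_prob b A.
Proof.
move=> a0 b0 mA.
have miE : measurable_fun setT (fun x : R => (\1_A x : R)%:E).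
  by apply/measurable_EFinP; exact: measurable_indic.
have i0 x : 0 <= (\1_A x : R)%:E by rewrite lee_fin.
have c0 : 0 <= (b / a)%:E by rewrite lee_fin divr_ge0// ltW.
have mc : measurable_fun setT (fun x : R => (b / a)%:E * (\1_A x : R)%:E).
  exact: emeasurable_funM (measurable_cst _) miE.
have c0' x : 0 <= (b / a)%:E * (\1_A x : R)%:E := mule_ge0 c0 (i0 x).
have ab : (a - b < a)%R by rewrite gtrBl.
transitivity (\int[exponential_prob a]_x ((expR ((a - b) * x))%:E * ((b / a)%:E * (\1_A x)%:E))).
  congr integral; apply/funext => x; rewrite -!EFinM; congr EFin; ring.
apply: (etrans (exponential_tilt a0 ab mc c0')).
have -> : (a - (a - b) = b)%R by ring.
apply: (etrans (congr1 _ (exponential_integralZl b0 c0 miE i0))).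
rewrite (@integral_indic _ _ _ (exponential_law b0))// setIT muleA -EFinM.
have -> : (a / b * (b / a) = 1)%R by field; rewrite !gt_eqF.
by rewrite mul1e.
Qed.

(** The passage time is the sum of the vertical axis and of the increments along row [n]. Tilting
    the axis from rate [w] to rate [z] costs [(w / z) ^+ n] and makes the model stationary; the row
    then has independent increments of rate [1 - z], whose moment generating function at [w - z] is
    [(1 - z) / (1 - w)]. *)
Lemma lpp_mgf (w z : R) m n : (0 < w)%R -> (w < 1)%R -> (0 < z)%R -> (z < 1)%R ->
  (m + n <= N)%N ->
  \int[P]_t (expR ((w - z) * lpp (1 - z)^-1 w^-1 (fun x y => W x y t) m n))%:E =
  ((w / z) ^+ n * ((1 - z) / (1 - w)) ^+ m)%:E.
Proof.
move=> w0 w1 z0 z1 mnN.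
have w1' : (0 < 1 - w)%R by rewrite subr_gt0.
have z1' : (0 < 1 - z)%R by rewrite subr_gt0.
pose Y := grid_var (1 - z)^-1 w^-1 W.
pose D := [pred l | on_shape (fun=> 0%N) l && inside_rectangle m n l].
have ins l : on_shape (fun=> 0%N) l -> inside_rectangle m n l -> used_site N (site l).
  case: l => -[|[|[|c]]] [a b]//=; rewrite /used_site/=.
  - by move=> _ /andP[? ?]; lia.
  - by rewrite ltn0 orbF => /eqP -> /andP[? ?]; lia.
  - by move=> /eqP -> /andP[? ?]; lia.
have [iY lY] := initial_family mW iW lW z1' w0 ins.
have mY l : measurable_fun setT (Y l) by exact: measurable_grid_var.
pose js := [seq vedge 0 b | b <- iota 0 n].
pose grid := [seq (c, p) | c <- iota 0 3, p <- [seq (a, b) | a <- iota 0 m.+1, b <- iota 0 n.+1]].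
pose rest := [seq l : label <- grid | D l && (l.1 != 2%N)].
have gridP c a b : (c < 3)%N -> (a < m.+1)%N -> (b < n.+1)%N -> (c, (a, b)) \in grid.
  move=> c3 am bn; apply: (@allpairs_f _ _ _ (fun c p => (c, p))).
    by rewrite mem_iota.
  by apply: allpairs_f; rewrite mem_iota.
have restP l : (l \in rest) = D l && (l.1 != 2%N).
  rewrite mem_filter; apply/andb_idr => /andP[/andP[ol il] _].
  case: l ol il => -[|[|[|c]]] [a b] ol //; rewrite /inside_rectangle => /andP[am bn];
    apply: gridP => //; lia.
have jsP l : (l \in js) = D l && (l.1 == 2%N).
  apply/mapP/idP => [[b]|].
    by rewrite mem_iota => /= bn ->; rewrite /=; lia.
  case: l => -[|[|[|c]]] [a b] /=; rewrite ?andbF// => /andP[/andP[/eqP -> bn] _].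
  by exists b => //; rewrite mem_iota.
have uall : uniq (js ++ rest).
  rewrite cat_uniq map_inj_uniq ?iota_uniq; last by move=> x y [].
  rewrite filter_uniq ?andbT; last first.
    apply: allpairs_uniq; rewrite ?iota_uniq//.
    - by apply: allpairs_uniq; rewrite ?iota_uniq// => -[a b] [a' b'] _ _ [-> ->].
    - by move=> [a b] [a' b'] _ _ [-> ->].
  apply/hasPn => l; rewrite restP => /andP[_ l2].
  by rewrite jsP (negbTE l2) andbF.
have allD l : (l \in js ++ rest) = D l.
  by rewrite mem_cat jsP restP -andb_orr orbN andbT.
have iall : indep P (js ++ rest) Y by apply: iY => // l; rewrite allD.
(* The density of rate [z] with respect to rate [w]. *)
pose g x := (z / w * expR ((w - z) * x))%R.
have mg : measurable_fun setT g.
  by apply: measurable_funM => //; apply: measurableT_comp => //; exact: measurable_funM.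
have g0 x : (0 <= g x)%R by rewrite mulr_ge0 ?expR_ge0// divr_ge0// ltW.
have mgE : measurable_fun setT (fun x => (g x)%:E) by exact/measurable_EFinP.
have g0E x : 0 <= (g x)%:E by rewrite lee_fin.
have lj j : j \in js -> has_exponential_law P (Y j) w.
  rewrite jsP => /andP[Dj j2]; have := lY _ Dj.
  by rewrite /initial_rate (eqP j2).
have jw A j : j \in js -> measurable A ->
    \int[P]_t ((\1_A (Y j t))%:E * (g (Y j t))%:E) = exponential_prob z A.
  move=> jj mA; rewrite -(exponential_reweight w0 z0 mA).
  have miE : measurable_fun setT (fun x : R => (\1_A x : R)%:E).
    by apply/measurable_EFinP; exact: measurable_indic.
  have i0 x : 0 <= (\1_A x : R)%:E by rewrite lee_fin.
  exact: (integral_has_exponential_law w0 (mY j) (lj _ jj)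
    (emeasurable_funM miE mgE) (fun x => mule_ge0 (i0 x) (g0E x))).
have gj : {in js, forall j, \int[P]_t (g (Y j t))%:E = 1}.
  move=> j jj; have := jw setT j jj measurableT.
  rewrite (@probability_setT _ _ _ (exponential_law z0)) => <-.
  by apply: eq_integral => t _; rewrite indicT/= mul1e.
have [Q [QE iQ Qr Qj]] := indep_tilt_seq mY uall iall mg g0 gj.
have fQ : exponential_family Q D Y (grid_rate z).
  split=> [s us sD|l Dl A mA].
    by apply: indep_subset iQ => // l /sD; rewrite allD.
  have : l \in js ++ rest by rewrite allD.
  rewrite mem_cat => /orP[lj'|lr].
    apply: (etrans (Qj _ _ lj' mA)); apply: (etrans (jw A l lj' mA)).
    by move: lj'; rewrite jsP => /andP[_ /eqP l2]; rewrite /grid_rate l2.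
  apply: (etrans (Qr _ _ lr mA)); apply: (etrans (lY _ Dl A mA)).
  move: lr; rewrite restP => /andP[_]; rewrite /initial_rate /grid_rate.
  by move: (Dl) => /andP[]; case: (l) => -[|[|[|c]]] [a b].
have ic a b : inside_rectangle m n (cell a b) ->
    inside_rectangle m n (hedge a b) && inside_rectangle m n (vedge a b).
  by rewrite /= => /andP[? ?]; apply/andP; split; lia.
have fin := @burke_shape _ _ _ Q W _ _ z mW z0 z1 (inside_rectangle m n) ic
  (fun=> m) n (fun=> leqnn m) _ fQ.
have [|iQ' lQ'] := fin; first by move=> a b bn am /=; rewrite am bn.
pose hs := [seq hedge a n | a <- iota 0 m].
have hsD l : l \in hs -> on_shape (fun b => if (b < n)%N then m else 0%N) l && inside_rectangle m n l.
  move=> /mapP[a]; rewrite mem_iota => /= am ->; rewrite /= ltnn leqnn am andbT /=.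
  by case: (n) => //= n'; rewrite leqnn am.
have uhs : uniq hs by rewrite map_inj_uniq ?iota_uniq// => x y [].
have ihs : indep Q hs Y by apply: iQ'.
(* The exponential moment of an increment of row [n], normalized to mean one under [Q]. *)
pose h x := ((1 - w) / (1 - z) * expR ((w - z) * x))%R.
have mh : measurable_fun setT h.
  by apply: measurable_funM => //; apply: measurableT_comp => //; exact: measurable_funM.
have h0 x : (0 <= h x)%R by rewrite mulr_ge0 ?expR_ge0// divr_ge0// ltW.
have mhE : measurable_fun setT (fun x => (h x)%:E) by exact/measurable_EFinP.
have h0E x : 0 <= (h x)%:E by rewrite lee_fin.
have wzE : (w - z = (1 - z) - (1 - w))%R by ring.
have hh : {in hs, forall l, \int[Q]_t (h (Y l t))%:E = 1}.
  move=> l lh; have lex : has_exponential_law Q (Y l) (1 - z).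
    have := lQ' _ (hsD _ lh); move: lh => /mapP[a _ ->]; exact.
  apply: (etrans (integral_has_exponential_law z1' (mY l) lex mhE h0E)).
  apply: (etrans _ (etrans (exponential_reweight z1' w1' (@measurableT _ (measurableTypeR R)))
    (@probability_setT _ _ _ (exponential_law w1')))).
  by congr integral; apply/funext => x; rewrite indicT mul1e /h wzE.
have := indep_expectation_prod1 mY uhs ihs (fun=> mh) (fun _ x => h0 x) hh.
rewrite QE; last 2 first.
- apply/measurable_EFinP; apply: measurable_prod => k _; exact: measurableT_comp.
- by move=> t; rewrite lee_fin prodr_ge0.
pose c := (((1 - w) / (1 - z)) ^+ m * (z / w) ^+ n)%R.
have c0 : (0 < c)%R by rewrite mulr_gt0// exprn_gt0// divr_gt0.
pose G t := lpp (1 - z)^-1 w^-1 (fun x y => W x y t) m n.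
(* Going up the vertical axis and then along row [n] telescopes to the passage time at [(m, n)]. *)
have prodE t : ((\prod_(i <- hs) h (Y i t))%:E * (\prod_(j <- js) g (Y j t))%:E =
    c%:E * (expR ((w - z) * G t))%:E).
  rewrite -!EFinM; congr EFin.
  rewrite /hs /js !big_map !big_split/= -!expR_sum -!mulr_sumr.
  have -> : iota 0 m = index_iota 0 m by rewrite /index_iota subn0.
  have -> : iota 0 n = index_iota 0 n by rewrite /index_iota subn0.
  rewrite !prodr_const_nat !subn0 mulrACA -expRD -mulrDr /c; congr (_ * expR (_ * _))%R.
    by rewrite !exprMn.
  have -> : (\sum_(0 <= i < m) hinc (1 - z)^-1 w^-1 (fun x y => W x y t) i n = G t - lpp (1 - z)^-1 w^-1 (fun x y => W x y t) 0 n)%R.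
    exact: (telescope_sumr (fun k => lpp (1 - z)^-1 w^-1 (fun x y => W x y t) k n)).
  have -> : (\sum_(0 <= i < n) vinc (1 - z)^-1 w^-1 (fun x y => W x y t) 0 i = lpp (1 - z)^-1 w^-1 (fun x y => W x y t) 0 n)%R.
    apply: (etrans (telescope_sumr (fun k => lpp (1 - z)^-1 w^-1 (fun x y => W x y t) 0 k) _)) => //.
    by rewrite lpp00 subr0.
  by rewrite subrK.
under eq_integral do rewrite prodE.
have mG : measurable_fun setT (fun t => (expR ((w - z) * G t))%:E).
  apply/measurable_EFinP; apply: measurableT_comp => //; apply: measurable_funM => //.
  exact: measurable_lpp.
rewrite ge0_integralZl//; last by rewrite lee_fin ltW.
set I := integral _ _ _ => cE.
have -> : I = (c^-1)%:E.
  by rewrite -[RHS]mule1 -cE muleA -EFinM mulVf ?gt_eqF// mul1e.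
by congr EFin; rewrite /c invfM -!exprVn !invf_div mulrC.
Qed.

End tilted_grid.

Section exit_probability.
Context {R : realType} {d} {T : measurableType d}.
Variables (P : probability T R) (W : nat -> nat -> T -> R) (N : nat).
Hypothesis mW : forall a b, measurable_fun setT (W a b).
Hypothesis W0 : forall a b t, 0 <= W a b t.
Hypothesis iW : mutually_independent P (used_site N) (fun p => W p.1 p.2).
Hypothesis lW : forall p, used_site N p -> has_exponential_law P (W p.1 p.2) 1.

Local Notation G al be a b t := (lpp al be (fun x y => W x y t) a b).

(* Raise the horizontal weights from rate [1 - rho] to rate [1 - z], with
   [z = rho + u]. The model with vertical rate [rho < z] has an explicit lower
   tail, the one with vertical rate [z + u > z] dominates the horizontal exits
   and has an explicit upper tail; [A] balances the two Chernoff bounds. *)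
Lemma exit_probability rho u a b : 0 < rho -> 0 < u -> rho + u + u < 1 ->
  (a + b <= N)%N ->
  (P [set t | (G 0 rho^-1 a b t < G (1 - rho)^-1 0 a b t)%R] <=
   (2 * expR (- (u ^+ 2 / 2 * (b%:R / (rho + u) ^+ 2 -
      a%:R / ((1 - (rho + u)) ^+ 2 - u ^+ 2)))))%:E)%E.
Proof.
move=> rho0 u0 rho1 abN; set z := rho + u; pose w := z + u.
have z0 : 0 < z by rewrite /z addr_gt0.
have w0 : 0 < w by rewrite addr_gt0.
have w1 : w < 1 by [].
have z1 : z < 1 by rewrite (lt_trans _ w1)// ltrDl.
have r1 : rho < 1 by rewrite (lt_trans _ z1)// ltrDl.
have [z1' w1' r1'] : [/\ 0 < 1 - z, 0 < 1 - w & 0 < 1 - rho] by rewrite !subr_gt0.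
pose c1 := (rho / z) ^+ b * ((1 - z) / (1 - rho)) ^+ a.
pose c2 := (w / z) ^+ b * ((1 - z) / (1 - w)) ^+ a.
have c10 : 0 < c1 by rewrite mulr_gt0// exprn_gt0// divr_gt0.
have c20 : 0 < c2 by rewrite mulr_gt0// exprn_gt0// divr_gt0.
pose A := (ln c2 - ln c1) / (2 * u).
(* The common value of the two Chernoff bounds at level [A]: the geometric mean of [c1] and [c2]. *)
pose B := expR ((ln c1 + ln c2) / 2).
have u20 : 2 * u != 0 by rewrite mulf_neq0// gt_eqF.
have mG al be : measurable_fun setT (fun t => G al be a b t) by exact: measurable_lpp.
have mE s al be : measurable_fun setT (fun t => expR (s * G al be a b t)).
  by apply: measurableT_comp => //; exact: measurable_funM.
have lowE : (P [set t | (expR (- u * A) <= expR (- u * G (1 - z)^-1 rho^-1 a b t))%R] <= B%:E)%E.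
  have -> : B = c1 / expR (- u * A).
    rewrite -expRN -{1}(lnK c10) -expRD /B /A; congr expR.
    by field; rewrite gt_eqF.
  apply: (markov_le (expR_gt0 _) (mE _ _ _) (fun t => expR_ge0 _)).
  have -> : - u = rho - z by rewrite /z opprD addrA subrr add0r.
  by rewrite (lpp_mgf mW iW lW).
have upE : (P [set t | (expR (u * A) <= expR (u * G (1 - z)^-1 w^-1 a b t))%R] <= B%:E)%E.
  have -> : B = c2 / expR (u * A).
    rewrite -expRN -{1}(lnK c20) -expRD /B /A; congr expR.
    by field; rewrite gt_eqF.
  apply: (markov_le (expR_gt0 _) (mE _ _ _) (fun t => expR_ge0 _)).
  have -> : u = w - z by rewrite /w addrAC subrr add0r.
  by rewrite (lpp_mgf mW iW lW).
have BE : B <= expR (- (u ^+ 2 / 2 * (b%:R / z ^+ 2 - a%:R / ((1 - z) ^+ 2 - u ^+ 2)))).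
  have D0 : 0 < (1 - z) ^+ 2 - u ^+ 2.
    by rewrite subr_sqr mulr_gt0//; rewrite /w in w1'; lra.
  rewrite /B ler_expR -lnM ?posrE// ler_pdivrMr//.
  (* Since [rho = z - u] and [w = z + u], one has [rho * w = z^2 - u^2] and
     [(1 - rho) * (1 - w) = (1 - z)^2 - u^2]; the first-order terms in [u] cancel in [c1 * c2]. *)
  pose x1 := - (u ^+ 2 / z ^+ 2); pose x2 := u ^+ 2 / ((1 - z) ^+ 2 - u ^+ 2).
  have -> : - (u ^+ 2 / 2 * (b%:R / z ^+ 2 - a%:R / ((1 - z) ^+ 2 - u ^+ 2))) * 2 =
      x1 * b%:R + x2 * a%:R.
    by rewrite /x1 /x2; field; rewrite !gt_eqF.
  rewrite -[leRHS]expRK ler_ln ?posrE ?expR_gt0 ?(mulr_gt0 c10 c20)//.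
  have -> : c1 * c2 = (1 + x1) ^+ b * (1 + x2) ^+ a.
    rewrite /c1 /c2 mulrACA -!exprMn; congr (_ ^+ _ * _ ^+ _).
      by rewrite /x1 /w /z; field; rewrite gt_eqF.
    rewrite /x2 /w /z; rewrite /w /z in w1' r1' z1' D0; field.
    by rewrite !gt_eqF//; lra.
  have x20 : 0 <= x2 by rewrite divr_ge0 ?sqr_ge0// ltW.
  have x10 : 0 <= 1 + x1.
    rewrite /x1 subr_ge0 ler_pdivrMr ?exprn_gt0// mul1r lerXn2r ?nnegrE ?ltW//.
    by rewrite /z ltrDr.
  have x20' : 0 <= 1 + x2 by rewrite addr_ge0.
  have p1 : (1 + x1) ^+ b <= expR (x1 * b%:R).
    by rewrite expRM_natr lerXn2r ?nnegrE ?expR_ge0// expR_ge1Dx.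
  have p2 : (1 + x2) ^+ a <= expR (x2 * a%:R).
    by rewrite expRM_natr lerXn2r ?nnegrE ?expR_ge0// expR_ge1Dx.
  by rewrite expRD ler_pM// exprn_ge0.
have BB : (B%:E + B%:E <= (2 * expR (- (u ^+ 2 / 2 *
    (b%:R / z ^+ 2 - a%:R / ((1 - z) ^+ 2 - u ^+ 2)))))%:E)%E.
  rewrite -EFinD lee_fin; move: BE; set e := expR (- _) => BE; lra.
apply: (le_trans _ BB); apply: (le_trans _ (leeD lowE upE)).
have m1 : measurable [set t | (expR (- u * A) <= expR (- u * G (1 - z)^-1 rho^-1 a b t))%R].
  by apply: measurable_le_set => //; exact: mE.
have m2 : measurable [set t | (expR (u * A) <= expR (u * G (1 - z)^-1 w^-1 a b t))%R].
  by apply: measurable_le_set => //; exact: mE.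
apply: (le_trans _ (measureU2 P m1 m2)).
apply: le_measure; rewrite ?inE.
- rewrite (_ : [set t | _] = ~` [set t | (G (1 - rho)^-1 0 a b t <= G 0 rho^-1 a b t)%R]).
    by apply: measurableC; apply: measurable_le_set.
  by apply/seteqP; split => t /=; rewrite ltNge => /negP.
- exact: measurableU.
move=> t /=; rewrite !ler_expR !mulNr lerN2 !ler_pM2l// => VH.
have W0t x y : 0 <= W x y t by exact: W0.
(* If the dominating model stays below [A], so does its horizontal part, hence also the smaller
   vertical part on this event; their maximum is the model with rates [1 - z] and [rho]. *)
have [AG|GA] := leP A (G (1 - z)^-1 w^-1 a b t); [by right|left].
have alz : (1 - rho)^-1 <= (1 - z)^-1 by rewrite lef_pV2 ?posrE// lerD2l lerN2 lerDl ltW.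
have HzG : G (1 - z)^-1 0 a b t <= G (1 - z)^-1 w^-1 a b t.
  by apply: le_lpp; rewrite // invr_ge0 ltW.
have HHz : G (1 - rho)^-1 0 a b t <= G (1 - z)^-1 0 a b t by exact: le_lpp.
have al0 : 0 <= (1 - z)^-1 by rewrite invr_ge0 ltW.
have be0 : 0 <= rho^-1 by rewrite invr_ge0 ltW.
rewrite (@lpp_max _ _ _ _ a b al0 be0 W0t) ge_max.
by apply/andP; split; lra.
Qed.

End exit_probability.

(** * One-sided control of the narrow wedge profile *)

Section parameter_estimates.
Context {R : realType} {d} {T : measurableType d}.

(** The factor 16 comes from [z * (1 - z) <= 1 / 4], which bounds the common denominator by
    [1 / 16]. *)
Lemma exit_exponent (a b z u L : R) : 0 < z -> 0 < 1 - z -> 0 < (1 - z) ^+ 2 - u ^+ 2 ->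
  0 <= L -> L <= b * ((1 - z) ^+ 2 - u ^+ 2) - a * z ^+ 2 ->
  16 * L <= b / z ^+ 2 - a / ((1 - z) ^+ 2 - u ^+ 2).
Proof.
move=> z0 z1; set D := _ - u ^+ 2 => D0 L0 LN.
have zD0 : 0 < z ^+ 2 * D by rewrite mulr_gt0 ?exprn_gt0.
have -> : b / z ^+ 2 - a / D = (b * D - a * z ^+ 2) / (z ^+ 2 * D).
  by field; rewrite !gt_eqF.
rewrite ler_pdivlMr//; apply: le_trans LN.
rewrite -[leRHS]mul1r mulrAC ler_wpM2r//.
have h : z ^+ 2 * D <= (z * (1 - z)) ^+ 2.
  rewrite exprMn ler_wpM2l ?sqr_ge0// /D gerBl; exact: sqr_ge0.
have h2 : (z * (1 - z)) ^+ 2 <= (1 / 4) ^+ 2.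
  have h1 : z * (1 - z) <= 1 / 4 by have := sqr_ge0 (z - 1 / 2); nra.
  by rewrite lerXn2r ?nnegrE//; apply: mulr_ge0; lra.
have h3 : (1 / 4) ^+ 2 = 1 / 16 :> R by field.
by move: h2; rewrite h3 => h2; lra.
Qed.

Lemma exit_small (P : probability T R) (W : nat -> nat -> T -> R) N rho u a b (L : R) :
  (forall a b, measurable_fun setT (W a b)) -> (forall a b t, 0 <= W a b t) ->
  mutually_independent P (used_site N) (fun p => W p.1 p.2) ->
  (forall p, used_site N p -> has_exponential_law P (W p.1 p.2) 1) ->
  0 < rho -> 0 < u -> rho + u + u < 1 -> (a + b <= N)%N -> 0 <= L ->
  L <= b%:R * ((1 - (rho + u)) ^+ 2 - u ^+ 2) - a%:R * (rho + u) ^+ 2 ->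
  (P [set t | (lpp 0 rho^-1 (fun x y => W x y t) a b <
               lpp (1 - rho)^-1 0 (fun x y => W x y t) a b)%R] <=
   (2 * expR (- (8 * u ^+ 2 * L)))%:E)%E.
Proof.
move=> mW W0 iW lW rho0 u0 rho1 abN L0 LN.
apply: (le_trans (exit_probability mW W0 iW lW rho0 u0 rho1 abN)).
have z0 : 0 < rho + u by rewrite addr_gt0.
have z1 : 0 < 1 - (rho + u) by lra.
have D0 : 0 < (1 - (rho + u)) ^+ 2 - u ^+ 2.
  by rewrite subr_sqr mulr_gt0//; lra.
have := exit_exponent z0 z1 D0 L0 LN.
set E := _ - _ => LE.
rewrite lee_fin ler_wpM2l// ler_expR lerN2.
have u2 : 0 <= u ^+ 2 := sqr_ge0 u.
nra.
Qed.

(** The exact value is [(1 - 4 e^2) / (1 - 16 e^2)], about [1 + 12 e^2]; the constant 30 leaves room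
    for [e] up to [1 / 8]. *)
Lemma step_mgf_low (e : R) : 0 < e -> e <= 1 / 8 ->
  (1 / 2 - e) / (1 / 2 - e - e) * ((1 - (1 / 2 - e)) / (1 - (1 / 2 - e) + e)) <=
  expR (e * (30 * e)).
Proof.
move=> e0 e8; apply: le_trans (expR_ge1Dx _).
have -> : (1 / 2 - e) / (1 / 2 - e - e) * ((1 - (1 / 2 - e)) / (1 - (1 / 2 - e) + e)) =
   (1 - 4 * e ^+ 2) / (1 - 16 * e ^+ 2).
  by field; rewrite !gt_eqF//; nra.
rewrite ler_pdivrMr; last by nra.
have : e ^+ 2 <= 1 / 64 by nra.
have := sqr_ge0 e; nra.
Qed.

(** Here the exact value is [1 - 4 e^2], below one: this is the source of the drop. *)
Lemma step_mgf_high (e : R) : 0 < e -> e <= 1 / 8 ->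
  (1 / 2 + e) / (1 / 2 + e - e) * ((1 - (1 / 2 + e)) / (1 - (1 / 2 + e) + e)) <=
  expR (e * (- 2 * e)).
Proof.
move=> e0 e8; apply: (@le_trans _ _ (expR (- 4 * e ^+ 2))).
  apply: le_trans (expR_ge1Dx _).
  rewrite le_eqVlt; apply/orP; left; apply/eqP; field.
  by rewrite !gt_eqF//; lra.
by rewrite ler_expR; nra.
Qed.

Lemma step_mgf_flat (e : R) : 0 < e -> e <= 1 / 8 ->
  (1 / 2) / (1 / 2 - e) * ((1 / 2) / (1 / 2 + e)) <= expR (e * (8 * e)).
Proof.
move=> e0 e8; apply: le_trans (expR_ge1Dx _).
have -> : (1 / 2) / (1 / 2 - e) * ((1 / 2) / (1 / 2 + e)) = 1 / (1 - 4 * e ^+ 2).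
  by field; rewrite !gt_eqF//; nra.
rewrite ler_pdivrMr; last by nra.
have : e ^+ 2 <= 1 / 64 by nra.
have := sqr_ge0 e; nra.
Qed.

(** With [z = 1 / 2 - e / 2] and [u = e / 2], the gain [N * e / 2] from a density below [1 / 2]
    favours the vertical exit even on the diagonal. *)
Lemma exit_near (A B N e : R) : 0 < e -> e <= 1 / 8 -> A + B = N -> 0 <= A ->
  (B - A) / 4 * (1 + e ^+ 2) + N * e / 2 - N * e ^+ 2 / 4 <=
  B * ((1 - (1 / 2 - e + e / 2)) ^+ 2 - (e / 2) ^+ 2) - A * (1 / 2 - e + e / 2) ^+ 2.
Proof.
move=> e0 e8 AB A0; have -> : B = N - A by lra.
have : 0 <= A * e ^+ 2 by rewrite mulr_ge0// sqr_ge0.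
nra.
Qed.

(** Above density [1 / 2] the vertical exit costs about [2 * N * e], to be paid for by the distance
    [B - A] from the diagonal. *)
Lemma exit_far (A B N e : R) : 0 < e -> A + B = N -> 0 <= A -> 0 <= B - A ->
  (B - A) / 4 - 2 * N * e - N * e ^+ 2 <=
  B * ((1 - (1 / 2 + e + e)) ^+ 2 - e ^+ 2) - A * (1 / 2 + e + e) ^+ 2.
Proof.
move=> e0 AB A0 BA.
have h1 : 0 <= A * e ^+ 2 by rewrite mulr_ge0// sqr_ge0.
have h2 : 0 <= (B - A) * e ^+ 2 by rewrite mulr_ge0// sqr_ge0.
have -> : N = A + B by lra.
nra.
Qed.

End parameter_estimates.

(** * Numerical inequalities between the scales *)

Section scales.
Context {R : realType}.
Implicit Types (r del X C n a b N k y eps e : R).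

(* The proof of [one_sided_bound] uses the densities [1 / 2 - e] and [1 / 2 + eps]
   with [eps = r n^(-1/3) / 64] and [e = eps / 124], so [n e = kappa r n^(2/3)]. *)
Definition kappa : R := 1 / (64 * 124).

Lemma kappa_gt0 : 0 < kappa.
Proof. by rewrite divr_gt0 ?mulr_gt0. Qed.

Lemma scale_del r del C : 0 <= C -> 0 < del ->
  300 * (300 * (C + 1)) <= r -> r * del <= 1 / 10 -> del <= 1 / 10 /\ 1 <= r.
Proof.
move=> C0 d0 rC rd; have r1 : 1 <= r by lra.
split => //; apply: le_trans rd; rewrite -[leLHS]mul1r ler_wpM2r//; exact: ltW.
Qed.

Lemma scale_X del X n : 0 < del -> n * del = X -> X * del ^+ 2 = 1 -> del <= 1 / 10 ->
  0 <= n -> 1 <= X /\ 1 <= n.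
Proof.
move=> d0 nX XE d1 n0.
have X0 : 0 <= X by rewrite -nX mulr_ge0// ltW.
have X1 : 1 <= X.
  rewrite -XE -[leRHS]mulr1 ler_wpM2l//.
  by rewrite expr2; nra.
split => //; rewrite -nX in X1; nra.
Qed.

(** The lower bound on [r] makes the offset [C * X] of the end point negligible: below
    [kappa * (r * X) / 3], which the comparison near the diagonal requires. *)
Lemma scale_y r X C : 0 <= C -> 1 <= X -> 300 * (300 * (C + 1)) <= r ->
  300 <= r * X /\ C * X + 3 <= r * X / 30 / 1000.
Proof.
move=> C0 X1 rC.
have h : 300 * (300 * (C * X + X)) <= r * X.
  have -> : 300 * (300 * (C * X + X)) = (300 * (300 * (C + 1))) * X by ring.
  by rewrite ler_wpM2r//; lra.
have : 0 <= C * X by rewrite mulr_ge0//; lra.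
by split; lra.
Qed.

Lemma scale_near_exit a b N C X y n e : 0 <= C * X -> 0 < e -> e <= 1 / 64 -> a + b = N ->
  N = 2 * n + 1 -> 1 <= n -> n * e = kappa * y -> 0 <= y ->
  - (2 * C * X + 3) <= b - a -> C * X + 3 <= y / 30 / 1000 ->
  kappa * y / 2 <= (b - a) / 4 * (1 + e ^+ 2) + N * e / 2 - N * e ^+ 2 / 4.
Proof.
move=> CX0 e0 e64 abN NE n1 ne y0 ba CX.
have e2 : e ^+ 2 <= 1 / 64 by nra.
have e20 : 0 <= e ^+ 2 := sqr_ge0 e.
have ky0 : 0 <= kappa * y by rewrite mulr_ge0// ltW ?kappa_gt0.
have h1 : - (2 * C * X + 3) / 2 <= (b - a) / 4 * (1 + e ^+ 2).
  have : 0 <= (b - a + (2 * C * X + 3)) * (1 + e ^+ 2) by rewrite mulr_ge0//; lra.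
  have : 0 <= (2 * C * X + 3) * (1 - e ^+ 2) by rewrite mulr_ge0//; lra.
  lra.
have en : e <= n * e by rewrite -[leLHS]mul1r ler_wpM2r// ltW.
have h2 : N * e ^+ 2 / 4 <= kappa * y / 8.
  have -> : N * e ^+ 2 = (2 * (n * e) + e) * e by rewrite NE; ring.
  have : (2 * (n * e) + e) * e <= (3 * (kappa * y)) * (1 / 64).
    by apply: ler_pM; lra.
  by lra.
have h3 : N * e / 2 = kappa * y + e / 2 by rewrite NE -ne; field.
have CXk : C * X + 3 <= kappa * y / 3 by move: CX; rewrite /kappa; lra.
rewrite h3; lra.
Qed.

(** Moving by [k >= y / 4] changes [b - a] by at least [y / 2] and so gains [y / 8]; the density
    costs about [4 * n * eps = y / 16], and half of the remaining [y / 16] absorbs the errors. *)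
Lemma scale_far_exit a b N C X y n eps k : 0 < eps -> eps <= 1 / 64 ->
  N = 2 * n + 1 -> 1 <= n -> n * eps = y / 64 -> 300 <= y -> y / 4 <= k ->
  - (2 * C * X + 3) <= b - a -> C * X + 3 <= y / 30 / 1000 ->
  y / 32 <= (b + k - (a - k)) / 4 - 2 * N * eps - N * eps ^+ 2.
Proof.
move=> e0 e64 NE n1 ne y0 yk ba CX.
have en : eps <= n * eps by rewrite -[leLHS]mul1r ler_wpM2r// ltW.
have h2 : N * eps ^+ 2 <= (3 * (y / 64)) * (1 / 64).
  have -> : N * eps ^+ 2 = (2 * (n * eps) + eps) * eps by rewrite NE; ring.
  by apply: ler_pM; lra.
have h3 : 2 * N * eps = y / 16 + 2 * eps.
  have -> : 2 * N * eps = 4 * (n * eps) + 2 * eps by rewrite NE; ring.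
  by rewrite ne; lra.
rewrite h3; lra.
Qed.

(** As [k] is at most [m / 3], the sum is at most [- 7 / 12 * eps * m]. *)
Lemma scale_walks k m M y eps D : 0 <= eps -> k <= y / 4 + 1 -> y - 2 <= M -> M <= m ->
  300 <= y -> D < eps * k / 4 + (- 2 * eps + eps) * (m - k) ->
  D < - (3 / 8 * eps * m).
Proof.
move=> eps0 ky yM Mm y300 DE.
have : eps * k <= eps * (m / 3) by rewrite ler_wpM2l//; lra.
have : 0 <= eps * m by rewrite mulr_ge0//; lra.
lra.
Qed.

Lemma scale_eps (x : R) : 0 <= x -> kappa ^+ 3 * x <= x / (64 * 64) / 4.
Proof.
move=> x0; have k1 : kappa <= 1 / 64 :> R by rewrite /kappa; lra.
have k3 : kappa ^+ 3 <= (1 / 64) ^+ 3 :> R.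
  by rewrite lerXn2r ?nnegrE// ltW// kappa_gt0.
apply: le_trans (ler_wpM2r x0 k3) _.
have -> : (1 / 64) ^+ 3 * x = x / (64 * 64) / 64 by field.
by lra.
Qed.

Lemma scale_walk (x : R) : 0 <= x -> kappa ^+ 3 * x <= x / (64 * 48) / (64 * 48) / 2.
Proof.
move=> x0; apply: le_trans (ler_wpM2r x0 (_ : _ <= (1 / (64 * 48)) ^+ 2 * (1 / 2))) _.
  have k1 : kappa <= 1 / (64 * 48) :> R by rewrite /kappa; lra.
  have k0 : 0 <= kappa :> R by rewrite ltW// kappa_gt0.
  by rewrite exprSr ler_pM ?exprn_ge0 ?lerXn2r ?nnegrE// /kappa; lra.
by rewrite le_eqVlt; apply/orP; left; apply/eqP; field.
Qed.

Lemma scale_e (x : R) : 0 <= x -> 4 * (kappa ^+ 3 * x) <= kappa ^+ 2 * x.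
Proof.
move=> x0; rewrite exprS -mulrA; set z := kappa ^+ 2 * x.
have z0 : 0 <= z by rewrite mulr_ge0// sqr_ge0.
by rewrite /kappa; lra.
Qed.

End scales.
Arguments kappa {R}.

Section one_sided_bound.
Context {R : realType} {d} {T : measurableType d}.

(* With [D m] the passage time to [(a - m, b + m)]: stationary comparison at
   [(a, b)] with density [1 / 2 - e] bounds the growth of [D] up to [m = k], and
   comparison at [(a - k, b + k)] with density [1 / 2 + eps] makes [D] decrease
   linearly afterwards. The two comparisons fail on [E1], [E2], the two walks
   of stationary increments deviate on [E3], [E4]. *)
Lemma one_sided_bound (P : probability T R) (W : nat -> nat -> T -> R) (n N a b M : nat)
    (r del X C : R) :
  (forall a b, measurable_fun setT (W a b)) -> (forall a b t, 0 <= W a b t) ->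
  mutually_independent P (used_site N) (fun p => W p.1 p.2) ->
  (forall p, used_site N p -> has_exponential_law P (W p.1 p.2) 1) ->
  N = (n + n + 1)%N -> (a + b = N)%N ->
  0 < del -> n%:R * del = X -> X * del ^+ 2 = 1 -> 0 <= C ->
  `|b%:R - a%:R| <= 2 * C * X + 3 ->
  300 * (300 * (C + 1)) <= r -> r * del <= 1 / 10 -> r * X - 2 <= M%:R ->
  (P [set t | exists2 m, (m <= a)%N && (M <= m)%N &
     (- (3 / 8 * (r * del / 64) * m%:R) <=
      lpp 0 0 (fun x y => W x y t) (a - m) (b + m) - lpp 0 0 (fun x y => W x y t) a b)%R] <=
   (6 * expR (- (kappa ^+ 3 * r ^+ 3)))%:E)%E.
Proof.
move=> mW W0 iW lW NE abN del0 nX XE C0 ba rC rdel rM.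
set E := [set t | _].
have bound0 : (0 <= (6 * expR (- (kappa ^+ 3 * r ^+ 3)))%:E)%E.
  by rewrite lee_fin mulr_ge0// expR_ge0.
have [Ma|aM] := leqP M a; last first.
  rewrite (_ : E = set0) ?measure0//; apply/seteqP; split => // t [m /andP[ma Mm] _].
  by move: (leq_trans Mm ma); rewrite leqNgt aM.
have [[del1 r1] n0] := (scale_del C0 del0 rC rdel, ler0n R n).
have [X1 n1] := scale_X del0 nX XE del1 n0.
have [y300 CX] := scale_y C0 X1 rC.
have CX0 : 0 <= C * X by rewrite mulr_ge0// (le_trans _ X1).
set y := r * X in rM y300 CX.
(* The divisor 124 makes [31 * e = eps / 4]: a walk of slope [30 * e + e] rises by at most
   [eps * k / 4] in [k] steps. *)
pose eps := r * del / 64; pose e := eps / 124.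
have rd0 : 0 < r * del by rewrite mulr_gt0// (lt_le_trans _ r1).
have eps0 : 0 < eps by rewrite divr_gt0.
have e0 : 0 < e by rewrite divr_gt0.
have eps1 : eps <= 1 / 64 by rewrite /eps; move: rdel; clear; lra.
have e1 : e <= 1 / 64 by rewrite /e; move: eps1 eps0; clear; lra.
have nE : n%:R * eps = y / 64 by rewrite /eps /y -nX; field.
have nE' : n%:R * e = kappa * y by rewrite /e mulrA nE /kappa; field.
have y_eps : y * eps ^+ 2 = r ^+ 3 / (64 * 64).
  have -> : y * eps ^+ 2 = r ^+ 3 * (X * del ^+ 2) / (64 * 64) by rewrite /y /eps; field.
  by rewrite XE mulr1.
have y_e : y * e ^+ 2 = kappa ^+ 2 * r ^+ 3.
  have -> : y * e ^+ 2 = y * eps ^+ 2 / (124 * 124) by rewrite /e; field.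
  by rewrite y_eps /kappa; field.
have r30 : 0 <= r ^+ 3 by rewrite exprn_ge0// (le_trans _ r1).
have k30 : 0 <= kappa ^+ 3 * r ^+ 3 by rewrite mulr_ge0// exprn_ge0// ltW ?kappa_gt0.
have y0 : 0 <= y := le_trans (ler0n R 300) y300.
have y40 : 0 <= y / 4 := divr_ge0 y0 (ler0n R 4).
(* [k] must be at least [y / 4] to pay for the vertical exit at density [1 / 2 + eps], and small
   against [M] for the drop to outweigh the first rise. *)
have [k k1 k2] : exists2 k : nat, y / 4 <= k%:R & k%:R <= y / 4 + 1.
  exists (Num.truncn (y / 4)).+1; first by rewrite ltW//; exact: truncnS_gt.
  by rewrite -natr1 lerD2r truncn_le.
have kM : (k <= M)%N by rewrite -(ler_nat R); move: k2 rM y300; clear; lra.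
have ka : (k <= a)%N := leq_trans kM Ma.
have NR : N%:R = 2 * n%:R + 1 :> R by rewrite NE !natrD; clear; lra.
have abR : a%:R + b%:R = N%:R :> R by rewrite -natrD abN.
have [rho1 rho2] : 0 < 1 / 2 - e /\ 0 < 1 / 2 + eps by split; move: e1 eps0; clear; lra.
pose D m t := lpp 0 0 (fun x y => W x y t) (a - m) (b + m).
pose E1 := [set t | (lpp 0 (1 / 2 - e)^-1 (fun x y => W x y t) a b <
   lpp (1 - (1 / 2 - e))^-1 0 (fun x y => W x y t) a b)%R].
pose E2 := [set t | (lpp 0 (1 / 2 + eps)^-1 (fun x y => W x y t) (a - k) (b + k) <
   lpp (1 - (1 / 2 + eps))^-1 0 (fun x y => W x y t) (a - k) (b + k))%R].
pose S1 := antidiag_step W (1 / 2 - e) a b.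
pose S2 := antidiag_step W (1 / 2 + eps) (a - k) (b + k).
pose E3 := [set t | exists2 j, (j <= a)%N && (k <= j)%N &
   ((30 * e + e) * j%:R <= \sum_(0 <= i < j) S1 i t)%R].
pose E4 := [set t | exists2 j, (j <= a - k)%N && (M - k <= j)%N &
   ((- 2 * eps + eps) * j%:R <= \sum_(0 <= i < j) S2 i t)%R].
have akbk : (a - k + (b + k) = N)%N by rewrite addnCA subnK// addnC.
have baL : - (2 * C * X + 3) <= b%:R - a%:R by move: ba; rewrite ler_norml => /andP[].
have PE1 : (P E1 <= (2 * expR (- (kappa ^+ 3 * r ^+ 3)))%:E)%E.
  have L0 : 0 <= kappa * y / 2 by rewrite -nE' divr_ge0// mulr_ge0// ltW.
  have e20 : 0 < e / 2 by rewrite divr_gt0.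
  have lt1 : 1 / 2 - e + e / 2 + e / 2 < 1 by move: e0; clear; lra.
  have abN' : (a + b <= N)%N by rewrite abN.
  apply: le_trans (exit_small (L := kappa * y / 2) mW W0 iW lW rho1 e20 lt1 abN' L0 _) _.
    have e8 : e <= 1 / 8 by move: e1; clear; lra.
    apply: le_trans (exit_near e0 e8 abR (ler0n _ _)).
    exact: (scale_near_exit CX0 e0 e1 abR NR n1 nE' y0 baL CX).
  rewrite lee_fin ler_wpM2l// ler_expR lerN2.
  have -> : 8 * (e / 2) ^+ 2 * (kappa * y / 2) = kappa * (y * e ^+ 2) by field.
  by rewrite y_e mulrA -exprS.
have PE2 : (P E2 <= (2 * expR (- (kappa ^+ 3 * r ^+ 3)))%:E)%E.
  have L0 : 0 <= y / 32 by rewrite divr_ge0.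
  have lt1 : 1 / 2 + eps + eps + eps < 1 by move: eps1; clear; lra.
  have abN' : (a - k + (b + k) <= N)%N by rewrite akbk.
  apply: le_trans (exit_small (L := y / 32) mW W0 iW lW rho2 eps0 lt1 abN' L0 _) _.
    have abR' : (a - k)%:R + (b + k)%:R = N%:R :> R by rewrite -natrD akbk.
    have far := scale_far_exit eps0 eps1 NR n1 nE y300 k1 baL CX.
    have ba0 : 0 <= (b + k)%:R - (a - k)%:R :> R.
      rewrite natrD natrB//; move: baL CX k1 y300; clear; lra.
    apply: le_trans (exit_far eps0 abR' (ler0n _ _) ba0).
    by rewrite natrD natrB.
  rewrite lee_fin ler_wpM2l// ler_expR lerN2.
  have -> : 8 * eps ^+ 2 * (y / 32) = y * eps ^+ 2 / 4 by field.
  rewrite y_eps; move: r30 (scale_eps r30); clear; lra.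
have PE3 : (P E3 <= (expR (- (kappa ^+ 3 * r ^+ 3)))%:E)%E.
  have mS i : measurable_fun setT (S1 i) by exact: measurable_antidiag_step.
  have rho1' : 1 / 2 - e < 1 by move: e0; clear; lra.
  have iS : indep P (iota 0 a) S1 by exact: (indep_antidiag_step mW iW lW rho1 rho1' abN).
  apply: le_trans (walk_tail k e0 (ltW e0) mS iS _) _ => [i ia|].
    have lt1 : e < 1 / 2 - e by move: e1; clear; lra.
    have lt2 : - e < 1 - (1 / 2 - e) by move: e0; clear; lra.
    rewrite (antidiag_step_mgf mW iW lW rho1 rho1' lt1 lt2 abN ia) lee_fin.
    by apply: step_mgf_low => //; move: e1; clear; lra.
  rewrite lee_fin ler_expR lerN2 -expr2.
  have : e ^+ 2 * (y / 4) <= e ^+ 2 * k%:R by rewrite ler_wpM2l ?sqr_ge0.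
  have -> : e ^+ 2 * (y / 4) = (y * e ^+ 2) / 4 by field.
  rewrite y_e; move: (scale_e r30); clear; lra.
have PE4 : (P E4 <= (expR (- (kappa ^+ 3 * r ^+ 3)))%:E)%E.
  have mS i : measurable_fun setT (S2 i) by exact: measurable_antidiag_step.
  have rho2' : 1 / 2 + eps < 1 by move: eps1; clear; lra.
  have iS : indep P (iota 0 (a - k)) S2 by exact: (indep_antidiag_step mW iW lW rho2 rho2' akbk).
  apply: le_trans (walk_tail (M - k) eps0 (ltW eps0) mS iS _) _ => [i ia|].
    have lt1 : eps < 1 / 2 + eps by clear; lra.
    have lt2 : - eps < 1 - (1 / 2 + eps) by clear; lra.
    rewrite (antidiag_step_mgf mW iW lW rho2 rho2' lt1 lt2 akbk ia) lee_fin.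
    by apply: step_mgf_high => //; move: eps1; clear; lra.
  rewrite lee_fin ler_expR lerN2 -expr2.
  have : eps ^+ 2 * (y / 2) <= eps ^+ 2 * (M - k)%:R.
    by rewrite ler_wpM2l ?sqr_ge0// natrB//; move: k2 rM y300; clear; lra.
  have -> : eps ^+ 2 * (y / 2) = (y * eps ^+ 2) / 2 by field.
  rewrite y_eps; move: r30 (scale_eps r30); clear; lra.
have mlpp al be x z : measurable_fun setT (fun t => lpp al be (fun x y => W x y t) x z).
  exact: measurable_lpp.
have mE1 : measurable E1 by exact: measurable_lt_set.
have mE2 : measurable E2 by exact: measurable_lt_set.
have mE3 : measurable E3.
  apply: measurable_bounded_ex => j; apply: measurable_le_set => //.
  by apply: measurable_sum => i; exact: measurable_antidiag_step.
have mE4 : measurable E4.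
  apply: measurable_bounded_ex => j; apply: measurable_le_set => //.
  by apply: measurable_sum => i; exact: measurable_antidiag_step.
have mE : measurable E.
  apply: measurable_bounded_ex => j; apply: measurable_le_set => //.
  exact: measurable_funB.
have sub : E `<=` E1 `|` E2 `|` E3 `|` E4.
  move=> t [m /andP[ma Mm] Dm]; apply: contrapT => nE0.
  have {nE0} [nE1 nE2 nE3 nE4] : [/\ ~ E1 t, ~ E2 t, ~ E3 t & ~ E4 t].
    by split => Et; apply: nE0; [left; left; left|left; left; right|left; right|right].
  have W0t x z : 0 <= W x z t by exact: W0.
  have km : (k <= m)%N := leq_trans kM Mm.
  have inv0 (x : R) : 0 < x -> 0 <= x^-1 by move=> x0; rewrite invr_ge0 ltW.
  have rho1' : 0 < 1 - (1 / 2 - e) by move: e0; clear; lra.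
  have rho2' : 0 < 1 - (1 / 2 + eps) by move: eps1; clear; lra.
  have c1 : D k t - D 0%N t <= \sum_(0 <= i < k) S1 i t.
    have h : lpp (1 - (1 / 2 - e))^-1 0 (fun x y => W x y t) a b <=
        lpp 0 (1 / 2 - e)^-1 (fun x y => W x y t) a b.
      by rewrite leNgt; apply/negP.
    have := exit_comparison (inv0 _ rho1') (inv0 _ rho1) W0t ka h.
    by rewrite [X in _ <= X -> _]lpp_antidiag_sum// /D subn0 addn0.
  have c2 : D m t - D k t <= \sum_(0 <= i < m - k) S2 i t.
    have h : lpp (1 - (1 / 2 + eps))^-1 0 (fun x y => W x y t) (a - k) (b + k) <=
        lpp 0 (1 / 2 + eps)^-1 (fun x y => W x y t) (a - k) (b + k).
      by rewrite leNgt; apply/negP.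
    have mk : (m - k <= a - k)%N := leq_sub2r k ma.
    have := exit_comparison (inv0 _ rho2') (inv0 _ rho2) W0t mk h.
    rewrite [X in _ <= X -> _]lpp_antidiag_sum// /D.
    have -> : (a - k - (m - k) = a - m)%N by rewrite subnBA// subnK.
    have -> : (b + k + (m - k) = b + m)%N by rewrite -addnA subnKC.
    by [].
  have c3 : \sum_(0 <= i < k) S1 i t < (30 * e + e) * k%:R.
    by rewrite ltNge; apply/negP => h; apply: nE3; exists k; rewrite ?ka ?leqnn.
  have c4 : \sum_(0 <= i < m - k) S2 i t < (- 2 * eps + eps) * (m - k)%:R.
    rewrite ltNge; apply/negP => h; apply: nE4; exists (m - k)%N => //.
    by rewrite !leq_sub2r.
  have D0 : D 0%N t = lpp 0 0 (fun x y => W x y t) a b by rewrite /D subn0 addn0.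
  move: Dm; rewrite -/(D m t) -D0 -/eps => Dm.
  rewrite natrB// in c4.
  have mM : M%:R <= m%:R :> R by rewrite ler_nat.
  have eE : (30 * e + e) * k%:R = eps * k%:R / 4 by rewrite /e; field.
  rewrite eE in c3.
  have c5 : D m t - D 0%N t < eps * k%:R / 4 + (- 2 * eps + eps) * (m%:R - k%:R).
    by move: c1 c2 c3 c4; clear; lra.
  have := scale_walks (ltW eps0) k2 rM mM y300 c5.
  by rewrite ltNge => /negP; apply; move: Dm; rewrite mulrAC mulrA mulrAC.
have -> : (6 * expR (- (kappa ^+ 3 * r ^+ 3)))%:E = ((2 * expR (- (kappa ^+ 3 * r ^+ 3)))%:E +
   (2 * expR (- (kappa ^+ 3 * r ^+ 3)))%:E + (expR (- (kappa ^+ 3 * r ^+ 3)))%:E +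
   (expR (- (kappa ^+ 3 * r ^+ 3)))%:E)%E.
  by rewrite -!EFinD; congr EFin; clear; ring.
apply: (le_trans _ (leeD (leeD (leeD PE1 PE2) PE3) PE4)).
apply: (@le_trans _ _ (P (E1 `|` E2 `|` E3 `|` E4))).
  by apply: le_measure; rewrite ?inE//; do 3 apply: measurableU => //.
apply: (le_trans (measureU2 P _ mE4)); first by do 2 apply: measurableU => //.
apply: leeD => //; apply: (le_trans (measureU2 P _ mE3)); first by apply: measurableU.
by apply: leeD => //; exact: measureU2.
Qed.

End one_sided_bound.

Local Arguments lpp : simpl never.

(** * Passage times and exit points *)

Section passage_times.
Context {R : realType}.
Implicit Types (om : pt -> R) (x y : pt) (pf : int -> \bar R).

Lemma bigmax_attained {d} {T : orderType d} {I : eqType} (x0 : T) (s : seq I) (Q : pred I)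
    (F : I -> T) :
  \big[Order.max/x0]_(i <- s | Q i) F i = x0 \/
  exists2 i, (i \in s) && Q i & \big[Order.max/x0]_(i <- s | Q i) F i = F i.
Proof.
elim: s => [|i s IH]; first by left; rewrite big_nil.
rewrite big_cons; case: ifP => Qi; last first.
  by case: IH => [->|[j /andP[js Qj] ->]]; [left|right; exists j; rewrite // inE js orbT].
case: leP => _; last by right; exists i; rewrite // inE eqxx.
by case: IH => [->|[j /andP[js Qj] ->]]; [left|right; exists j; rewrite // inE js orbT].
Qed.

Lemma le_bigmax_mem {d} {T : orderType d} {I : eqType} (x0 : T) (s : seq I) (Q : pred I)
    (F : I -> T) i : i \in s -> Q i -> (F i <= \big[Order.max/x0]_(i <- s | Q i) F i)%O.
Proof.
elim: s => // j s IH; rewrite inE big_cons => /orP[/eqP <- ->|is_ Qi].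
  by rewrite le_max lexx.
by case: ifP => _; rewrite ?le_max IH// orbT.
Qed.

Lemma path_pts_ge x w : x.1 <= (last x (path_pts x w)).1 /\ x.2 <= (last x (path_pts x w)).2.
Proof.
by elim: w x => [|[] w IH] x //=; have [] := IH (if true then (x.1 + 1, x.2) else x);
  have [] := IH (x.1, x.2 + 1) => /=; lia.
Qed.

(** The number of steps is a separate argument, for induction on the path. *)
Definition lpp_words om m x y : \bar R :=
  \big[maxe/-oo%E]_(w <- words m | last x (path_pts x w) == y) (passage om x w)%:E.

Lemma lpp_words_beyond om m x y : (y.1 < x.1) || (y.2 < x.2) -> lpp_words om m x y = -oo%E.
Proof.
move=> yx; rewrite /lpp_words big1 // => w /eqP wy.
by have := path_pts_ge x w; rewrite wy; case/orP: yx; lia.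
Qed.

Lemma lpp_wordsS om m x y : lpp_words om m.+1 x y =
  maxe ((om (x.1 + 1, x.2)%R)%:E + lpp_words om m (x.1 + 1, x.2)%R y)%E
       ((om (x.1, x.2 + 1)%R)%:E + lpp_words om m (x.1, x.2 + 1)%R y)%E.
Proof.
have morph c m' x' : (c%:E + lpp_words om m' x' y)%E =
    \big[maxe/-oo%E]_(w <- words m' | last x' (path_pts x' w) == y) (c + passage om x' w)%:E.
  apply: (big_morph (fun z : \bar R => c%:E + z)%E) => // u v.
  by rewrite adde_maxr.
rewrite !morph /lpp_words /= cats0 big_cat !big_map.
by congr maxe; apply: eq_bigr => w _; rewrite /passage /= big_cons.
Qed.

(** Removing the first step of a path matches the last step of the recursion, since coordinates are
    read backwards from [y]. The shift by one puts the weight of [y] at [(1, 1)], next to weightless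
    axes. *)
Lemma lpp_words_lpp om y (a b : nat) : (forall p, 0 <= om p) ->
  let W := fun a b : nat => om (y.1 + 1 - a%:Z, y.2 + 1 - b%:Z) in
  lpp_words om (a + b) (y.1 - a%:Z, y.2 - b%:Z) y =
  (Num.max (lpp 0 0 W a b.+1) (lpp 0 0 W a.+1 b))%:E.
Proof.
move=> om0 W; have W0 (x z : nat) : 0 <= W x z by exact: om0.
have G0 (x z : nat) : 0 <= lpp 0 0 W x z by exact: lpp_ge0.
have Gx (x : nat) : lpp 0 0 W x 0 = 0.
  by elim: x => [|x IH]; rewrite ?lpp00// lppS0 IH mul0r addr0.
have Gz z : lpp 0 0 W 0 z = 0.
  by elim: z => [|z IH]; rewrite ?lpp00// lpp0S IH mul0r addr0.
have ptE (u v u' v' : int) : u = u' -> v = v' -> om (u, v) = om (u', v') by move=> -> ->.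
move: a b; apply: lpp_ind => [|a IH|b IH|a b IH1 IH2].
- rewrite /lpp_words Gx Gz maxxx big_cons big_nil /passage /= big_nil !subr0 -surjective_pairing eqxx.
  by rewrite max_l// leNye.
- rewrite addSn lpp_wordsS /=.
  have -> : lpp_words om (a + 0) (y.1 - a.+1%:Z, y.2 - 0%:Z + 1) y = -oo%E.
    by apply: lpp_words_beyond => /=; lia.
  have -> : y.1 - a.+1%:Z + 1 = y.1 - a%:Z by lia.
  rewrite IH addeNy maxeNy -EFinD !Gx [in RHS]max_l// lppSS Gx.
  by congr (_ + _)%:E; apply: ptE; lia.
- rewrite addnS lpp_wordsS /=.
  have -> : lpp_words om (0 + b) (y.1 - 0%:Z + 1, y.2 - b.+1%:Z) y = -oo%E.
    by apply: lpp_words_beyond => /=; lia.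
  have -> : y.2 - b.+1%:Z + 1 = y.2 - b%:Z by lia.
  rewrite IH addeNy maxNye -EFinD !Gz [in RHS]max_r// lppSS Gz.
  by congr (_ + _)%:E; apply: ptE; lia.
- rewrite addSn lpp_wordsS /=.
  have -> : y.1 - a.+1%:Z + 1 = y.1 - a%:Z by lia.
  have -> : y.2 - b.+1%:Z + 1 = y.2 - b%:Z by lia.
  rewrite IH1 addnS -addSn IH2 -!EFinD -EFin_max (lppSS _ _ _ a) (lppSS _ _ _ a.+1).
  by congr (Num.max (_ + _) (_ + _))%:E; apply: ptE; lia.
Qed.

(* The starting point [(j, -j)] carries no weight, hence the maximum over its two
   successors. *)
Lemma Lk_lpp om (j : int) y (a b : nat) : (forall p, 0 <= om p) ->
  y.1 - j = a%:Z -> y.2 + j = b%:Z ->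
  let W := fun a b : nat => om (y.1 + 1 - a%:Z, y.2 + 1 - b%:Z) in
  Lk om j y = (Num.max (lpp 0 0 W a b.+1) (lpp 0 0 W a.+1 b))%:E.
Proof.
move=> om0 ya yb W; rewrite -lpp_words_lpp// /Lk /LPP /= -/(lpp_words _ _ _ _).
by congr lpp_words; [lia|congr pair; lia].
Qed.

Lemma mem_Cset (x : pt) (k : int) : 0 <= x.1 + x.2 ->
  (k \in Cset x) = (- x.2 <= k <= x.1).
Proof.
move=> x0; rewrite /Cset x0; apply/mapP/idP => [[i]|kx].
  by rewrite mem_iota => /andP[_ ix] ->; lia.
by exists (absz (k + x.2)); rewrite ?mem_iota; lia.
Qed.

(** The value at 0 is not [-oo], so the maximum is attained at some index and the set of maximizers
    defining [Zb] is nonempty. *)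
Lemma Zb_maximizes (b : int -> \bar R) om x : 0 <= x.1 -> 0 <= x.2 -> (b 0%R + Lk om 0%R x != -oo)%E ->
  Zb b om x \in Cset x /\
  (b 0%R + Lk om 0%R x <= b (Zb b om x) + Lk om (Zb b om x) x)%E.
Proof.
move=> x1 x2 b0; have x0 : 0 <= x.1 + x.2 by rewrite addr_ge0.
have C0 : 0 \in Cset x by rewrite mem_Cset//; lia.
have le0 : (b 0%R + Lk om 0%R x <= Lb b om x)%E.
  exact: (le_bigmax_mem -oo%E (fun k => b k + Lk om k x)%E C0).
have [j jC jE] : exists2 j, j \in Cset x & (b j + Lk om j x)%E == Lb b om x.
  case: (bigmax_attained -oo%E (Cset x) predT (fun k => b k + Lk om k x)%E) => [h|].
    by move: le0 b0; rewrite /Lb h leeNy_eq => /eqP ->.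
  by case=> j /andP[jC _] h; exists j => //; apply/eqP/esym; exact: h.
suff [ZC /eqP ZE] : Zb b om x \in Cset x /\
    (b (Zb b om x) + Lk om (Zb b om x) x)%E == Lb b om x by rewrite ZE.
have jZ : j <= Zb b om x by exact: (le_bigmax_mem (- x.2) id jC jE).
case: (bigmax_attained (- x.2) (Cset x)
  (fun k => (b k + Lk om k x)%E == Lb b om x) id) => [h|[i /andP[iC iE] h]].
  (* The default value [- x.2] is the least element of [Cset x]; if the maximum equals it, the
     maximizer [j] is that element. *)
  suff <- : j = Zb b om x by [].
  apply/eqP; rewrite eq_le jZ /= /Zb h.
  by move: jC; rewrite mem_Cset// => /andP[].
by rewrite /Zb h.
Qed.

End passage_times.

(** * Measurability of the exit point *)

Section measurable_exit.
Context {R : realType} {d} {T : measurableType d}.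

(** The maximum depends on finitely many measurable conditions only, so every property of it is
    measurable; the induction needs [Q] arbitrary. *)
Lemma measurable_bigmax_set (s : seq int) (x0 : int) (p : int -> T -> bool) (Q : int -> Prop) :
  (forall k, measurable [set t | p k t]) ->
  measurable [set t | Q (\big[Num.max/x0]_(k <- s | p k t) k)].
Proof.
move=> mp; elim: s Q => [|k s IH] Q.
  have [Qx|nQ] := pselect (Q x0).
    by rewrite (_ : [set t | _] = setT)//; apply/seteqP; split => t //= _; rewrite big_nil.
  by rewrite (_ : [set t | _] = set0)//; apply/seteqP; split => t //=; rewrite big_nil.
have -> : [set t | Q (\big[Num.max/x0]_(i <- k :: s | p i t) i)] =
    ([set t | p k t] `&` [set t | Q (Num.max k (\big[Num.max/x0]_(i <- s | p i t) i))]) `|`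
    (~` [set t | p k t] `&` [set t | Q (\big[Num.max/x0]_(i <- s | p i t) i)]).
  apply/seteqP; split => t /=; rewrite big_cons; case: ifP => pk.
  - by left.
  - by right.
  - by case=> -[].
  - by case=> -[].
apply: measurableU; apply: measurableI => //.
- exact: (IH (fun z => Q (Num.max k z))).
- exact: measurableC.
Qed.

Lemma measurable_bigmaxe {I : Type} (s : seq I) (p : pred I) (F : I -> T -> \bar R) :
  (forall i, measurable_fun setT (F i)) ->
  measurable_fun setT (fun t => \big[maxe/-oo%E]_(i <- s | p i) F i t).
Proof.
move=> mF; elim: s => [|i s IH].
  rewrite (_ : (fun _ => _) = cst -oo%E)//.
  by apply/funext => t; rewrite big_nil.
case: (boolP (p i)) => pi.
  rewrite (_ : (fun _ => _) = fun t => maxe (F i t) (\big[maxe/-oo%E]_(i <- s | p i) F i t)).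
    exact: measurable_maxe.
  by apply/funext => t; rewrite big_cons pi.
rewrite (_ : (fun _ => _) = fun t => \big[maxe/-oo%E]_(i <- s | p i) F i t)//.
by apply/funext => t; rewrite big_cons (negbTE pi).
Qed.

Variables (om : T -> pt -> R) (b : T -> int -> \bar R).
Hypothesis mom : forall p, measurable_fun setT (fun t => om t p).
Hypothesis mb : forall k, measurable_fun setT (fun t => b t k).

Lemma measurable_Lk k x : measurable_fun setT (fun t => Lk (om t) k x).
Proof.
apply: measurable_bigmaxe => w; apply/measurable_EFinP.
by apply: measurable_sum => p.
Qed.

Lemma measurable_Zb x (Q : int -> Prop) : measurable [set t | Q (Zb (b t) (om t) x)].
Proof.
have mF k : measurable_fun setT (fun t => b t k + Lk (om t) k x)%E.
  by apply: emeasurable_funD => //; exact: measurable_Lk.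
have mL : measurable_fun setT (fun t => Lb (b t) (om t) x).
  exact: (measurable_bigmaxe (Cset x) predT mF).
apply: measurable_bigmax_set => k.
rewrite (_ : [set t | _] = setT `&` [set t | (b t k + Lk (om t) k x)%E = Lb (b t) (om t) x]).
  by apply: measurable_eqe => //; exact: mF.
by rewrite setTI; apply/seteqP; split => t /= /eqP.
Qed.

End measurable_exit.

Section positive_part.
Context {R : realType} {d} {T : measurableType d} (P : probability T R).

Lemma has_exponential_law_ge0 (X : T -> R) (l : R) :
  has_exponential_law P X l -> P [set t | X t < 0] = 0%E.
Proof.
move=> lX; have := lX `]-oo, 0[%classic; rewrite /preimage /=.
rewrite (_ : [set t | _] = [set t | X t < 0]); last first.
  by apply/seteqP; split => t /=; rewrite in_itv.
move=> ->//; rewrite /exponential_prob; apply: integral0_eq => x /=.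
rewrite in_itv/= => x0; rewrite /exponential_pdf patchE ifF//.
apply/negbTE/negP; rewrite inE/= in_itv/= andbT leNgt; exact/negP/negPn.
Qed.

Lemma measure_ae_eq (A B C : set T) : measurable A -> measurable B -> measurable C ->
  P C = 0%E -> A `<=` B `|` C -> (P A <= P B)%E.
Proof.
move=> mA mB mC C0 AB; rewrite -[leRHS]adde0 -C0.
apply: le_trans (measureU2 P mB mC).
by apply: le_measure => //; rewrite inE//; exact: measurableU.
Qed.

Lemma has_exponential_law_max0 (X : T -> R) (l : R) : measurable_fun setT X ->
  has_exponential_law P X l -> has_exponential_law P (fun t => Num.max 0 (X t)) l.
Proof.
move=> mX lX A mA; rewrite -lX//.
have mM : measurable_fun setT (fun t => Num.max 0 (X t)) by exact: measurable_maxr.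
have mN : measurable [set t | X t < 0] by exact: measurable_lt_set.
have m1 : measurable ((fun t => Num.max 0 (X t)) @^-1` A) by rewrite -[X in measurable X]setTI; exact: mM.
have m2 : measurable (X @^-1` A) by rewrite -[X in measurable X]setTI; exact: mX.
have XE t : ~~ (X t < 0) -> Num.max 0 (X t) = X t by rewrite -leNgt => /max_r.
by apply/eqP; rewrite eq_le; apply/andP; split;
  apply: (measure_ae_eq _ _ mN (has_exponential_law_ge0 lX)) => // t /=;
  have [?|/XE ->] := boolP (X t < 0); [right|left|right|left].
Qed.

Lemma mutually_independent_comp {I J : eqType} (D : J -> Prop) (D' : I -> Prop)
    (Y : J -> T -> R) (phi : I -> J) (g : R -> R) :
  measurable_fun setT g -> injective phi -> (forall i, D' i -> D (phi i)) ->
  mutually_independent P D Y -> mutually_independent P D' (fun i => g \o Y (phi i)).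
Proof.
move=> mg phi_inj DD iY s B us sD mB.
apply: (mutually_independent_indep (f := phi) (g := fun=> g) iY) => //.
- by rewrite map_inj_uniq.
- by move=> i /sD; exact: DD.
Qed.

End positive_part.

(** * Tails of the exit point *)

Section exit_tail_limit.
Context {R : realType} {d} {T : measurableType d} (P : probability T R).

Lemma limf_esup_eq0 {X : topologicalType} (F : set_system X) (f : X -> \bar R) :
  ProperFilter F -> (forall x, 0 <= f x)%E ->
  (forall e : R, 0 < e -> \forall x \near F, (f x <= e%:E)%E) -> limf_esup f F = 0%E.
Proof.
move=> FF f0 fe; apply/eqP; rewrite eq_le; apply/andP; split; last first.
  by apply: limf_esup_ge0 => //; exact: filter_not_empty.
apply/lee_addgt0Pr => e e0; rewrite add0e.
apply: (@le_trans _ _ (ereal_sup (f @` [set x | (f x <= e%:E)%E]))).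
  by apply: ereal_inf_lbound; exists [set x | (f x <= e%:E)%E] => //; exact: fe.
by apply: ge_ereal_sup => _ [x /= fx <-].
Qed.

Definition exit_event (b : T -> int -> \bar R) (om : T -> pt -> R) (C r : R) (n : nat) :=
  [set t | r * (n%:R `^ (2%:R / 3%:R)) <=
     ((`|Zb (b t) (om t) (brkR (C * (n%:R `^ (2%:R / 3%:R))) n)|%R : int)%:~R)].

Lemma exit_tail_eq0 (b : T -> int -> \bar R) (om : T -> pt -> R) (C K c r0 : R) :
  0 <= K -> 0 < c ->
  (forall r, r0 <= r -> exists n0, forall n, (n0 <= n)%N ->
    (P (exit_event b om C r n) <= (K * expR (- (c * r ^+ 3)))%:E)%E) ->
  exit_tail P b om C = 0%E.
Proof.
move=> K0 c0 H; apply: limf_esup_eq0 => [r|e e0].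
  apply: limf_esup_ge0 => [|n]; last exact: measure_ge0.
  exact: filter_not_empty.
near=> r.
have r1 : 1 <= r by near: r; exact: (nbhs_pinfty_ge (num_real _)).
have [n0 Hn] : exists n0, forall n, (n0 <= n)%N ->
    (P (exit_event b om C r n) <= (K * expR (- (c * r ^+ 3)))%:E)%E.
  by apply: H; near: r; exact: (nbhs_pinfty_ge (num_real _)).
have rK : K / (c * e) <= r by near: r; exact: (nbhs_pinfty_ge (num_real _)).
(* [K <= e * (c * r) <= e * (c * r ^+ 3)], and the exponential exceeds its argument. *)
have small : K * expR (- (c * r ^+ 3)) <= e.
  have rr : r <= r ^+ 3 by rewrite exprS ler_peMr ?exprn_ege1// (le_trans _ r1).
  rewrite expRN ler_pdivrMr ?expR_gt0//.
  apply: (@le_trans _ _ (e * (c * r))).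
    by move: rK; rewrite ler_pdivrMr ?mulr_gt0// => /le_trans; apply; rewrite mulrC mulrCA mulrA.
  rewrite ler_pM2l//; apply: le_trans (expR_ge1Dx _).
  by rewrite -[leLHS]add0r lerD// ler_pM2l.
apply: (@le_trans _ _ (ereal_sup ((fun n : nat => P (exit_event b om C r n))
    @` [set n | (n0 <= n)%N]))).
  apply: ereal_inf_lbound; exists [set n | (n0 <= n)%N] => //.
  exact: nbhs_infty_ge.
apply: ge_ereal_sup => _ [n /= n0n <-].
by apply: le_trans (Hn _ n0n) _; rewrite lee_fin.
Unshelve. all: by end_near.
Qed.

End exit_tail_limit.

Section scaling.
Context {R : realType}.

Lemma scaling_exponents (n : nat) : (0 < n)%N ->
  let del := n%:R `^ (- 3%:R^-1) : R in let X := n%:R `^ (2%:R / 3%:R) in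
  [/\ 0 < del, n%:R * del = X & X * del ^+ 2 = 1].
Proof.
move=> n0 del X; have nR : 0 < n%:R :> R by rewrite ltr0n.
have n10 : n%:R != 0 :> R by rewrite gt_eqF.
split; first exact: powR_gt0.
- rewrite -{1}[n%:R](powRr1 (ltW nR)) -powRD ?n10 ?implybT//.
  by congr (_ `^ _); field.
- rewrite -powR_mulrn ?powR_ge0// -powRrM -powRD ?n10 ?implybT//.
  by rewrite [X in _ `^ X](_ : _ = 0) ?powRr0//; field.
Qed.

Lemma scaling_small (eta : R) : 0 < eta ->
  exists n0, forall n, (n0 <= n)%N -> (0 < n)%N /\ n%:R `^ (- 3%:R^-1) <= eta.
Proof.
move=> eta0; exists (Num.truncn (eta^-1 ^+ 3)).+1 => n nn; split; first exact: leq_ltn_trans nn.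
have nR : eta^-1 ^+ 3 <= n%:R.
  by apply: le_trans (ltW (truncnS_gt _)) _; rewrite ler_nat.
have eta1 : 0 <= eta^-1 by rewrite invr_ge0 ltW.
rewrite powRN -[leRHS]invrK lef_pV2 ?posrE ?invr_gt0//; last first.
  by apply: powR_gt0; apply: lt_le_trans nR; rewrite exprn_gt0 ?invr_gt0.
have -> : eta^-1 = (eta^-1 ^+ 3) `^ 3%:R^-1.
  by rewrite -powR_mulrn// -powRrM mulfV// powRr1.
by apply: ge0_ler_powR => //; rewrite ?nnegrE ?exprn_ge0// invr_ge0.
Qed.

End scaling.

(** * From a distant exit point to a late rise *)

Section exit_dichotomy.
Context {R : realType}.
Implicit Types (om : pt -> R) (A B M k m : nat) (eps : R).

(* Weights read backwards from [(A + 1, B + 1)]: paths ending at [(A, B)] become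
   paths from the origin, with no weight on the axes. *)
Definition corner_weight om A B : nat -> nat -> R :=
  fun a b => om (A%:Z + 1 - a%:Z, B%:Z + 1 - b%:Z).

(** The event of [one_sided_bound] based at [(A, B + 1)], which stands for one of the two successors
    of the starting point [(0, 0)]. *)
Definition late_rise (W : nat -> nat -> R) A B M eps :=
  exists2 m, (m <= A)%N && (M <= m)%N &
    - (3 / 8 * eps * m%:R) <= lpp 0 0 W (A - m) (B.+1 + m) - lpp 0 0 W A B.+1.

(** The best path from a starting point goes through one of its two successors, at antidiagonal
    distance [k] or [k - 1]. The slope [3 / 16], half of [3 / 8], suffices for both because
    [k <= 2 * (k - 1)]. *)
Lemma le_max_rise (eps c u v D : R) k : (1 < k)%N -> 0 <= eps ->
  c <= 3 / 16 * eps * k%:R -> D <= c + Num.max u v ->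
  - (3 / 8 * eps * k%:R) <= u - D \/ - (3 / 8 * eps * k.-1%:R) <= v - D.
Proof.
case: k => [//|k] /= k1 eps0; have kR : 1 <= k%:R :> R by rewrite ler1n.
have ek : eps <= eps * k%:R by rewrite ler_peMr.
rewrite -(natr1 k) => cE; case: (leP u v) => uv DE; [right|left]; lra.
Qed.

(** The exit point is at least as good as 0, so its passage time makes up for all but the profile. A
    negative exit point becomes a positive one after exchanging the axes; the strict [M < k] leaves
    room for [k - 1]. *)
Lemma exit_dichotomy om (pf : int -> \bar R) A B M eps : (forall p, 0 <= om p) ->
  (0 < M)%N -> 0 <= eps -> pf 0 = 0%E ->
  (forall k, (k <= A)%N -> (M <= k)%N -> (pf (k%:Z)%R <= (3 / 16 * eps * k%:R)%:E)%E) ->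
  (forall k, (pf (- k%:Z)%R <= 0)%E) ->
  (M < absz (Zb pf om (A%:Z, B%:Z)))%N ->
  late_rise (corner_weight om A B) A B M eps \/
  late_rise (fun a b => corner_weight om A B b a) B A M eps.
Proof.
move=> om0 M0 eps0 pf0 pfR pfL MZ; set x : pt := (A%:Z, B%:Z) in MZ *.
set W := corner_weight om A B.
have L0 : Lk om 0 x = (Num.max (lpp 0 0 W A B.+1) (lpp 0 0 W A.+1 B))%:E.
  by apply: Lk_lpp => //=; lia.
have L0N : (pf 0%R + Lk om 0%R x != -oo)%E by rewrite pf0 add0e L0.
have [ZC] := Zb_maximizes (x := x) (isT : 0 <= x.1) (isT : 0 <= x.2) L0N.
rewrite pf0 add0e L0 => le0.
move: ZC; rewrite mem_Cset//= => /andP[Z1 Z2].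
move: (Zb pf om x) Z1 Z2 MZ le0 => [k|k'] /= Z1 Z2 MZ le0.
- have kA : (k <= A)%N by lia.
  have e1 : x.1 - k%:Z = (A - k)%N%:Z by rewrite /=; lia.
  have e2 : x.2 + k%:Z = (B + k)%N%:Z by rewrite /=; lia.
  rewrite (Lk_lpp om0 e1 e2) -/W in le0.
  have k1 : (1 < k)%N := leq_ltn_trans M0 MZ.
  have := le_trans le0 (leeD2r _ (pfR k kA (ltnW MZ))).
  rewrite -EFinD lee_fin ge_max => /andP[/(le_max_rise k1 eps0 (lexx _)) h _].
  left; case: h => h; [exists k|exists k.-1].
  + by rewrite kA ltnW.
  + by rewrite addSn.
  + by apply/andP; split; lia.
  + by move: h; congr (_ <= lpp _ _ _ _ _ - _); lia.
- set k := k'.+1 in MZ; have kB : (k <= B)%N by lia.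
  rewrite NegzE -/k in le0.
  have e1 : x.1 - - k%:Z = (A + k)%N%:Z by rewrite /=; lia.
  have e2 : x.2 + - k%:Z = (B - k)%N%:Z by rewrite /=; lia.
  rewrite (Lk_lpp om0 e1 e2) -/W in le0.
  have k1 : (1 < k)%N := leq_ltn_trans M0 MZ.
  have := le_trans le0 (leeD2r _ (pfL k)).
  rewrite -EFinD lee_fin ge_max maxC => /andP[_ h].
  have c0 : 0 <= 3 / 16 * eps * k%:R by rewrite !mulr_ge0.
  have {}h := le_max_rise k1 eps0 c0 h.
  right; rewrite /late_rise -!(lpp_transpose 0 0 W).
  case: h => h; [exists k|exists k.-1].
  + by rewrite kB ltnW.
  + by rewrite -(lpp_transpose 0 0 W) addSn.
  + by apply/andP; split; lia.
  + rewrite -(lpp_transpose 0 0 W).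
    by move: h; congr (_ <= lpp _ _ _ _ _ - _); lia.
Qed.

End exit_dichotomy.

Section corner.
Context {R : realType}.

Lemma brk_corner (n c : nat) : (c <= n)%N -> brk c%:Z n = ((n + c)%N%:Z, (n - c)%N%:Z).
Proof. by move=> cn; rewrite /brk; congr pair; lia. Qed.

Lemma corner_sum (n c : nat) : (c <= n)%N -> (n + c + (n - c) = n + n)%N.
Proof. lia. Qed.

Lemma corner_width (n c : nat) (z : R) : (c <= n)%N -> c%:R <= z ->
  `|(n - c).+1%:R - (n + c)%:R| <= 2 * z + 3 /\ `|(n + c).+1%:R - (n - c)%:R| <= 2 * z + 3.
Proof.
move=> cn cz; have c0 : 0 <= c%:R :> R by [].
rewrite -(natr1 (n - c)) -(natr1 (n + c)) natrD natrB//.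
by split; rewrite ler_norml; apply/andP; split; lra.
Qed.

(** [M] is the integer part of [y] minus one, so that [M < k] holds strictly as soon as [y <= k]. *)
Lemma cutoff (y : R) : 2 <= y ->
  exists2 M, (0 < M)%N & y - 2 <= M%:R /\ forall k : nat, y <= k%:R -> (M < k)%N.
Proof.
move=> y2; have y0 : 0 <= y by lra.
have t2 : (2 <= Num.truncn y)%N by rewrite truncn_ge_nat.
exists (Num.truncn y).-1; first by case: Num.truncn t2 => [|[]].
have tE := prednK (ltnW t2); split.
  have := truncnS_gt y; rewrite -{1}tE -(natr1 (_.-1.+1)) -(natr1 (_.-1)); lra.
by move=> k yk; rewrite tE -(ler_nat R) (le_trans _ yk)// truncn_le.
Qed.

Definition corner_site (A B : nat) (p : nat * nat) : pt :=
  (A%:Z + 1 - p.1%:Z, B%:Z + 1 - p.2%:Z).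

Definition swap_pair (p : nat * nat) := (p.2, p.1).

Lemma corner_site_inj A B : injective (corner_site A B).
Proof. by move=> [a a'] [a2 a2'] /= [] h1 h2; congr pair; lia. Qed.

(** With end point on the antidiagonal of sum [N], the triangle of size [N + 1] reads weights
    strictly above the antidiagonal of sum 0, where the law of the weights is given. *)
Lemma corner_site_gt0 A B N p : (A + B = N)%N -> used_site (N + 1) p ->
  0 < (corner_site A B p).1 + (corner_site A B p).2.
Proof. by case: p => a a' AB /andP[_ /=]; lia. Qed.

Lemma swap_pair_inj : injective swap_pair.
Proof. by move=> [a a'] [a2 a2'] [-> ->]. Qed.

Lemma used_site_swap N p : used_site N p -> used_site N (swap_pair p).
Proof.
case: p => a a' /andP[/= p0 aN]; apply/andP; split; last by rewrite /= addnC.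
by apply: contra p0 => /eqP[-> ->].
Qed.

Lemma truncn_floor_nat (z : R) (n : nat) : 0 <= z -> z <= n%:R ->
  exists2 c : nat, Num.floor z = c%:Z & (c <= n)%N /\ c%:R <= z.
Proof.
move=> z0 zn; exists (Num.truncn z).
  by rewrite truncn_floor z0 gez0_abs// floor_ge0.
have cz : (Num.truncn z)%:R <= z by rewrite truncn_le.
by split => //; rewrite -(ler_nat R) (le_trans cz).
Qed.

End corner.

Section exit_bound.
Context {R : realType} {d} {T : measurableType d} (P : probability T R).
Variable om : T -> pt -> R.
Hypothesis mom : forall p, measurable_fun setT (fun t => om t p).
Hypothesis om0 : forall t p, 0 <= om t p.
Hypothesis iom : mutually_independent P (fun x : pt => 0 < x.1 + x.2) (fun x t => om t x).
Hypothesis lom : forall x : pt, 0 < x.1 + x.2 -> has_exponential_law P (fun t => om t x) 1.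

Local Notation tail r := (expR (- (kappa ^+ 3 * r ^+ 3))).

(** The embedding [phi] of the quadrant is left free, so that the reflected model is covered too. *)
Lemma late_rise_le (phi : nat * nat -> pt) (n A B M : nat) (r del X C : R) :
  injective phi ->
  (forall p, used_site (n + n + 1) p -> 0 < (phi p).1 + (phi p).2) ->
  (A + B = n + n)%N -> 0 < del -> n%:R * del = X -> X * del ^+ 2 = 1 -> 0 <= C ->
  `|B.+1%:R - A%:R| <= 2 * C * X + 3 ->
  300 * (300 * (C + 1)) <= r -> r * del <= 1 / 10 -> r * X - 2 <= M%:R ->
  let E := [set t | late_rise (fun a b => om t (phi (a, b))) A B M (r * del / 64)] in
  measurable E /\ (P E <= (6 * tail r)%:E)%E.
Proof.
move=> phi_inj phiD AB del0 nX XE C0 BA rC rdel rM E.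
have mW a b : measurable_fun setT (fun t => om t (phi (a, b))) by exact: mom.
split.
  apply: measurable_bounded_ex => j; apply: measurable_le_set => //.
  by apply: measurable_funB; exact: (measurable_lpp 0 0 _ _ mW).
have iW : mutually_independent P (used_site (n + n + 1)) (fun p t => om t (phi (p.1, p.2))).
  rewrite (_ : (fun p t => _) = (fun p => id \o (fun t => om t (phi p)))); last first.
    by apply/funext => -[].
  exact: (mutually_independent_comp (Y := fun x t => om t x) _ phi_inj phiD iom).
have lW p : used_site (n + n + 1) p -> has_exponential_law P (fun t => om t (phi (p.1, p.2))) 1.
  by case: p => a b /phiD /lom.
have ABE : (A + B.+1 = n + n + 1)%N by rewrite addnS AB addn1.
exact: (@one_sided_bound _ _ _ P (fun a b t => om t (phi (a, b))) n _ A B.+1 M r del X C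
  mW (fun a b t => om0 t _) iW lW erefl ABE del0 nX XE C0 BA rC rdel rM).
Qed.

(** The constant is 6 for each side and 1 for the growth of the profile. *)
Lemma exit_event_le (b : T -> int -> \bar R) (n : nat) (r C : R) :
  forall del X : R, del = n%:R `^ (- 3%:R^-1) -> X = n%:R `^ (2%:R / 3%:R) ->
  (forall k, measurable_fun setT (fun t => b t k)) ->
  (forall t, b t 0 = 0%E) -> (forall t (k : nat), (b t (- k%:Z)%R <= 0)%E) ->
  (forall A M : nat, r * X - 2 <= M%:R ->
    (P [set t | exists2 k, (k <= A)%N && (M <= k)%N &
       ((3 / 16 * (r * del / 64) * k%:R)%:E < b t (k%:Z)%R)%E] <= (tail r)%:E)%E) ->
  (0 < n)%N -> 0 <= C -> C * del <= 1 ->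
  300 * (300 * (C + 1)) <= r -> r * del <= 1 / 10 ->
  (P (exit_event b om C r n) <= (13 * tail r)%:E)%E.
Proof.
move=> del X delE XdE mb b0 bneg bpos n0 C0 Cdel rC rdel.
have [del0 nX XE] : [/\ 0 < del, n%:R * del = X & X * del ^+ 2 = 1].
  by rewrite delE XdE; exact: scaling_exponents n0.
have [del1 r1] := scale_del C0 del0 rC rdel.
have [X1 _] := scale_X del0 nX XE del1 (ler0n R n).
have [rX300 _] := scale_y C0 X1 rC.
have CX0 : 0 <= C * X by rewrite mulr_ge0// (le_trans ler01).
have CXn : C * X <= n%:R by rewrite -nX mulrCA ler_piMr.
have [c cE [cn cX]] := truncn_floor_nat CX0 CXn.
pose A := (n + c)%N; pose B := (n - c)%N.
have brkE : brkR (C * X) n = (A%:Z, B%:Z) by rewrite /brkR cE brk_corner.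
have [M M0 [rM Mr]] := cutoff (le_trans (ler_nat R 2 300) rX300).
have [BA1 BA2] := corner_width cn cX; rewrite -/A -/B in BA1 BA2.
have AB : (A + B = n + n)%N := corner_sum cn.
pose eps := r * del / 64.
have eps0 : 0 <= eps by rewrite divr_ge0// mulr_ge0// ?(le_trans ler01 r1)// ltW.
pose E1 := [set t | late_rise (corner_weight (om t) A B) A B M eps].
pose E2 := [set t | late_rise (fun x y => corner_weight (om t) A B y x) B A M eps].
pose E3 := [set t | exists2 k, (k <= A)%N && (M <= k)%N &
  ((3 / 16 * eps * k%:R)%:E < b t (k%:Z)%R)%E].
have [mE1 PE1] : measurable E1 /\ (P E1 <= (6 * tail r)%:E)%E.
  apply: (late_rise_le (phi := corner_site A B) _ _ AB del0 nX XE C0 _ rC rdel rM).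
  - exact: corner_site_inj.
  - by move=> p; exact: corner_site_gt0.
  - by rewrite -mulrA.
have [mE2 PE2] : measurable E2 /\ (P E2 <= (6 * tail r)%:E)%E.
  have BA : (B + A = n + n)%N by rewrite addnC.
  apply: (late_rise_le (phi := corner_site A B \o swap_pair) _ _ BA del0 nX XE C0 _ rC rdel rM).
  - by apply: inj_comp; [exact: corner_site_inj|exact: swap_pair_inj].
  - by move=> p /used_site_swap; exact: corner_site_gt0.
  - by rewrite -mulrA.
have PE3 : (P E3 <= (tail r)%:E)%E := bpos A M rM.
have mE3 : measurable E3.
  apply: measurable_bounded_ex => k.
  rewrite -[X in measurable X]setTI.
  by apply: measurable_lte => //; exact: mb.
have sub : exit_event b om C r n `<=` E1 `|` E2 `|` E3.
  move=> t; rewrite /exit_event /= -XdE brkE -natr_absz => /Mr MZ.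
  have [?|nE3] := pselect (E3 t); first by right.
  left; apply: (exit_dichotomy (om0 t) M0 eps0 (b0 t) _ (bneg t) MZ) => k kA Mk.
  by rewrite leNgt; apply/negP => h; apply: nE3; exists k; rewrite ?kA.
have -> : (13 * tail r)%:E = ((6 * tail r)%:E + (6 * tail r)%:E + (tail r)%:E)%E.
  by rewrite -!EFinD; congr EFin; clear; ring.
apply: (le_trans _ (leeD (leeD PE1 PE2) PE3)).
apply: (@le_trans _ _ (P (E1 `|` E2 `|` E3))).
  apply: le_measure; rewrite ?inE//; last by do 2 apply: measurableU => //.
  rewrite /exit_event -XdE; exact: (measurable_Zb mom mb _ (fun z => r * X <= (`|z|%R : int)%:~R)).
apply: (le_trans (measureU2 P _ mE3)); first by apply: measurableU.
by apply: leeD => //; exact: measureU2.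
Qed.

End exit_bound.

Section exit_tail_nonneg.
Context {R : realType} {d} {T : measurableType d} (P : probability T R).

(** Up to the error probability of the other estimates, the profile rises with at most half the
    slope of the drop. Only positive [k] matter: the profiles treated are nonpositive on the
    left. *)
Definition slow_growth (b : T -> int -> \bar R) := forall (r del X : R) (A M : nat),
  0 < del -> X * del ^+ 2 = 1 -> 300 <= r * X -> 1 <= r -> r * del <= 1 / 10 ->
  r * X - 2 <= M%:R ->
  (P [set t | exists2 k, (k <= A)%N && (M <= k)%N &
     ((3 / 16 * (r * del / 64) * k%:R)%:E < b t (k%:Z)%R)%E] <=
   (expR (- (kappa ^+ 3 * r ^+ 3)))%:E)%E.

Lemma exit_tail_nonneg (om : T -> pt -> R) (b : T -> int -> \bar R) (C : R) :
  (forall p, measurable_fun setT (fun t => om t p)) -> (forall t p, 0 <= om t p) ->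
  mutually_independent P (fun x : pt => 0 < x.1 + x.2) (fun x t => om t x) ->
  (forall x : pt, 0 < x.1 + x.2 -> has_exponential_law P (fun t => om t x) 1) ->
  (forall k, measurable_fun setT (fun t => b t k)) ->
  (forall t, b t 0 = 0%E) -> (forall t (k : nat), (b t (- k%:Z)%R <= 0)%E) ->
  slow_growth b -> 0 <= C -> exit_tail P b om C = 0%E.
Proof.
move=> mom om0 iom lom mb b0 bneg bpos C0.
have k30 : 0 < kappa ^+ 3 :> R by rewrite exprn_gt0// kappa_gt0.
apply: (exit_tail_eq0 (K := 13) (r0 := 300 * (300 * (C + 1))) _ k30) => // r rC.
have C1 : 0 < C + 1 by rewrite ltr_wpDl.
have r0 : 0 < r by move: C0 rC; clear; lra.
(* The two terms ensure [r * del <= 1 / 10], which keeps the densities near [1 / 2], and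
   [C * del <= 1], which keeps the end point in the quadrant. *)
have eta0 : 0 < Num.min (10 * r)^-1 (C + 1)^-1 by rewrite lt_min !invr_gt0 C1 mulr_gt0.
have [n0 Hn0] := scaling_small eta0; exists n0 => n /Hn0[n_gt0 {Hn0}].
have [del0 nX XE] := @scaling_exponents R n n_gt0.
set del := _ `^ (- _) in del0 nX XE *; rewrite le_min => /andP[del1 del2].
have rdel : r * del <= 1 / 10.
  have -> : 1 / 10 = r * (10 * r)^-1 by field; rewrite gt_eqF.
  by rewrite ler_pM2l.
have Cdel : C * del <= 1.
  move: del2; rewrite -(ler_pM2l C1) mulfV ?gt_eqF// => /(le_trans _); apply.
  by rewrite ler_wpM2r ?lerDl// ltW.
have [del10 r1] := scale_del C0 del0 rC rdel.
have [X1 _] := scale_X del0 nX XE del10 (ler0n R n).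
have [rX300 _] := scale_y C0 X1 rC.
apply: (exit_event_le mom om0 iom lom (b := b) (del := del) (n := n)) => // A M.
exact: bpos.
Qed.

End exit_tail_nonneg.

(** * Reduction to nonnegative weights *)

Section positive_part.
Context {R : realType}.
Implicit Types (om : pt -> R) (b : int -> \bar R) (x : pt).

Lemma path_pts_gt x w p : p \in path_pts x w -> x.1 + x.2 < p.1 + p.2.
Proof.
elim: w x => //= c w IH x; rewrite inE => /orP[/eqP ->|/IH].
  by case: c => /=; lia.
by case: c => /=; lia.
Qed.

(** A path starts on the antidiagonal of sum 0 and its starting point is excluded, so only sites of
    positive sum are visited. *)
Lemma eq_Lk om om' k x : (forall p : pt, 0 < p.1 + p.2 -> om p = om' p) ->
  Lk om k x = Lk om' k x.
Proof.
move=> E; apply: eq_bigr => w _; congr EFin; apply: eq_big_seq => p /path_pts_gt /= kp.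
by apply: E; rewrite subrr in kp.
Qed.

Lemma eq_Zb b om om' x : (forall p : pt, 0 < p.1 + p.2 -> om p = om' p) ->
  Zb b om x = Zb b om' x.
Proof.
move=> E; have LE k : (b k + Lk om k x = b k + Lk om' k x)%E by rewrite (eq_Lk _ _ E).
have LbE : Lb b om x = Lb b om' x by apply: eq_bigr.
by apply: eq_bigl => k; rewrite LE LbE.
Qed.

End positive_part.

Section exit_events.
Context {R : realType} {d} {T : measurableType d} (P : probability T R).
Implicit Types (om : T -> pt -> R) (b : T -> int -> \bar R).

Lemma measurable_exit_event b om (C r : R) n :
  (forall p, measurable_fun setT (fun t => om t p)) ->
  (forall k, measurable_fun setT (fun t => b t k)) -> measurable (exit_event b om C r n).
Proof.
move=> mom mb.
exact: (measurable_Zb mom mb (brkR (C * (n%:R `^ (2%:R / 3%:R))) n)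
  (fun z => r * (n%:R `^ (2%:R / 3%:R)) <= (`|z|%R : int)%:~R)).
Qed.

Lemma eq_exit_tail b om om' (C : R) :
  (forall r n, P (exit_event b om C r n) = P (exit_event b om' C r n)) ->
  exit_tail P b om C = exit_tail P b om' C.
Proof.
move=> E; pose f om r n := P (exit_event b om C r n).
have fE : f om = f om' by apply/funext => r; apply/funext => n; exact: E.
transitivity (limf_esup (fun r => limn_esup (f om r)) +oo%R); first by [].
by rewrite fE.
Qed.

End exit_events.

Section exit_tail.
Context {R : realType} {d} {T : measurableType d} (P : probability T R).
Variable om : T -> pt -> R.
Hypothesis mom : forall p, measurable_fun setT (fun t => om t p).
Hypothesis iom : mutually_independent P (fun x : pt => 0 < x.1 + x.2) (fun x t => om t x).
Hypothesis lom : forall x : pt, 0 < x.1 + x.2 -> has_exponential_law P (fun t => om t x) 1.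

Lemma negative_site_null (q : option pt) :
  let N := [set t | if q is Some p then (0 < p.1 + p.2) && (om t p < 0) else false] in
  measurable N /\ P N = 0%E.
Proof.
have Z (A : set T) : (forall t, ~ A t) -> measurable A /\ P A = 0%E.
  by move=> A0; have -> : A = set0; [apply/seteqP; split => // t /A0|rewrite measure0].
case: q => [p|]; last exact: Z.
case: (ltP 0 (p.1 + p.2)) => [p0|_]; last exact: Z.
split; last exact: (has_exponential_law_ge0 (lom p0)).
by apply: measurable_lt_set; [exact: mom|exact: measurable_cst].
Qed.

Lemma negative_sites_null : exists N : set T, [/\ measurable N, P N = 0%E &
  forall t, ~ N t -> forall p : pt, 0 < p.1 + p.2 -> 0 <= om t p].
Proof.
(* The sites are countable; an enumeration turns the exceptional set into a countable union of null
   events. *)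
have [f fK] : exists f : nat -> option pt, forall p, exists i, f i = Some p.
  by exists unpickle => p; exists (pickle p); rewrite pickleK.
pose N i := [set t | if f i is Some p then (0 < p.1 + p.2) && (om t p < 0) else false].
have mN i : measurable (N i) by have [] := negative_site_null (f i).
have mU : measurable (\bigcup_i N i) by exact: bigcup_measurable.
exists (\bigcup_i N i); split => //.
- apply/negligibleP => //; apply: negligible_bigcup => i.
  by apply/negligibleP => //; have [] := negative_site_null (f i).
- move=> t Nt p p0; rewrite leNgt; apply/negP => omp; apply: Nt.
  by have [i fi] := fK p; exists i => //; rewrite /N /= fi p0.
Qed.

(* Comparison needs nonnegative weights everywhere; passing to positive parts
   changes the exit point only on a null event. *)
Lemma exit_tail0 (b : T -> int -> \bar R) (C : R) :
  (forall k, measurable_fun setT (fun t => b t k)) ->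
  (forall t, b t 0 = 0%E) -> (forall t (k : nat), (b t (- k%:Z)%R <= 0)%E) ->
  slow_growth P b -> 0 <= C -> exit_tail P b om C = 0%E.
Proof.
move=> mb b0 bneg bpos C0; pose om' t p := Num.max 0 (om t p).
have mom' p : measurable_fun setT (fun t => om' t p) by exact: measurable_maxr.
have [N [mN PN N0]] := negative_sites_null.
have E t : ~ N t -> forall p : pt, 0 < p.1 + p.2 -> om t p = om' t p.
  by move=> /N0 Nt p /Nt; rewrite /om' => /max_r.
have <- : exit_tail P b om' C = exit_tail P b om C.
  apply: eq_exit_tail => r n.
  have mE := measurable_exit_event C r n mom mb.
  have mE' := measurable_exit_event C r n mom' mb.
  have Zbt t : ~ N t ->
      Zb (b t) (om t) =1 Zb (b t) (om' t) by move=> /E NE x; exact: eq_Zb.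
  apply/eqP; rewrite eq_le; apply/andP; split; apply: (measure_ae_eq _ _ mN PN) => // t Et.
    have [?|/Zbt ZE] := pselect (N t); first by right.
    by left; move: Et; rewrite /exit_event /= ZE.
  have [?|/Zbt ZE] := pselect (N t); first by right.
  by left; move: Et; rewrite /exit_event /= ZE.
apply: exit_tail_nonneg => //.
- by move=> t p; rewrite /om' le_max lexx.
- have -> : (fun x t => om' t x) = (fun x => (fun z => Num.max 0 z) \o (fun t => om t x)) by [].
  apply: (mutually_independent_comp (Y := fun x t => om t x) (phi := id) _ _ _ iom) => //.
  exact: measurable_maxr.
- by move=> x x0; apply: has_exponential_law_max0 => //; exact: lom.
Qed.

End exit_tail.

(** * Growth of the profiles *)

Section slow_growth.
Context {R : realType} {d} {T : measurableType d} (P : probability T R).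

Lemma slow_growth_nonpos (b : T -> int -> \bar R) :
  (forall t k, (b t k <= 0)%E) -> slow_growth P b.
Proof.
move=> b0 r del X A M del0 XE rX r1 rdel rM.
rewrite (_ : [set t | _] = set0) ?measure0 ?lee_fin ?expR_ge0//.
apply/seteqP; split => // t [k _]; apply/negP; rewrite -leNgt.
by apply: le_trans (b0 _ _) _; rewrite lee_fin !mulr_ge0// ltW// (lt_le_trans _ r1).
Qed.

(** The steps are centred, with moment generating function [1 / (1 - 4 th^2)] at [th], so
    [walk_tail] controls all times [k >= M] at once. *)
Lemma slow_growth_walk (zeta : nat -> T -> R) (b : T -> int -> \bar R) :
  (forall i, measurable_fun setT (zeta i)) ->
  (forall i, (0 < i)%N -> forall A, measurable A -> P (zeta i @^-1` A) = law_X (1 / 2) A) ->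
  mutually_independent P (fun i => (0 < i)%N) zeta ->
  (forall t (k : nat), b t k%:Z = (\sum_(0 <= i < k) zeta i.+1 t)%:E) -> slow_growth P b.
Proof.
move=> mz lz iz bE r del X A M del0 XE rX r1 rdel rM.
have half : 1 - 1 / 2 = 1 / 2 :> R by lra.
(* The divisor 48 gives [8 * th + th = 3 / 16 * (r * del / 64)], the allowed slope. *)
pose th := r * del / 64 / 48.
have th0 : 0 < th by rewrite !divr_gt0// mulr_gt0// (lt_le_trans _ r1).
have th8 : th <= 1 / 8 by rewrite /th; move: rdel; clear; lra.
have iS N : indep P (iota 0 N) (fun i => zeta i.+1).
  apply: (mutually_independent_indep (f := S) (g := fun=> id) iz) => //.
  by rewrite map_inj_uniq ?iota_uniq// => i j [].
have h := @walk_tail _ _ _ P (fun i => zeta i.+1) A M th (8 * th) th th0 (ltW th0)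
  (fun i => mz i.+1) (iS A) _.
have EX i : (i < A)%N -> (\int[P]_t (expR (th * zeta i.+1 t))%:E <= (expR (th * (8 * th)))%:E)%E.
  move=> _; rewrite (@exponential_diff_law_mgf _ _ _ P (zeta i.+1) (1 - 1 / 2) (1 / 2)) //.
  - by rewrite half lee_fin step_mgf_flat.
  - by rewrite half.
  - by move: th8; clear; lra.
  - by move: th0; clear; lra.
  - by move=> B mB; rewrite lz.
rewrite (_ : [set t | _] = [set t | exists2 k, (k <= A)%N && (M <= k)%N &
  (3 / 16 * (r * del / 64) * k%:R < \sum_(0 <= i < k) zeta i.+1 t)%R]); last first.
  by apply/seteqP; split => t /= [k kA h']; exists k => //; move: h'; rewrite bE lte_fin.
have m1 : measurable [set t | exists2 k, (k <= A)%N && (M <= k)%N &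
    ((8 * th + th) * k%:R <= \sum_(0 <= i < k) zeta i.+1 t)%R].
  apply: measurable_bounded_ex => k; apply: measurable_le_set => //.
  by apply: measurable_sum => i; exact: mz.
have m2 : measurable [set t | exists2 k, (k <= A)%N && (M <= k)%N &
    (3 / 16 * (r * del / 64) * k%:R < \sum_(0 <= i < k) zeta i.+1 t)%R].
  apply: measurable_bounded_ex => k; apply: measurable_lt_set => //.
  by apply: measurable_sum => i; exact: mz.
apply: (@le_trans _ _ (P [set t | exists2 k, (k <= A)%N && (M <= k)%N &
    ((8 * th + th) * k%:R <= \sum_(0 <= i < k) zeta i.+1 t)%R])).
  apply: le_measure; rewrite ?inE// => t [k kA kS]; exists k => //; apply: ltW.
  have <- : 3 / 16 * (r * del / 64) = 8 * th + th by rewrite /th; field.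
  exact: kS.
apply: (le_trans (h EX)); rewrite lee_fin ler_expR lerN2.
have r30 : 0 <= r ^+ 3 by rewrite exprn_ge0// (le_trans _ r1).
have h1 : th * th * (r * X / 2) <= th * th * M%:R.
  apply: ler_wpM2l; first by rewrite mulr_ge0// ltW.
  by move: rM rX; clear; lra.
apply: le_trans h1.
have -> : th * th * (r * X / 2) = r ^+ 3 * (X * del ^+ 2) / (64 * 48) / (64 * 48) / 2.
  by rewrite /th; field.
by rewrite XE mulr1 scale_walk.
Qed.

End slow_growth.

Theorem theorem2 (R : realType) (d : measure_display) (T : measurableType d)
  (P : probability T R) (omega : pt -> {RV P >-> R}) :
  (* omega_{i,j}, i+j>0, are i.i.d. Exp(1) *)
  (forall x : pt, 0 < x.1 + x.2 -> forall A : set R, measurable A ->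
     P (omega x @^-1` A) = exponential_prob 1 A) ->
  mutually_independent P (fun x : pt => 0 < x.1 + x.2) (fun x => omega x : T -> R) ->
  forall C : R, 0 <= C ->
  let om := fun t (x : pt) => omega x t in
  [/\ exit_tail P (fun _ => prof_w) om C = 0%E,
      exit_tail P (fun _ => prof_f) om C = 0%E,
      exit_tail P (fun _ => prof_wf) om C = 0%E &
      (* random profiles: zeta_1, zeta_2, ... i.i.d. copies of X(1/2), independent of omega *)
      forall zeta : nat -> {RV P >-> R},
        (forall i : nat, (0 < i)%N -> forall A : set R, measurable A ->
           P (zeta i @^-1` A) = law_X (1 / 2) A) ->
        mutually_independent P
          (fun j : pt + nat => match j with inl x => 0 < x.1 + x.2 | inr i => (0 < i)%N end)
          (fun j => match j with inl x => omega x : T -> R | inr i => zeta i : T -> R end) ->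
        exit_tail P (fun t => prof_ws (fun i => zeta i t)) om C = 0%E /\
        exit_tail P (fun t => prof_fs (fun i => zeta i t)) om C = 0%E].
Proof.
move=> lom iom C C0 om.
have mom p : measurable_fun setT (fun t => om t p) by exact: measurable_funPT.
have tail0 b := @exit_tail0 R d T P om mom iom lom b C.
have nonpos (pf : int -> \bar R) : pf 0 = 0%E -> (forall k, (pf k <= 0)%E) ->
    exit_tail P (fun=> pf) om C = 0%E.
  by move=> pf0 pfN; apply: tail0 => // ; exact: slow_growth_nonpos.
split.
- by apply: nonpos => [|k]; rewrite /prof_w//; case: ifP; rewrite ?leNye.
- exact: nonpos.
- by apply: nonpos => [|k]; rewrite /prof_wf//; case: ifP; rewrite ?leNye.
move=> zeta lz ij.
have mz i : measurable_fun setT (zeta i) by exact: measurable_funPT.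
have mS (k : nat) : measurable_fun setT (fun t => (\sum_(0 <= i < k) zeta i.+1 t)%:E).
  by apply/measurable_EFinP; apply: measurable_sum => i; exact: mz.
have iz : mutually_independent P (fun i => (0 < i)%N) (fun i => zeta i : T -> R).
  move=> s B us sD mB.
  suff iz : indep P s (fun i => zeta i : T -> R) by exact: iz.
  apply: (mutually_independent_indep (f := @inr pt nat) (g := fun=> id) ij) => //.
  rewrite map_inj_uniq// => i j ij'.
  exact: (congr1 (fun z => if z is inr k then k else i) ij').
split; apply: tail0 => //.
- by move=> k; rewrite /prof_ws; case: (ltP k 0).
- by move=> t; rewrite /prof_ws /= big_geq.
- move=> t [|k]; first by rewrite /prof_ws /= big_geq.
  by rewrite /prof_ws.
- exact: (slow_growth_walk mz lz iz).
- by move=> k; rewrite /prof_fs; case: (leP k 0).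
- by move=> t [|k].
- by apply: (slow_growth_walk mz lz iz) => // t [|k]//=; rewrite /prof_fs/= big_geq.
Qed.
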